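(* For every $s\in\mathbb{C}$ the following three identities hold: $$\frac{3}{2}(1-3^{-s})\eta(s)=\sum_{k=1}^{\infty}\frac{(-1)^{k-1}}{(2k)!}\left(\frac{2\pi}{3}\right)^{2k}\eta(s-2k),$$ $$(1-2^{-s})\eta(s)=\sum_{k=1}^{\infty}\frac{(-1)^{k-1}}{(2k)!}\left(\frac{\pi}{2}\right)^{2k}\eta(s-2k),$$ $$\frac{1}{2}(1-2^{2-s}+3^{1-s})\zeta(s)=\sum_{k=1}^{\infty}\frac{(-1)^{k-1}}{(2k)!}\left(\frac{\pi}{3}\right)^{2k}\eta(s-2k),$$ where in the third identity the left-hand side at $s=1$ is understood as its limit as $s\to1$ (the singularity is removable).
   Context: $\zeta(s)$ is the Riemann zeta function (meromorphically continued to $\mathbb{C}$). $\eta(s)$ is the alternating zeta function, the entire function that equals $\sum_{n\ge1}(-1)^{n-1}n^{-s}$ for $\Re(s)>0$; $\eta(s)=(1-2^{1-s})\zeta(s)$. *)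

(* Defs.v *)
From Stdlib Require Import Reals Factorial.
From Coquelicot Require Import Coquelicot.

Definition Cexp (z : C) : C :=
  ((exp (Re z) * cos (Im z))%R, (exp (Re z) * sin (Im z))%R).

(* [a^s = exp (s log a)] with the real logarithm; meaningful for [a > 0] only. *)
Definition pos_cpow (a : R) (s : C) : C := Cexp (s * RtoC (ln a))%C.

Definition holomorphic_at (f : C -> C) (s : C) : Prop :=
  @ex_derive C_AbsRing C_NormedModule f s.

Definition Cis_series (a : nat -> C) (l : C) : Prop :=
  @is_series C_AbsRing C_NormedModule a l.

(* Limit as the argument tends to [s] while staying different from [s]. *)
Definition Cis_lim (f : C -> C) (s l : C) : Prop :=
  filterlim f (@locally' C_UniformSpace s) (@locally C_UniformSpace l).

(* The conditions determine [zeta] on [C \ {1}], by uniqueness of analytic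
   continuation; [zeta 1] is unconstrained, so nothing may depend on it.
   The pole at [1] is a consequence. *)
Definition is_riemann_zeta (zeta : C -> C) : Prop :=
  (forall s : C, s <> RtoC 1 -> holomorphic_at zeta s) /\
  (forall s : C, (1 < Re s)%R ->
     Cis_series (fun n => pos_cpow (INR (S n)) (- s)%C) (zeta s)).

(* With [n] starting at [0], the sign [(-1)^(n-1)] of the [n]-th term of the
   usual indexing becomes [(-1)^n].  The series converges only conditionally
   when [0 < Re s <= 1]. *)
Definition is_alternating_zeta (eta : C -> C) : Prop :=
  (forall s : C, holomorphic_at eta s) /\
  (forall s : C, (0 < Re s)%R ->
     Cis_series (fun n => (RtoC ((-1) ^ n) * pos_cpow (INR (S n)) (- s))%C)
       (eta s)).

Definition eta_term (eta : C -> C) (x : R) (s : C) (k : nat) : C :=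
  (RtoC ((-1) ^ (k - 1) / INR (fact (2 * k)) * x ^ (2 * k)) *
   eta (s - RtoC (INR (2 * k))))%C.

(* [l] is the sum over [k >= 1] of [eta_term eta x s k]. *)
Definition is_eta_expansion (eta : C -> C) (x : R) (s l : C) : Prop :=
  Cis_series (fun j => eta_term eta x s (S j)) l.

(* Main.v *)
(* The alternating zeta function is the integral
   [eta s = 1/2 int_R (1/2 + i t)^(-s) / cosh (pi t) dt]: moving the line of integration of
   [z^(-s) / sin (pi z)] to the right collects the terms of the series as residues, and the
   integral is entire in [s].  Inserting [cos (x z)], [0 <= x < pi], in the integrand gives the
   continuation of [sum (-1)^(n-1) cos (n x) n^(-s)] on one side and, expanding the cosine in
   powers of [x z], the sum over all [k >= 0] of [(-1)^k x^(2k) / (2k)! eta (s - 2k)] on the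
   other.  For [x = 2 pi / 3, pi / 2, pi / 3] the coefficients [cos (n x)] are periodic and the
   Dirichlet series is a combination of dilations of that of [eta] or [zeta].

   As [eta] and [zeta] are only assumed complex differentiable, uniqueness of the continuation
   rests on Goursat's theorem for rectangles: if [F] vanishes near [a], Cauchy's formula for
   [F z / (z - a)^N] with [N -> oo] shows that [F] vanishes on every square centred at [a]. *)
Require Import Defs.
From Stdlib Require Import Reals Factorial Lra Lia.
From Coquelicot Require Import Coquelicot.
Local Open Scope R_scope.
Local Open Scope C_scope.
Bind Scope C_scope with C.
Arguments Cmod x%_C_scope.
Arguments Re z%_C_scope.
Arguments Im z%_C_scope.

(** * Complex differentiability *)

(** The line integral is tied to the series by a recurrence rather than by an infinite contour. For
    an integer [N], [sin (PI z) = (-1)^N cosh (PI t)] on [Re z = N + 1/2], so a single residue says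
    that the integrals over two neighbouring lines add up to [2 f N]. The alternating sum telescopes
    and converges as soon as the last integral tends to zero; no absolute convergence enters, and
    the half-plane [Re s > 0] is reached at once. The bound [x < PI] shapes the estimates:
    [cos (x z)] grows like [exp (x |t|)] against [1 / cosh (PI t)], and the gap has to pay for the
    power [z^(-s)] and for the Taylor remainders of the cosine. Contours are rectangles, and
    [2 i PI] is never computed: Cauchy's formula keeps the integral of [1 / (z - z0)] as a nonzero
    factor, and the residue at [N] is normalised by the explicit integral of [sech]. At [s = 1]
    nothing special happens: a difference of two entire integrals equals the third left-hand side
    away from [1], and its value at [1] is the limit. *)

Definition Cderiv (f : C -> C) (z l : C) : Prop :=
  forall eps : R, (0 < eps)%R -> exists d : R, (0 < d)%R /\
    forall h : C, (Cmod h < d)%R ->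
      (Cmod (f (z + h) - f z - l * h)%C <= eps * Cmod h)%R.

Definition Chol (f : C -> C) (z : C) : Prop := exists l, Cderiv f z l.

(** Both the ball in the domain and the norm on the values in [ex_derive] over [C_AbsRing] are
    [Cmod] up to conversion, so its little-o condition unfolds to the epsilon form. *)
Lemma holomorphic_at_Chol (f : C -> C) (z : C) : holomorphic_at f z -> Chol f z.
Proof.
  intros [l [_ H]]. exists l. intros eps He.
  destruct (H z (fun P HP => HP) (mkposreal eps He)) as [d Hd].
  exists d. split; [apply cond_pos|]. intros h Hh.
  assert (Hm : minus (z + h) z = h).
  { unfold minus, plus, opp; simpl. ring. }
  specialize (Hd (z + h)).
  assert (Hb : @ball (AbsRing_UniformSpace C_AbsRing) z d (z + h)).
  { change (Cmod (minus (z + h) z)%C < d)%R. now rewrite Hm. }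
  specialize (Hd Hb). simpl in Hd.
  assert (E : forall x : C, @norm C_AbsRing C_NormedModule x = Cmod x).
  { reflexivity. }
  rewrite E in Hd.
  change (@norm C_AbsRing (AbsRing_NormedModule C_AbsRing) (minus (z + h) z))
    with (Cmod (minus (z + h) z)%C) in Hd.
  rewrite Hm in Hd.
  replace (f (z + h) - f z - l * h) with
    (minus (minus (f (z + h)) (f z)) (@scal C_AbsRing C_NormedModule (minus (z + h) z) l)); [exact Hd|].
  rewrite Hm. unfold minus, plus, opp, scal, mult; simpl. unfold mult; simpl. ring.
Qed.

Lemma Cmod_minus_sym (a b : C) : Cmod (a - b)%C = Cmod (b - a)%C.
Proof. rewrite <- Cmod_opp. f_equal. ring. Qed.

Lemma Cmod_triangle_minus (a b : C) : (Cmod (a - b)%C <= Cmod a + Cmod b)%R.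
Proof. unfold Cminus. rewrite <- (Cmod_opp b). apply Cmod_triangle. Qed.

Lemma Cmod_le_minus (a b : C) : (Cmod a <= Cmod b + Cmod (a - b)%C)%R.
Proof. replace a with (b + (a - b)) at 1 by ring. apply Cmod_triangle. Qed.

Lemma Cmod_Re_Im (z : C) : (Cmod z <= Rabs (Re z) + Rabs (Im z))%R.
Proof.
  replace z with (RtoC (Re z) + Ci * RtoC (Im z)) at 1.
  - eapply Rle_trans; [apply Cmod_triangle|].
    rewrite Cmod_mult, Cmod_Ci, !Cmod_R. lra.
  - destruct z; unfold RtoC, Ci, Cplus, Cmult; simpl; f_equal; ring.
Qed.

Lemma im_le_Cmod (z : C) : (Rabs (Im z) <= Cmod z)%R.
Proof. eapply Rle_trans; [|apply Rmax_Cmod]. apply Rmax_r. Qed.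

Lemma Cderiv_cont (f : C -> C) (z : C) : Chol f z ->
  forall eps : R, (0 < eps)%R -> exists d : R, (0 < d)%R /\
    forall h : C, (Cmod h < d)%R -> (Cmod (f (z + h)%C - f z)%C <= eps)%R.
Proof.
  intros [l H] eps He.
  destruct (H 1%R Rlt_0_1) as [d [Hd H1]].
  set (L := (1 + Cmod l)%R).
  assert (HL : (0 < L)%R) by (unfold L; pose proof (Cmod_ge_0 l); lra).
  exists (Rmin d (eps / L)). split.
  { apply Rmin_pos; [lra|]. apply Rdiv_lt_0_compat; lra. }
  intros h Hh.
  assert (h1 : (Cmod h < d)%R) by (eapply Rlt_le_trans; [apply Hh|apply Rmin_l]).
  assert (h2 : (Cmod h < eps / L)%R) by (eapply Rlt_le_trans; [apply Hh|apply Rmin_r]).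
  specialize (H1 h h1).
  pose proof (Cmod_le_minus (f (z + h) - f z) (l * h)) as H2.
  rewrite Cmod_mult in H2.
  assert (L * Cmod h <= eps)%R.
  { replace eps with (L * (eps / L))%R by (field; lra).
    apply Rmult_le_compat_l; lra. }
  unfold L in *. lra.
Qed.

Lemma Cderiv_const (c z : C) : Cderiv (fun _ => c) z 0.
Proof.
  intros eps He. exists 1%R. split; [lra|]. intros h _.
  replace (c - c - 0 * h) with (RtoC 0) by ring. rewrite Cmod_0.
  apply Rmult_le_pos; [lra|apply Cmod_ge_0].
Qed.

Lemma Cderiv_id (z : C) : Cderiv (fun w => w) z 1.
Proof.
  intros eps He. exists 1%R. split; [lra|]. intros h _.
  replace (z + h - z - 1 * h) with (RtoC 0) by ring. rewrite Cmod_0.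
  apply Rmult_le_pos; [lra|apply Cmod_ge_0].
Qed.

Lemma Cderiv_plus (f g : C -> C) (z a b : C) :
  Cderiv f z a -> Cderiv g z b -> Cderiv (fun w => f w + g w) z (a + b).
Proof.
  intros Hf Hg eps He.
  destruct (Hf (eps / 2)%R ltac:(lra)) as [d1 [Hd1 H1]].
  destruct (Hg (eps / 2)%R ltac:(lra)) as [d2 [Hd2 H2]].
  exists (Rmin d1 d2). split; [now apply Rmin_pos|]. intros h Hh.
  specialize (H1 h (Rlt_le_trans _ _ _ Hh (Rmin_l _ _))).
  specialize (H2 h (Rlt_le_trans _ _ _ Hh (Rmin_r _ _))).
  replace (f (z + h) + g (z + h) - (f z + g z) - (a + b) * h) with
    ((f (z + h) - f z - a * h) + (g (z + h) - g z - b * h)) by ring.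
  eapply Rle_trans; [apply Cmod_triangle|]. lra.
Qed.

Lemma Cderiv_mult (f g : C -> C) (z a b : C) :
  Cderiv f z a -> Cderiv g z b ->
  Cderiv (fun w => f w * g w) z (a * g z + f z * b).
Proof.
  intros Hf Hg eps He.
  (* The remainder splits into four terms, which contribute the summands [Cmod (g z)], [Cmod (f z)],
     [Cmod b] and [1] to the factor of [e * Cmod h]; the last one uses that the increment of [f] is
     at most [1]. *)
  set (K := (1 + Cmod (g z)%C + Cmod (f z)%C + Cmod b)%R).
  assert (HK : (0 < K)%R).
  { unfold K. pose proof (Cmod_ge_0 (g z)); pose proof (Cmod_ge_0 (f z));
    pose proof (Cmod_ge_0 b); lra. }
  set (e := (Rmin 1 (eps / (2 * K)))%R).
  assert (He0 : (0 < e)%R).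
  { apply Rmin_pos; [lra|]. apply Rdiv_lt_0_compat; lra. }
  assert (He2 : (e * K <= eps / 2)%R).
  { replace (eps / 2)%R with (eps / (2 * K) * K)%R by (field; lra).
    apply Rmult_le_compat_r; [lra|apply Rmin_r]. }
  destruct (Hf e He0) as [d1 [Hd1 H1]].
  destruct (Hg e He0) as [d2 [Hd2 H2]].
  destruct (Cderiv_cont f z (ex_intro _ a Hf) e He0) as [d3 [Hd3 H3]].
  exists (Rmin d1 (Rmin d2 d3)).
  split; [repeat apply Rmin_pos; lra|]. intros h Hh.
  assert (Hm : (Cmod h < d1 /\ Cmod h < d2 /\ Cmod h < d3)%R).
  { pose proof (Rmin_l d1 (Rmin d2 d3)); pose proof (Rmin_r d1 (Rmin d2 d3));
    pose proof (Rmin_l d2 d3); pose proof (Rmin_r d2 d3). lra. }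
  destruct Hm as [m1 [m2 m3]].
  specialize (H1 h m1). specialize (H2 h m2). specialize (H3 h m3).
  replace (f (z + h) * g (z + h) - f z * g z - (a * g z + f z * b) * h) with
    ((f (z + h) - f z - a * h) * g z + f z * (g (z + h) - g z - b * h)
     + (f (z + h) - f z) * (b * h)
     + (f (z + h) - f z) * (g (z + h) - g z - b * h)) by ring.
  eapply Rle_trans; [apply Cmod_triangle|].
  eapply Rle_trans; [apply Rplus_le_compat_r, Cmod_triangle|].
  eapply Rle_trans; [apply Rplus_le_compat_r, Rplus_le_compat_r, Cmod_triangle|].
  rewrite !Cmod_mult.
  pose proof (Cmod_ge_0 (g z)); pose proof (Cmod_ge_0 (f z));
    pose proof (Cmod_ge_0 b); pose proof (Cmod_ge_0 h).
  set (X := Cmod (f (z + h) - f z - a * h)%C) in *.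
  set (Y := Cmod (g (z + h) - g z - b * h)%C) in *.
  set (Z := Cmod (f (z + h) - f z)%C) in *.
  assert (0 <= X)%R by apply Cmod_ge_0. assert (0 <= Y)%R by apply Cmod_ge_0.
  assert (0 <= Z)%R by apply Cmod_ge_0.
  assert (Z <= 1)%R by (pose proof (Rmin_l 1 (eps / (2 * K))); unfold e in *; lra).
  assert (X * Cmod (g z)%C <= e * Cmod h * Cmod (g z)%C)%R by (apply Rmult_le_compat_r; lra).
  assert (Cmod (f z)%C * Y <= Cmod (f z)%C * (e * Cmod h))%R by (apply Rmult_le_compat_l; lra).
  assert (Z * (Cmod b * Cmod h) <= e * (Cmod b * Cmod h))%R.
  { apply Rmult_le_compat_r; [apply Rmult_le_pos; lra|lra]. }
  assert (Z * Y <= 1 * (e * Cmod h))%R by (apply Rmult_le_compat; lra).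
  apply Rle_trans with (e * K * Cmod h)%R.
  - unfold K. nra.
  - apply Rmult_le_compat_r; lra.
Qed.

Lemma Cderiv_comp (f g : C -> C) (z a b : C) :
  Cderiv f z a -> Cderiv g (f z) b -> Cderiv (fun w => g (f w)) z (b * a).
Proof.
  intros Hf Hg eps He.
  set (K := (1 + Cmod a + Cmod b)%R).
  pose proof (Cmod_ge_0 a); pose proof (Cmod_ge_0 b).
  assert (HK : (0 < K)%R) by (unfold K; lra).
  set (e := (Rmin 1 (eps / (2 * K)))%R).
  assert (He0 : (0 < e)%R).
  { apply Rmin_pos; [lra|]. apply Rdiv_lt_0_compat; lra. }
  assert (He1 : (e <= 1)%R) by apply Rmin_l.
  assert (He2 : (e * K <= eps / 2)%R).
  { replace (eps / 2)%R with (eps / (2 * K) * K)%R by (field; lra).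
    apply Rmult_le_compat_r; [lra|apply Rmin_r]. }
  destruct (Hf e He0) as [d1 [Hd1 H1]].
  destruct (Hg e He0) as [d2 [Hd2 H2]].
  (* Halving [d2] turns the non-strict bound of [Cderiv_cont] into the strict one that [H2]
     demands. *)
  destruct (Cderiv_cont f z (ex_intro _ a Hf) (d2 / 2)%R ltac:(lra)) as [d3 [Hd3 H3]].
  exists (Rmin d1 d3). split; [now apply Rmin_pos|]. intros h Hh.
  specialize (H1 h (Rlt_le_trans _ _ _ Hh (Rmin_l _ _))).
  specialize (H3 h (Rlt_le_trans _ _ _ Hh (Rmin_r _ _))).
  specialize (H2 (f (z + h) - f z) ltac:(lra)).
  replace (f z + (f (z + h) - f z)) with (f (z + h)) in H2 by ring.
  replace (g (f (z + h)) - g (f z) - b * a * h) with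
    ((g (f (z + h)) - g (f z) - b * (f (z + h) - f z))
     + b * (f (z + h) - f z - a * h)) by ring.
  eapply Rle_trans; [apply Cmod_triangle|]. rewrite Cmod_mult.
  pose proof (Cmod_le_minus (f (z + h) - f z) (a * h)) as H4.
  rewrite Cmod_mult in H4. pose proof (Cmod_ge_0 h).
  set (X := Cmod (f (z + h) - f z - a * h)%C) in *.
  set (Z := Cmod (f (z + h) - f z)%C) in *.
  assert (Cmod b * X <= Cmod b * (e * Cmod h))%R by (apply Rmult_le_compat_l; lra).
  assert (e * Z <= e * ((Cmod a + 1) * Cmod h))%R.
  { apply Rmult_le_compat_l; [lra|]. nra. }
  apply Rle_trans with (e * K * Cmod h)%R.
  - unfold K. nra.
  - apply Rmult_le_compat_r; lra.
Qed.

Lemma Cderiv_inv (z : C) : z <> 0 -> Cderiv (fun w => / w) z (- / (z * z)).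
Proof.
  intros Hz eps He.
  assert (Hm : (0 < Cmod z)%R) by now apply Cmod_gt_0.
  set (m := Cmod z) in *.
  (* The first radius keeps [Cmod (z + h)] above [m / 2]. The remainder is exactly
     [h^2 / (z^2 (z + h))], hence at most [2 |h|^2 / m^3], which gives the second. *)
  exists (Rmin (m / 2) (eps * (m * m * m) / 2)). split.
  { apply Rmin_pos; [lra|]. apply Rdiv_lt_0_compat; [|lra].
    apply Rmult_lt_0_compat; [lra|]. repeat apply Rmult_lt_0_compat; lra. }
  intros h Hh.
  pose proof (Rlt_le_trans _ _ _ Hh (Rmin_l _ _)) as h1.
  pose proof (Rlt_le_trans _ _ _ Hh (Rmin_r _ _)) as h2.
  assert (Hzh : (m / 2 <= Cmod (z + h)%C)%R).
  { pose proof (Cmod_le_minus z (z + h)) as H.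
    replace (z - (z + h)) with (- h) in H by ring. rewrite Cmod_opp in H.
    fold m in H. lra. }
  assert (Hzh0 : z + h <> 0) by (apply Cmod_gt_0; lra).
  replace (/ (z + h) - / z - - / (z * z) * h) with (h * h / (z * z * (z + h)))
    by (field; auto).
  rewrite Cmod_div by (repeat apply Cmult_neq_0; auto).
  rewrite !Cmod_mult. fold m. pose proof (Cmod_ge_0 h).
  apply Rle_div_l.
  { repeat apply Rmult_lt_0_compat; lra. }
  rewrite Rmult_assoc, (Rmult_comm (Cmod h) (m * m * Cmod (z + h)%C)), <- Rmult_assoc.
  apply Rmult_le_compat_r; [lra|].
  apply Rle_trans with (eps * (m * m * (m / 2)))%R; [lra|].
  apply Rmult_le_compat_l; [lra|]. apply Rmult_le_compat_l; [|lra].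
  apply Rmult_le_pos; lra.
Qed.

Lemma Cderiv_ext_loc (f g : C -> C) (z l : C) :
  (exists d, (0 < d)%R /\ forall w, (Cmod (w - z)%C < d)%R -> f w = g w) ->
  Cderiv f z l -> Cderiv g z l.
Proof.
  intros [d0 [Hd0 E]] H eps He. destruct (H eps He) as [d [Hd H1]].
  exists (Rmin d d0). split; [now apply Rmin_pos|]. intros h Hh.
  rewrite <- (E (z + h)), <- (E z).
  - apply H1. eapply Rlt_le_trans; [apply Hh|apply Rmin_l].
  - replace (z - z) with (RtoC 0) by ring. rewrite Cmod_0. lra.
  - replace (z + h - z) with h by ring.
    eapply Rlt_le_trans; [apply Hh|apply Rmin_r].
Qed.

Lemma Chol_const (c z : C) : Chol (fun _ => c) z.
Proof. exists (RtoC 0). apply Cderiv_const. Qed.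

Lemma Chol_id (z : C) : Chol (fun w => w) z.
Proof. exists (RtoC 1). apply Cderiv_id. Qed.

Lemma Chol_plus (f g : C -> C) (z : C) :
  Chol f z -> Chol g z -> Chol (fun w => f w + g w) z.
Proof. intros [a Ha] [b Hb]. eexists. apply Cderiv_plus; eassumption. Qed.

Lemma Chol_mult (f g : C -> C) (z : C) :
  Chol f z -> Chol g z -> Chol (fun w => f w * g w) z.
Proof. intros [a Ha] [b Hb]. eexists. apply Cderiv_mult; eassumption. Qed.

Lemma Chol_comp (f g : C -> C) (z : C) :
  Chol f z -> Chol g (f z) -> Chol (fun w => g (f w)) z.
Proof. intros [a Ha] [b Hb]. eexists. eapply Cderiv_comp; eassumption. Qed.

Lemma Chol_inv (f : C -> C) (z : C) :
  Chol f z -> f z <> 0 -> Chol (fun w => / f w) z.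
Proof.
  intros Hf H. apply (Chol_comp f Cinv); auto. eexists. now apply Cderiv_inv.
Qed.

Lemma Chol_ext_loc (f g : C -> C) (z : C) :
  (exists d, (0 < d)%R /\ forall w, (Cmod (w - z)%C < d)%R -> f w = g w) ->
  Chol f z -> Chol g z.
Proof. intros H [l Hl]. exists l. now apply (Cderiv_ext_loc f). Qed.

Lemma Chol_ext (f g : C -> C) (z : C) :
  (forall w, f w = g w) -> Chol f z -> Chol g z.
Proof.
  intros H. apply Chol_ext_loc. exists 1%R. split; [lra|]. intros; apply H.
Qed.

Lemma Chol_opp (f : C -> C) (z : C) : Chol f z -> Chol (fun w => - f w) z.
Proof.
  intros H. apply (Chol_ext (fun w => (- (1)) * f w)).
  - intros w. ring.
  - apply Chol_mult; [apply Chol_const|exact H].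
Qed.

Lemma Chol_minus (f g : C -> C) (z : C) :
  Chol f z -> Chol g z -> Chol (fun w => f w - g w) z.
Proof. intros. apply Chol_plus; [assumption|]. now apply Chol_opp. Qed.

Lemma Chol_pow (f : C -> C) (n : nat) (z : C) :
  Chol f z -> Chol (fun w => f w ^ n) z.
Proof.
  intros H. induction n as [|n IH]; simpl.
  - apply Chol_const.
  - now apply Chol_mult.
Qed.

(** * Integrals of complex functions of a real variable *)

(** Continuity is asked of the components because complex integrals are taken as pairs of real
    Riemann integrals; [Ccont_eps] and [eps_Ccont] translate to and from the modulus. *)
Definition Ccont (F : R -> C) (t : R) : Prop :=
  continuous (fun u => Re (F u)%C) t /\ continuous (fun u => Im (F u)%C) t.

Lemma Ccont_eps (F : R -> C) (t : R) : Ccont F t ->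
  forall eps : R, (0 < eps)%R -> exists d : R, (0 < d)%R /\
    forall u, (Rabs (u - t) < d)%R -> (Cmod (F u - F t)%C <= eps)%R.
Proof.
  intros [H1 H2] eps He.
  destruct (proj1 (filterlim_locally _ _) H1 (mkposreal (eps / 2) ltac:(lra))) as [d1 K1].
  destruct (proj1 (filterlim_locally _ _) H2 (mkposreal (eps / 2) ltac:(lra))) as [d2 K2].
  exists (Rmin d1 d2). split.
  { apply Rmin_pos; apply cond_pos. }
  intros u Hu.
  specialize (K1 u (Rlt_le_trans _ _ _ Hu (Rmin_l _ _))).
  specialize (K2 u (Rlt_le_trans _ _ _ Hu (Rmin_r _ _))).
  eapply Rle_trans; [apply Cmod_Re_Im|].
  change (Rabs (Re (F u)%C - Re (F t)%C) < eps / 2)%R in K1.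
  change (Rabs (Im (F u)%C - Im (F t)%C) < eps / 2)%R in K2.
  change (Rabs (Re (F u)%C - Re (F t)%C) + Rabs (Im (F u)%C - Im (F t)%C) <= eps)%R. lra.
Qed.

Lemma eps_Ccont (F : R -> C) (t : R) :
  (forall eps : R, (0 < eps)%R -> exists d : R, (0 < d)%R /\
    forall u, (Rabs (u - t) < d)%R -> (Cmod (F u - F t)%C <= eps)%R) -> Ccont F t.
Proof.
  intros H. split; apply filterlim_locally; intros eps;
  destruct (H (eps / 2)%R ltac:(pose proof (cond_pos eps); lra)) as [d [Hd K]];
  exists (mkposreal d Hd); intros u Hu; specialize (K u Hu);
  pose proof (cond_pos eps).
  - change (Rabs (Re (F u - F t)%C) < eps)%R. pose proof (re_le_Cmod (F u - F t)). lra.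
  - change (Rabs (Im (F u - F t)%C) < eps)%R. pose proof (im_le_Cmod (F u - F t)). lra.
Qed.

Lemma Ccont_const (c : C) (t : R) : Ccont (fun _ => c) t.
Proof. split; apply continuous_const. Qed.

Lemma Ccont_RtoC (f : R -> R) (t : R) : continuous f t -> Ccont (fun u => RtoC (f u)) t.
Proof. intros H. split; simpl; [exact H|apply continuous_const]. Qed.

Lemma Ccont_pair (f g : R -> R) (t : R) :
  continuous f t -> continuous g t -> Ccont (fun u => (f u, g u)) t.
Proof. intros. now split. Qed.

Lemma Ccont_plus (F G : R -> C) (t : R) :
  Ccont F t -> Ccont G t -> Ccont (fun u => F u + G u) t.
Proof.
  intros [a b] [c d]. split.
  - exact (continuous_plus _ _ _ a c).
  - exact (continuous_plus _ _ _ b d).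
Qed.

Lemma Ccont_mult (F G : R -> C) (t : R) :
  Ccont F t -> Ccont G t -> Ccont (fun u => F u * G u) t.
Proof.
  intros [a b] [c d]. split.
  - exact (continuous_minus _ _ _ (continuous_mult _ _ _ a c) (continuous_mult _ _ _ b d)).
  - exact (continuous_plus _ _ _ (continuous_mult _ _ _ a d) (continuous_mult _ _ _ b c)).
Qed.

Lemma Ccont_Chol (f : C -> C) (G : R -> C) (t : R) :
  Chol f (G t) -> Ccont G t -> Ccont (fun u => f (G u)) t.
Proof.
  intros Hf HG. apply eps_Ccont. intros eps He.
  destruct (Cderiv_cont f _ Hf eps He) as [d [Hd K]].
  destruct (Ccont_eps G t HG (d / 2)%R ltac:(lra)) as [d2 [Hd2 K2]].
  exists d2. split; [assumption|]. intros u Hu. specialize (K2 u Hu).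
  replace (G u) with (G t + (G u - G t)) by ring. apply K. lra.
Qed.

Lemma Ccont_ext (F G : R -> C) (t : R) :
  (forall u, F u = G u) -> Ccont F t -> Ccont G t.
Proof.
  intros E [a b]. split.
  - apply (continuous_ext (fun u => Re (F u)%C)); [intros; now rewrite E|exact a].
  - apply (continuous_ext (fun u => Im (F u)%C)); [intros; now rewrite E|exact b].
Qed.

Lemma Ccont_minus (F G : R -> C) (t : R) :
  Ccont F t -> Ccont G t -> Ccont (fun u => F u - G u) t.
Proof.
  intros H1 H2. apply (Ccont_ext (fun u => F u + RtoC (-1) * G u)).
  - intros u. ring.
  - apply Ccont_plus; [exact H1|]. apply Ccont_mult; [apply Ccont_const|exact H2].
Qed.

Definition CInt (F : R -> C) (a b : R) : C :=
  (RInt (fun t => Re (F t)%C) a b, RInt (fun t => Im (F t)%C) a b).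

Definition Ccont_on (F : R -> C) (a b : R) : Prop :=
  forall t, (a <= t <= b)%R -> Ccont F t.

Lemma Ccont_on_ex_Re (F : R -> C) (a b : R) : (a <= b)%R -> Ccont_on F a b ->
  ex_RInt (fun t => Re (F t)%C) a b.
Proof.
  intros Hab H. apply (@ex_RInt_continuous R_CompleteNormedModule).
  intros t Ht. rewrite Rmin_left, Rmax_right in Ht by lra. exact (proj1 (H t Ht)).
Qed.

Lemma Ccont_on_ex_Im (F : R -> C) (a b : R) : (a <= b)%R -> Ccont_on F a b ->
  ex_RInt (fun t => Im (F t)%C) a b.
Proof.
  intros Hab H. apply (@ex_RInt_continuous R_CompleteNormedModule).
  intros t Ht. rewrite Rmin_left, Rmax_right in Ht by lra. exact (proj2 (H t Ht)).
Qed.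

Lemma CInt_ext (F G : R -> C) (a b : R) : (a <= b)%R ->
  (forall t, (a <= t <= b)%R -> F t = G t) -> CInt F a b = CInt G a b.
Proof.
  intros Hab E. unfold CInt. f_equal; apply RInt_ext; intros t Ht;
  rewrite Rmin_left, Rmax_right in Ht by lra; rewrite E; auto; lra.
Qed.

Lemma CInt_plus (F G : R -> C) (a b : R) : (a <= b)%R ->
  Ccont_on F a b -> Ccont_on G a b ->
  CInt (fun t => F t + G t) a b = CInt F a b + CInt G a b.
Proof.
  intros Hab HF HG. unfold CInt, Cplus at 3; simpl. f_equal.
  - apply (@RInt_plus R_CompleteNormedModule); now apply Ccont_on_ex_Re.
  - apply (@RInt_plus R_CompleteNormedModule); now apply Ccont_on_ex_Im.
Qed.

Lemma CInt_scal (F : R -> C) (c : C) (a b : R) : (a <= b)%R ->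
  Ccont_on F a b -> CInt (fun t => c * F t) a b = c * CInt F a b.
Proof.
  intros Hab HF.
  pose proof (Ccont_on_ex_Re F a b Hab HF) as H1.
  pose proof (Ccont_on_ex_Im F a b Hab HF) as H2.
  unfold CInt, Cmult at 3; simpl. f_equal.
  - rewrite (@RInt_minus R_CompleteNormedModule (fun t => fst c * Re (F t)%C)%R
      (fun t => snd c * Im (F t)%C)%R).
    + unfold minus, plus, opp; simpl.
      rewrite !(@RInt_scal R_CompleteNormedModule) by assumption. reflexivity.
    + now apply (@ex_RInt_scal R_CompleteNormedModule).
    + now apply (@ex_RInt_scal R_CompleteNormedModule).
  - rewrite (@RInt_plus R_CompleteNormedModule (fun t => fst c * Im (F t)%C)%R
      (fun t => snd c * Re (F t)%C)%R).
    + unfold plus; simpl.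
      rewrite !(@RInt_scal R_CompleteNormedModule) by assumption. reflexivity.
    + now apply (@ex_RInt_scal R_CompleteNormedModule).
    + now apply (@ex_RInt_scal R_CompleteNormedModule).
Qed.

Lemma CInt_minus (F G : R -> C) (a b : R) : (a <= b)%R ->
  Ccont_on F a b -> Ccont_on G a b ->
  CInt (fun t => F t - G t) a b = CInt F a b - CInt G a b.
Proof.
  intros Hab HF HG.
  rewrite (CInt_ext _ (fun t => F t + RtoC (-1) * G t)) by (try intros; try ring; assumption).
  rewrite CInt_plus, CInt_scal; auto; [ring|].
  intros t Ht. apply Ccont_mult; [apply Ccont_const|now apply HG].
Qed.

Lemma CInt_Chasles (F : R -> C) (a b c : R) : (a <= b <= c)%R ->
  Ccont_on F a c -> CInt F a c = CInt F a b + CInt F b c.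
Proof.
  intros [Hab Hbc] H.
  assert (H1 : Ccont_on F a b) by (intros t Ht; apply H; lra).
  assert (H2 : Ccont_on F b c) by (intros t Ht; apply H; lra).
  unfold CInt, Cplus; simpl. f_equal; symmetry.
  - apply (@RInt_Chasles R_CompleteNormedModule); now apply Ccont_on_ex_Re.
  - apply (@RInt_Chasles R_CompleteNormedModule); now apply Ccont_on_ex_Im.
Qed.

(* Rotating by the conjugate of the integral reduces to the real part. *)
Lemma CInt_bound (F : R -> C) (g : R -> R) (a b : R) : (a <= b)%R ->
  Ccont_on F a b -> ex_RInt g a b ->
  (forall t, (a <= t <= b)%R -> (Cmod (F t)%C <= g t)%R) ->
  (Cmod (CInt F a b)%C <= RInt g a b)%R.
Proof.
  intros Hab HF Hg HFg. set (c := CInt F a b).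
  destruct (Req_dec (Cmod c) 0) as [E|E].
  - rewrite E. apply RInt_ge_0; auto. intros t Ht.
    eapply Rle_trans; [apply Cmod_ge_0|]. apply HFg. lra.
  - assert (Hc : (0 < Cmod c)%R) by (pose proof (Cmod_ge_0 c); lra).
    apply (Rmult_le_reg_l (Cmod c)); [assumption|].
    assert (E1 : RtoC (Cmod c ^ 2)%R = CInt (fun t => Cconj c * F t) a b).
    { rewrite CInt_scal by assumption. fold c.
      rewrite Cmod2_conj. ring. }
    replace (Cmod c * Cmod c)%R with (Re (CInt (fun t => Cconj c * F t) a b)%C).
    2: { rewrite <- E1. simpl. ring. }
    change (RInt (fun t => Re (Cconj c * F t)%C) a b <= scal (Cmod c) (RInt g a b))%R.
    clearbody c.
    rewrite <- (@RInt_scal R_CompleteNormedModule) by assumption.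
    apply (RInt_le (fun t => Re (Cconj c * F t)%C)); auto.
    + apply (Ccont_on_ex_Re (fun t => Cconj c * F t)); auto. intros t Ht.
      apply Ccont_mult; [apply Ccont_const|now apply HF].
    + now apply (@ex_RInt_scal R_CompleteNormedModule).
    + intros t Ht.
      eapply Rle_trans; [apply Rle_abs|].
      eapply Rle_trans; [apply re_le_Cmod|].
      rewrite Cmod_mult, Cmod_conj. unfold scal; simpl; unfold mult; simpl.
      apply Rmult_le_compat_l; [lra|]. apply HFg; lra.
Qed.

Lemma CInt_bound_const (F : R -> C) (M a b : R) : (a <= b)%R ->
  Ccont_on F a b -> (forall t, (a <= t <= b)%R -> (Cmod (F t)%C <= M)%R) ->
  (Cmod (CInt F a b)%C <= M * (b - a))%R.
Proof.
  intros Hab HF H. eapply Rle_trans.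
  - apply (CInt_bound F (fun _ => M)); auto. apply ex_RInt_const.
  - rewrite RInt_const. unfold scal; simpl; unfold mult; simpl. lra.
Qed.

Lemma CInt_reflect (F : R -> C) (a b : R) : (a <= b)%R -> Ccont_on F (- b) (- a) ->
  CInt (fun t => F (- t)%R) a b = CInt F (- b) (- a).
Proof.
  intros Hab HF.
  assert (K : forall f : R -> R, ex_RInt f (- b) (- a) ->
    RInt (fun t => f (- t)%R) a b = RInt f (- b) (- a)).
  { intros f Hf.
    apply (@is_RInt_unique R_CompleteNormedModule).
    apply (is_RInt_ext (fun t => opp (scal (-1)%R (f (-1 * t + 0)%R)))).
    - intros t _. unfold opp, scal; simpl; unfold mult; simpl.
      replace (-1 * t + 0)%R with (- t)%R by ring. ring.
    - replace (RInt f (- b) (- a)) with (opp (RInt f (- a) (- b))).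
      + apply (@is_RInt_opp R_NormedModule).
        apply (is_RInt_comp_lin f (-1)%R 0%R a b).
        replace (-1 * a + 0)%R with (- a)%R by ring.
        replace (-1 * b + 0)%R with (- b)%R by ring.
        apply (@RInt_correct R_CompleteNormedModule).
        now apply ex_RInt_swap.
      + rewrite (@opp_RInt_swap R_CompleteNormedModule); [reflexivity|].
        now apply ex_RInt_swap. }
  unfold CInt. f_equal.
  - apply (K (fun t => Re (F t)%C)). apply Ccont_on_ex_Re; [lra|assumption].
  - apply (K (fun t => Im (F t)%C)). apply Ccont_on_ex_Im; [lra|assumption].
Qed.

Lemma CInt_derive (F G : R -> C) (a b : R) : (a <= b)%R ->
  (forall t, (a <= t <= b)%R -> is_derive (fun u => Re (F u)%C) t (Re (G t)%C) /\
     is_derive (fun u => Im (F u)%C) t (Im (G t)%C)) ->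
  Ccont_on G a b -> CInt G a b = F b - F a.
Proof.
  intros Hab H HG. apply injective_projections; unfold CInt; simpl;
  apply (@is_RInt_unique R_CompleteNormedModule).
  - apply (is_RInt_derive (fun u => Re (F u)%C)); intros t Ht;
    rewrite Rmin_left, Rmax_right in Ht by lra; [apply (H t Ht)|apply (HG t Ht)].
  - apply (is_RInt_derive (fun u => Im (F u)%C)); intros t Ht;
    rewrite Rmin_left, Rmax_right in Ht by lra; [apply (H t Ht)|apply (HG t Ht)].
Qed.

(** * Goursat's theorem on rectangles *)

(** The counterclockwise integral over the boundary of [[a, b] x [c, d]]; on the vertical sides
    [dz = i dy]. *)
Definition rect (f : C -> C) (a b c d : R) : C :=
  CInt (fun x => f (x, c)) a b - CInt (fun x => f (x, d)) a b
  + Ci * (CInt (fun y => f (b, y)) c d - CInt (fun y => f (a, y)) c d).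

(** Continuity is restricted to the sides because several integrands have a pole inside the
    rectangle. *)
Definition Ccont_edges (f : C -> C) (a b c d : R) : Prop :=
  (Ccont_on (fun x => f (x, c)) a b /\ Ccont_on (fun x => f (x, d)) a b) /\
  (Ccont_on (fun y => f (b, y)) c d /\ Ccont_on (fun y => f (a, y)) c d).

Definition Chol_rect (f : C -> C) (a b c d : R) : Prop :=
  forall x y : R, (a <= x <= b)%R -> (c <= y <= d)%R -> Chol f (x, y).

Lemma Ccont_horizontal (f : C -> C) (x y : R) : Chol f (x, y) ->
  Ccont (fun u => f (u, y)) x.
Proof.
  intros H. apply (Ccont_Chol f (fun u => (u, y))); [exact H|].
  apply Ccont_pair; [apply continuous_id|apply continuous_const].
Qed.

Lemma Ccont_vertical (f : C -> C) (x y : R) : Chol f (x, y) ->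
  Ccont (fun u => f (x, u)) y.
Proof.
  intros H. apply (Ccont_Chol f (fun u => (x, u))); [exact H|].
  apply Ccont_pair; [apply continuous_const|apply continuous_id].
Qed.

Lemma Chol_rect_edges (f : C -> C) (a b c d : R) : (a <= b)%R -> (c <= d)%R ->
  Chol_rect f a b c d -> Ccont_edges f a b c d.
Proof.
  intros Hab Hcd H.
  split; split; intros t Ht; first [apply Ccont_horizontal|apply Ccont_vertical];
  apply H; lra.
Qed.

Lemma Chol_rect_sub (f : C -> C) (a b c d a' b' c' d' : R) :
  Chol_rect f a b c d -> (a <= a')%R -> (b' <= b)%R -> (c <= c')%R -> (d' <= d)%R ->
  Chol_rect f a' b' c' d'.
Proof. intros H h1 h2 h3 h4 x y Hx Hy. apply H; lra. Qed.

Lemma rect_plus (f g : C -> C) (a b c d : R) : (a <= b)%R -> (c <= d)%R ->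
  Ccont_edges f a b c d -> Ccont_edges g a b c d ->
  rect (fun z => f z + g z) a b c d = rect f a b c d + rect g a b c d.
Proof.
  intros Hab Hcd [[f1 f2] [f3 f4]] [[g1 g2] [g3 g4]]. unfold rect.
  rewrite (CInt_plus (fun x => f (x, c)) (fun x => g (x, c))) by assumption.
  rewrite (CInt_plus (fun x => f (x, d)) (fun x => g (x, d))) by assumption.
  rewrite (CInt_plus (fun x => f (a, x)) (fun x => g (a, x))) by assumption.
  rewrite (CInt_plus (fun x => f (b, x)) (fun x => g (b, x))) by assumption.
  ring.
Qed.

Lemma rect_scal (f : C -> C) (k : C) (a b c d : R) : (a <= b)%R -> (c <= d)%R ->
  Ccont_edges f a b c d -> rect (fun z => k * f z) a b c d = k * rect f a b c d.
Proof.
  intros Hab Hcd [[f1 f2] [f3 f4]]. unfold rect.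
  rewrite (CInt_scal (fun x => f (x, c))) by assumption.
  rewrite (CInt_scal (fun x => f (x, d))) by assumption.
  rewrite (CInt_scal (fun x => f (a, x))) by assumption.
  rewrite (CInt_scal (fun x => f (b, x))) by assumption.
  ring.
Qed.

Lemma rect_ext (f g : C -> C) (a b c d : R) : (a <= b)%R -> (c <= d)%R ->
  (forall x y, (a <= x <= b)%R -> (c <= y <= d)%R ->
     (x = a \/ x = b \/ y = c \/ y = d) -> f (x, y) = g (x, y)) ->
  rect f a b c d = rect g a b c d.
Proof.
  intros Hab Hcd E. unfold rect.
  rewrite (CInt_ext (fun x => f (x, c)) (fun x => g (x, c))) by (try intros; try apply E; auto; lra).
  rewrite (CInt_ext (fun x => f (x, d)) (fun x => g (x, d))) by (try intros; try apply E; auto; lra).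
  rewrite (CInt_ext (fun x => f (a, x)) (fun x => g (a, x))) by (try intros; try apply E; auto; lra).
  rewrite (CInt_ext (fun x => f (b, x)) (fun x => g (b, x))) by (try intros; try apply E; auto; lra).
  reflexivity.
Qed.

Lemma rect_bound (f : C -> C) (M a b c d : R) : (a <= b)%R -> (c <= d)%R ->
  Ccont_edges f a b c d ->
  (forall x y, (a <= x <= b)%R -> (c <= y <= d)%R ->
     (x = a \/ x = b \/ y = c \/ y = d) -> (Cmod (f (x, y))%C <= M)%R) ->
  (Cmod (rect f a b c d)%C <= 2 * M * ((b - a) + (d - c)))%R.
Proof.
  intros Hab Hcd [[f1 f2] [f3 f4]] H. unfold rect.
  eapply Rle_trans; [apply Cmod_triangle|]. rewrite Cmod_mult, Cmod_Ci.
  pose proof (Cmod_triangle_minus (CInt (fun x => f (x, c)) a b) (CInt (fun x => f (x, d)) a b)).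
  pose proof (Cmod_triangle_minus (CInt (fun y => f (b, y)) c d) (CInt (fun y => f (a, y)) c d)).
  pose proof (CInt_bound_const _ M a b Hab f1 ltac:(intros; apply H; auto; lra)).
  pose proof (CInt_bound_const _ M a b Hab f2 ltac:(intros; apply H; auto; lra)).
  pose proof (CInt_bound_const _ M c d Hcd f3 ltac:(intros; apply H; auto; lra)).
  pose proof (CInt_bound_const _ M c d Hcd f4 ltac:(intros; apply H; auto; lra)).
  lra.
Qed.

Lemma rect_split_x (f : C -> C) (a m b c d : R) : (a <= m <= b)%R ->
  Ccont_on (fun x => f (x, c)) a b -> Ccont_on (fun x => f (x, d)) a b ->
  rect f a b c d = rect f a m c d + rect f m b c d.
Proof.
  intros Hm H1 H2. unfold rect.
  rewrite (CInt_Chasles (fun x => f (x, c)) a m b) by assumption.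
  rewrite (CInt_Chasles (fun x => f (x, d)) a m b) by assumption. ring.
Qed.

Lemma rect_split_y (f : C -> C) (a b c m d : R) : (c <= m <= d)%R ->
  Ccont_on (fun y => f (a, y)) c d -> Ccont_on (fun y => f (b, y)) c d ->
  rect f a b c d = rect f a b c m + rect f a b m d.
Proof.
  intros Hm H1 H2. unfold rect.
  rewrite (CInt_Chasles (fun y => f (a, y)) c m d) by assumption.
  rewrite (CInt_Chasles (fun y => f (b, y)) c m d) by assumption. ring.
Qed.

(** This chain rule along an affine path serves the horizontal sides ([v = 1]), the vertical sides
    ([v = Ci]) and the rays on which the exponential is compared with its Taylor polynomials. *)
Lemma Cderiv_line (F : C -> C) (g : R -> C) (v l : C) (t : R) :
  (forall u, g u = g t + RtoC (u - t)%R * v) -> Cderiv F (g t) l ->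
  is_derive (fun u => Re (F (g u))%C) t (Re (l * v)%C) /\
  is_derive (fun u => Im (F (g u))%C) t (Im (l * v)%C).
Proof.
  intros Hg HF.
  assert (K : forall eps, (0 < eps)%R -> exists d : posreal, forall h : R, h <> 0%R ->
    (Rabs h < d)%R -> (Cmod ((F (g (t + h)%R) - F (g t)) / RtoC h - l * v)%C < eps)%R).
  { intros eps He. pose proof (Cmod_ge_0 v).
    (* The [+ 1] allows [v = 0]; the factor [2] turns the non-strict bound of [Cderiv] into the
       strict one of a real derivative. *)
    destruct (HF (eps / (2 * (Cmod v + 1)))%R) as [d [Hd K]].
    { apply Rdiv_lt_0_compat; lra. }
    exists (mkposreal (d / (Cmod v + 1))%R ltac:(apply Rdiv_lt_0_compat; lra)).
    simpl. intros h h0 Hh.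
    assert (Hr : (0 < Rabs h)%R) by now apply Rabs_pos_lt.
    assert (E : g (t + h)%R = g t + RtoC h * v).
    { rewrite (Hg (t + h)%R). now replace (t + h - t)%R with h by ring. }
    specialize (K (RtoC h * v)). rewrite Cmod_mult, Cmod_R in K.
    assert (Hl : (Rabs h * Cmod v < d)%R).
    { apply Rle_lt_trans with (Rabs h * (Cmod v + 1))%R.
      - apply Rmult_le_compat_l; lra.
      - apply (Rmult_lt_compat_r (Cmod v + 1)) in Hh; [|lra].
        replace (d / (Cmod v + 1) * (Cmod v + 1))%R with d in Hh by (field; lra). lra. }
    specialize (K Hl). rewrite E.
    assert (h1 : RtoC h <> 0) by (intros Z; apply h0; now apply RtoC_inj).
    replace ((F (g t + RtoC h * v) - F (g t)) / RtoC h - l * v)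
      with ((F (g t + RtoC h * v) - F (g t) - l * (RtoC h * v)) / RtoC h)
      by (field; assumption).
    rewrite Cmod_div, Cmod_R by assumption.
    apply Rlt_div_l; [assumption|].
    eapply Rle_lt_trans; [apply K|].
    apply Rle_lt_trans with (eps / 2 * Rabs h)%R; [|nra].
    set (k := (eps / (2 * (Cmod v + 1)))%R).
    assert (Hk : (0 < k)%R) by (apply Rdiv_lt_0_compat; lra).
    replace (eps / 2)%R with (k * (Cmod v + 1))%R by (unfold k; field; lra). nra. }
  assert (Q : forall (z : C) (r : R), r <> 0%R -> (Re z / r = Re (z / RtoC r)%C /\ Im z / r = Im (z / RtoC r)%C)%R).
  { intros z r Hr. destruct z as [x y]. unfold Cdiv, Cmult, Cinv, RtoC, Re, Im; simpl.
    split; field; lra. }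
  split; apply is_derive_Reals; intros eps He; destruct (K eps He) as [d Hd];
  exists d; intros h h0 Hh; specialize (Hd h h0 Hh);
  destruct (Q (F (g (t + h)%R) - F (g t)) h h0) as [Q1 Q2].
  - eapply Rle_lt_trans; [|exact Hd]. eapply Rle_trans; [|apply re_le_Cmod].
    right. f_equal. change (Re (F (g (t + h)%R))%C - Re (F (g t))%C)%R
      with (Re (F (g (t + h)%R) - F (g t))%C). rewrite Q1. reflexivity.
  - eapply Rle_lt_trans; [|exact Hd]. eapply Rle_trans; [|apply im_le_Cmod].
    right. f_equal. change (Im (F (g (t + h)%R))%C - Im (F (g t))%C)%R
      with (Im (F (g (t + h)%R) - F (g t))%C). rewrite Q2. reflexivity.
Qed.

(** The fundamental theorem of calculus on each side leaves values of [F] at the corners, and every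
    corner occurs twice with opposite signs. *)
Lemma rect_primitive (F f : C -> C) (a b c d : R) : (a <= b)%R -> (c <= d)%R ->
  (forall z, Cderiv F z (f z)) -> Ccont_edges f a b c d -> rect f a b c d = 0.
Proof.
  intros Hab Hcd HF [[f1 f2] [f3 f4]].
  assert (Hh : forall y, Ccont_on (fun x => f (x, y)) a b ->
    CInt (fun x => f (x, y)) a b = F (b, y) - F (a, y)).
  { intros y Hy. apply (CInt_derive (fun x => F (x, y))); auto. intros t Ht.
    replace (f (t, y)) with (f (t, y) * 1) by ring.
    apply (Cderiv_line F (fun u => (u, y))); [|apply HF].
    intros u. apply injective_projections; simpl; ring. }
  assert (Hv : forall x, Ccont_on (fun y => f (x, y)) c d ->
    Ci * CInt (fun y => f (x, y)) c d = F (x, d) - F (x, c)).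
  { intros x Hx. rewrite <- CInt_scal by assumption.
    apply (CInt_derive (fun y => F (x, y))); auto.
    - intros t Ht. rewrite (Cmult_comm Ci).
      apply (Cderiv_line F (fun u => (x, u))); [|apply HF].
      intros u. apply injective_projections; simpl; ring.
    - intros t Ht. apply Ccont_mult; [apply Ccont_const|now apply Hx]. }
  unfold rect.
  replace (Ci * (CInt (fun y => f (b, y)) c d - CInt (fun y => f (a, y)) c d))
    with (Ci * CInt (fun y => f (b, y)) c d - Ci * CInt (fun y => f (a, y)) c d) by ring.
  rewrite !Hh, !Hv by assumption. ring.
Qed.

Lemma rect_affine (p q : C) (a b c d : R) : (a <= b)%R -> (c <= d)%R ->
  rect (fun z => p + q * z) a b c d = 0.
Proof.
  intros Hab Hcd.
  apply (rect_primitive (fun z => p * z + RtoC (1 / 2)%R * q * (z * z))); auto.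
  - intros z.
    assert (Q : p + q * z =
      (0 * z + p * 1) + (0 * (z * z) + RtoC (1 / 2)%R * q * (1 * z + z * 1))).
    { transitivity (p + q * z * (RtoC (1 / 2)%R + RtoC (1 / 2)%R)); [|ring].
      rewrite <- RtoC_plus. replace (1 / 2 + 1 / 2)%R with 1%R by field. ring. }
    rewrite Q.
    apply (Cderiv_plus (fun z => p * z) (fun z => RtoC (1 / 2)%R * q * (z * z))).
    + apply (Cderiv_mult (fun _ => p) (fun z => z)); [apply Cderiv_const|apply Cderiv_id].
    + apply (Cderiv_mult (fun _ => RtoC (1 / 2)%R * q) (fun z => z * z));
        [apply Cderiv_const|].
      apply (Cderiv_mult (fun z => z) (fun z => z)); apply Cderiv_id.
  - apply Chol_rect_edges; auto. intros x y _ _.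
    apply Chol_plus; [apply Chol_const|]. apply Chol_mult; auto using Chol_const, Chol_id.
Qed.

(** The affine approximation of [f] at [p] has a primitive and integrates to zero, so only its error
    is left to be bounded along the boundary. *)
Lemma rect_small (f : C -> C) (p l : C) (eps D a b c d : R) :
  (0 <= eps)%R -> (a <= b)%R -> (c <= d)%R -> Chol_rect f a b c d ->
  (forall x y, (a <= x <= b)%R -> (c <= y <= d)%R ->
    (Cmod (f (x, y) - f p - l * ((x, y) - p))%C <= eps * D)%R) ->
  (Cmod (rect f a b c d)%C <= 2 * (eps * D) * ((b - a) + (d - c)))%R.
Proof.
  intros He Hab Hcd Hf H.
  set (g := fun z => f z - f p - l * (z - p)).
  assert (Hg : Chol_rect g a b c d).
  { intros x y Hx Hy. unfold g.
    apply Chol_minus; [apply Chol_minus; [now apply Hf|apply Chol_const]|].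
    apply Chol_mult; [apply Chol_const|].
    apply Chol_minus; [apply Chol_id|apply Chol_const]. }
  rewrite (rect_ext f (fun z => g z + ((f p - l * p) + l * z))); auto.
  - assert (Ha : Chol_rect (fun z => (f p - l * p) + l * z) a b c d).
    { intros x y _ _. apply Chol_plus; [apply Chol_const|].
      apply Chol_mult; auto using Chol_const, Chol_id. }
    rewrite rect_plus, rect_affine by (auto; apply Chol_rect_edges; auto).
    rewrite Cplus_0_r. apply rect_bound; auto.
    + now apply Chol_rect_edges.
    + intros x y Hx Hy _. now apply H.
  - intros x y _ _ _. unfold g. ring.
Qed.

(** Only the lower left corner is recorded, since the sides at stage [n] are [w / 2^n] and
    [h / 2^n]. The last quarter is taken untested: when the other three fail the test, the triangle
    inequality makes it large enough. *)
Definition quarter (f : C -> C) (w h E : R) (n : nat) (p : R * R) : R * R :=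
  let big a c := Rle_dec (E / 4 ^ S n)%R
    (Cmod (rect f a (a + w / 2 ^ S n)%R c (c + h / 2 ^ S n)%R)%C) in
  let (a, c) := p in
  let a' := (a + w / 2 ^ S n)%R in
  let c' := (c + h / 2 ^ S n)%R in
  if big a c then (a, c) else if big a' c then (a', c)
  else if big a c' then (a, c') else (a', c').

Fixpoint quarters (f : C -> C) (w h E a c : R) (n : nat) : R * R :=
  match n with
  | O => (a, c)
  | S m => quarter f w h E m (quarters f w h E a c m)
  end.

Lemma quarter_pos (f : C -> C) (w h E : R) (n : nat) (p : R * R) :
  let q := quarter f w h E n p in
  (fst q = fst p \/ fst q = fst p + w / 2 ^ S n)%R /\ (snd q = snd p \/ snd q = snd p + h / 2 ^ S n)%R.
Proof.
  destruct p as [a c]. unfold quarter.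
  repeat match goal with |- context [Rle_dec ?x ?y] => destruct (Rle_dec x y) end;
  simpl; auto.
Qed.

Lemma quarter_big (f : C -> C) (w h E : R) (n : nat) (p : R * R) :
  (0 <= w)%R -> (0 <= h)%R ->
  Chol_rect f (fst p) (fst p + w / 2 ^ n) (snd p) (snd p + h / 2 ^ n) ->
  (E / 4 ^ n <= Cmod (rect f (fst p) (fst p + w / 2 ^ n) (snd p) (snd p + h / 2 ^ n))%C)%R ->
  let q := quarter f w h E n p in
  (E / 4 ^ S n <= Cmod (rect f (fst q) (fst q + w / 2 ^ S n) (snd q) (snd q + h / 2 ^ S n))%C)%R.
Proof.
  destruct p as [a c]. intros Hw Hh Hf H. simpl fst in *; simpl snd in *.
  assert (P2 : (0 < 2 ^ n)%R) by (apply pow_lt; lra).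
  assert (P4 : (0 < 4 ^ n)%R) by (apply pow_lt; lra).
  assert (Ew : (w / 2 ^ n = w / 2 ^ S n + w / 2 ^ S n)%R) by (simpl; field; lra).
  assert (Eh : (h / 2 ^ n = h / 2 ^ S n + h / 2 ^ S n)%R) by (simpl; field; lra).
  assert (Hw' : (0 <= w / 2 ^ S n)%R).
  { apply Rmult_le_pos; [lra|]. left. apply Rinv_0_lt_compat, pow_lt. lra. }
  assert (Hh' : (0 <= h / 2 ^ S n)%R).
  { apply Rmult_le_pos; [lra|]. left. apply Rinv_0_lt_compat, pow_lt. lra. }
  assert (E4 : (E / 4 ^ n = 4 * (E / 4 ^ S n))%R) by (simpl; field; lra).
  unfold quarter.
  rewrite Ew, Eh, E4 in H. rewrite Ew, Eh in Hf.
  set (w' := (w / 2 ^ S n)%R) in *. set (h' := (h / 2 ^ S n)%R) in *.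
  set (e := (E / 4 ^ S n)%R) in *.
  replace (a + (w' + w'))%R with (a + w' + w')%R in * by ring.
  replace (c + (h' + h'))%R with (c + h' + h')%R in * by ring.
  repeat match goal with |- context [Rle_dec ?x ?y] => destruct (Rle_dec x y) end;
  simpl; auto.
  assert (Hc : forall y, (c <= y <= c + h' + h')%R ->
    Ccont_on (fun x => f (x, y)) a (a + w' + w')).
  { intros y Hy t Ht. apply Ccont_horizontal, Hf; lra. }
  assert (Hv : forall x, (a <= x <= a + w' + w')%R ->
    Ccont_on (fun y => f (x, y)) c (c + h' + h')).
  { intros x Hx t Ht. apply Ccont_vertical, Hf; lra. }
  rewrite (rect_split_x f a (a + w') (a + w' + w')) in H by (try apply Hc; lra).
  rewrite (rect_split_y f a (a + w') c (c + h') (c + h' + h')) in H by (try apply Hv; lra).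
  rewrite (rect_split_y f (a + w') (a + w' + w') c (c + h') (c + h' + h')) in H by (try apply Hv; lra).
  pose proof (Cmod_triangle
    (rect f a (a + w') c (c + h') + rect f a (a + w') (c + h') (c + h' + h'))
    (rect f (a + w') (a + w' + w') c (c + h') + rect f (a + w') (a + w' + w') (c + h') (c + h' + h'))).
  pose proof (Cmod_triangle (rect f a (a + w') c (c + h')) (rect f a (a + w') (c + h') (c + h' + h'))).
  pose proof (Cmod_triangle (rect f (a + w') (a + w' + w') c (c + h'))
    (rect f (a + w') (a + w' + w') (c + h') (c + h' + h'))).
  repeat match goal with H : ~ (_ <= _)%R |- _ => apply Rnot_le_lt in H end.
  lra.
Qed.

(** The intervals are nested: left ends increase and right ends decrease, so every right end bounds
    all left ends and the supremum of the left ends lies in each interval. *)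
Lemma bisection_limit (u : nat -> R) (w : R) : (0 <= w)%R ->
  (forall n, u (S n) = u n \/ u (S n) = u n + w / 2 ^ S n)%R ->
  (forall n, u 0%nat <= u n /\ u n + w / 2 ^ n <= u 0%nat + w)%R /\
  exists l : R, forall n, (u n <= l <= u n + w / 2 ^ n)%R.
Proof.
  intros Hw H.
  assert (Hp : forall n, (0 <= w / 2 ^ n)%R).
  { intros n. apply Rmult_le_pos; [lra|]. left. apply Rinv_0_lt_compat, pow_lt. lra. }
  assert (Hs : forall n, (u n <= u (S n) /\ u (S n) + w / 2 ^ S n <= u n + w / 2 ^ n)%R).
  { intros n. pose proof (Hp (S n)).
    assert (w / 2 ^ n = w / 2 ^ S n + w / 2 ^ S n)%R.
    { simpl. field. apply pow_nonzero. lra. }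
    destruct (H n) as [E|E]; rewrite E; lra. }
  assert (Hm : forall n k, (u n <= u (n + k)%nat /\ u (n + k)%nat + w / 2 ^ (n + k) <= u n + w / 2 ^ n)%R).
  { intros n k. induction k as [|k IH].
    - rewrite Nat.add_0_r. lra.
    - rewrite Nat.add_succ_r. destruct (Hs (n + k)%nat). lra. }
  split.
  - intros n. destruct (Hm 0%nat n). simpl in *.
    replace (u 0%nat + w)%R with (u 0%nat + w / 1)%R by field. now split.
  - destruct (completeness (fun x => exists n, x = u n)) as [l [Hl1 Hl2]].
    + exists (u 0%nat + w)%R. intros x [n ->]. destruct (Hm 0%nat n) as [_ K].
      simpl in K. pose proof (Hp n). lra.
    + now exists (u 0%nat), 0%nat.
    + exists l. intros n. split.
      * apply Hl1. now exists n.
      * apply Hl2. intros x [m ->].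
        destruct (Nat.le_ge_cases n m) as [L|L].
        -- destruct (Hm n (m - n)%nat) as [_ K].
           replace (n + (m - n))%nat with m in K by lia. pose proof (Hp m). lra.
        -- destruct (Hm m (n - m)%nat) as [K _].
           replace (m + (n - m))%nat with n in K by lia. pose proof (Hp n). lra.
Qed.

Lemma goursat (f : C -> C) (a b c d : R) : (a <= b)%R -> (c <= d)%R ->
  Chol_rect f a b c d -> rect f a b c d = 0.
Proof.
  intros Hab Hcd Hf.
  destruct (Req_dec (Cmod (rect f a b c d)%C) 0) as [H0|H0]; [now apply Cmod_eq_0|].
  exfalso. set (E := Cmod (rect f a b c d)%C) in *.
  assert (HE : (0 < E)%R) by (pose proof (Cmod_ge_0 (rect f a b c d)); unfold E in *; lra).
  clear H0.
  set (w := (b - a)%R). set (h := (d - c)%R).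
  assert (Hw : (0 <= w)%R) by (unfold w; lra). assert (Hh : (0 <= h)%R) by (unfold h; lra).
  set (q := quarters f w h E a c).
  destruct (bisection_limit (fun n => fst (q n)) w Hw) as [A1 [x0 A2]].
  { intros n. apply (quarter_pos f w h E n (q n)). }
  destruct (bisection_limit (fun n => snd (q n)) h Hh) as [B1 [y0 B2]].
  { intros n. apply (quarter_pos f w h E n (q n)). }
  simpl fst in A1. simpl snd in B1.
  assert (Hp : forall n v, (0 <= v)%R -> (0 <= v / 2 ^ n)%R).
  { intros n v Hv. apply Rmult_le_pos; [lra|]. left. apply Rinv_0_lt_compat, pow_lt. lra. }
  assert (Hsub : forall n, Chol_rect f (fst (q n)) (fst (q n) + w / 2 ^ n)
    (snd (q n)) (snd (q n) + h / 2 ^ n)).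
  { intros n. destruct (A1 n), (B1 n).
    apply (Chol_rect_sub f a b c d); auto; unfold w, h in *; lra. }
  assert (Hbig : forall n, (E / 4 ^ n <= Cmod (rect f (fst (q n)) (fst (q n) + w / 2 ^ n)
    (snd (q n)) (snd (q n) + h / 2 ^ n))%C)%R).
  { induction n as [|n IH].
    - simpl. unfold w, h.
      replace (a + (b - a) / 1)%R with b by field.
      replace (c + (d - c) / 1)%R with d by field. unfold E. lra.
    - apply (quarter_big f w h E n (q n)); auto. }
  assert (Hx0 : (a <= x0 <= b)%R).
  { destruct (A2 0%nat). simpl in *. unfold w in *. lra. }
  assert (Hy0 : (c <= y0 <= d)%R).
  { destruct (B2 0%nat). simpl in *. unfold h in *. lra. }
  destruct (Hf x0 y0 Hx0 Hy0) as [l Hl].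
  set (S := (w + h)%R).
  (* At stage [n] the integral is at least [E / 4^n], while linear approximation bounds it by
     [2 eps D^2] with [D = S / 2^n]. The contradiction needs [2 eps S^2 < E]; the [+ 1] covers a
     degenerate rectangle with [S = 0]. *)
  set (eps := (E / (4 * (S + 1) * (S + 1)))%R).
  assert (HS : (0 <= S)%R) by (unfold S; lra).
  assert (He : (0 < eps)%R).
  { apply Rdiv_lt_0_compat; [lra|]. repeat apply Rmult_lt_0_compat; lra. }
  destruct (Hl eps He) as [r [Hr K]].
  assert (Hn : exists n, (S / 2 ^ n < r)%R).
  { destruct (pow_lt_1_zero (1 / 2) ltac:(rewrite Rabs_pos_eq; lra) (r / (S + 1))
      ltac:(apply Rdiv_lt_0_compat; lra)) as [n Kn].
    exists n. specialize (Kn n (le_n n)).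
    rewrite Rabs_pos_eq in Kn by (apply pow_le; lra).
    unfold Rdiv in Kn at 1. rewrite Rmult_1_l, pow_inv in Kn.
    apply (Rmult_lt_compat_r (S + 1)) in Kn; [|lra].
    replace (r / (S + 1) * (S + 1))%R with r in Kn by (field; lra).
    assert (0 < / 2 ^ n)%R by (apply Rinv_0_lt_compat, pow_lt; lra).
    unfold Rdiv. nra. }
  destruct Hn as [n Hn]. specialize (Hbig n). specialize (Hsub n).
  specialize (A2 n). specialize (B2 n). simpl in A2, B2.
  pose proof (Hp n w Hw). pose proof (Hp n h Hh).
  set (D := (S / 2 ^ n)%R) in *.
  assert (HD : (w / 2 ^ n + h / 2 ^ n = D)%R).
  { unfold D, S, Rdiv. ring. }
  assert (KD : (Cmod (rect f (fst (q n)) (fst (q n) + w / 2 ^ n)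
    (snd (q n)) (snd (q n) + h / 2 ^ n))%C <= 2 * (eps * D) * D)%R).
  { eapply Rle_trans.
    - apply (rect_small f (x0, y0) l eps D); try lra; auto.
      intros x y Hx Hy.
      assert (Hd : (Cmod ((x, y) - (x0, y0))%C <= D)%R).
      { eapply Rle_trans; [apply Cmod_Re_Im|]. simpl.
        assert (Rabs (x - x0) <= w / 2 ^ n)%R by (apply Rabs_le; lra).
        assert (Rabs (y - y0) <= h / 2 ^ n)%R by (apply Rabs_le; lra).
        unfold Rminus in *. lra. }
      replace (x, y) with ((x0, y0) + ((x, y) - (x0, y0))) at 1 by ring.
      eapply Rle_trans; [apply K; lra|]. apply Rmult_le_compat_l; lra.
    - right. f_equal. lra. }
  assert (E4 : (2 * (eps * D) * D < E / 4 ^ n)%R).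
  { assert (P : (0 < / 4 ^ n)%R) by (apply Rinv_0_lt_compat, pow_lt; lra).
    replace (2 * (eps * D) * D)%R with (2 * eps * (S * S) * / 4 ^ n)%R.
    2: { unfold D. replace 4%R with (2 * 2)%R by ring. rewrite Rpow_mult_distr. field.
         apply pow_nonzero. lra. }
    apply Rmult_lt_compat_r; [assumption|].
    replace E with (4 * eps * ((S + 1) * (S + 1)))%R by (unfold eps; field; lra). nra. }
  lra.
Qed.

(* Cutting off the four rectangles around a small square leaves only that square. *)
Lemma cauchy_removable (f : C -> C) (a b c d x0 y0 M r : R) :
  (a < x0 < b)%R -> (c < y0 < d)%R -> (0 < r)%R ->
  (forall x y, (a <= x <= b)%R -> (c <= y <= d)%R -> (x, y) <> (x0, y0) -> Chol f (x, y)) ->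
  (forall x y, (Rabs (x - x0) <= r)%R -> (Rabs (y - y0) <= r)%R -> (x, y) <> (x0, y0) ->
     (Cmod (f (x, y))%C <= M)%R) ->
  rect f a b c d = 0.
Proof.
  intros Hx Hy Hr Hf HM.
  destruct (Req_dec (Cmod (rect f a b c d)%C) 0) as [H0|H0]; [now apply Cmod_eq_0|].
  exfalso. set (E := Cmod (rect f a b c d)%C) in *.
  assert (HE : (0 < E)%R) by (pose proof (Cmod_ge_0 (rect f a b c d)); unfold E in *; lra).
  assert (HM0 : (0 <= M)%R).
  { eapply Rle_trans; [apply Cmod_ge_0|]. apply (HM (x0 + r) y0)%R.
    - rewrite Rabs_pos_eq; lra.
    - replace (y0 - y0)%R with 0%R by ring. rewrite Rabs_R0. lra.
    - intros Q. injection Q. lra. }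
  (* A square of half-side [s] contributes at most [8 M s]; the last entry of the minimum makes this
     at most [E / 2], the others keep the square inside the rectangle and inside the region where
     [M] is a bound. *)
  set (s := Rmin r (Rmin (Rmin (x0 - a) (b - x0)) (Rmin (Rmin (y0 - c) (d - y0)) (E / (16 * (M + 1)))))).
  assert (Hs : (0 < s)%R).
  { repeat apply Rmin_pos; try lra. apply Rdiv_lt_0_compat; lra. }
  assert (Ks : (s <= r /\ s <= x0 - a /\ s <= b - x0 /\ s <= y0 - c /\ s <= d - y0 /\ s <= E / (16 * (M + 1)))%R).
  { unfold s.
    repeat split; repeat first [apply Rle_refl | eapply Rle_trans; [apply Rmin_l|]; apply Rle_refl
      | eapply Rle_trans; [apply Rmin_l|]; eapply Rle_trans; [apply Rmin_l|]; apply Rle_refl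
      | eapply Rle_trans; [apply Rmin_l|]; eapply Rle_trans; [apply Rmin_r|]; apply Rle_refl
      | eapply Rle_trans; [apply Rmin_r|]]. }
  destruct Ks as (s1 & s2 & s3 & s4 & s5 & s6).
  assert (Ch : forall y p q, (c <= y <= d)%R -> (a <= p)%R -> (q <= b)%R -> y <> y0 \/ (x0 < p)%R \/ (q < x0)%R ->
    Ccont_on (fun x => f (x, y)) p q).
  { intros y p q Hyy Hp Hq Hn t Ht. apply Ccont_horizontal, Hf; try lra.
    intros Q. injection Q. intros. destruct Hn as [Hn|[Hn|Hn]]; lra. }
  assert (Cv : forall x p q, (a <= x <= b)%R -> (c <= p)%R -> (q <= d)%R -> x <> x0 \/ (y0 < p)%R \/ (q < y0)%R ->
    Ccont_on (fun y => f (x, y)) p q).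
  { intros x p q Hxx Hp Hq Hn t Ht. apply Ccont_vertical, Hf; try lra.
    intros Q. injection Q. intros. destruct Hn as [Hn|[Hn|Hn]]; lra. }
  assert (Gz : forall a' b' c' d', (a <= a')%R -> (a' <= b')%R -> (b' <= b)%R ->
    (c <= c')%R -> (c' <= d')%R -> (d' <= d)%R ->
    ((b' < x0) \/ (x0 < a') \/ (d' < y0) \/ (y0 < c'))%R -> rect f a' b' c' d' = 0).
  { intros a' b' c' d' h1 h2 h3 h4 h5 h6 Hn. apply goursat; auto.
    intros x y Hxx Hyy. apply Hf; try lra. intros Q. injection Q. intros.
    destruct Hn as [Hn|[Hn|[Hn|Hn]]]; lra. }
  assert (Eq : rect f a b c d = rect f (x0 - s) (x0 + s) (y0 - s) (y0 + s)).
  { rewrite (rect_split_x f a (x0 - s) b) by (try apply Ch; lra).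
    rewrite (rect_split_x f (x0 - s) (x0 + s) b) by (try apply Ch; lra).
    rewrite (rect_split_y f (x0 - s) (x0 + s) c (y0 - s) d) by (try apply Cv; lra).
    rewrite (rect_split_y f (x0 - s) (x0 + s) (y0 - s) (y0 + s) d) by (try apply Cv; lra).
    rewrite (Gz a (x0 - s)%R c d), (Gz (x0 + s)%R b c d),
      (Gz (x0 - s)%R (x0 + s)%R c (y0 - s)%R), (Gz (x0 - s)%R (x0 + s)%R (y0 + s)%R d) by lra.
    ring. }
  assert (B : (E <= 2 * M * (2 * s + 2 * s))%R).
  { unfold E. rewrite Eq. eapply Rle_trans.
    - apply (rect_bound f M); try lra.
      + split; split; first [apply Ch | apply Cv]; lra.
      + intros x y Hxx Hyy He. apply HM; try (apply Rabs_le; lra).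
        intros Q. injection Q. intros. destruct He as [He|[He|[He|He]]]; lra.
    - right. ring. }
  assert (8 * (M + 1) * s <= E / 2)%R.
  { replace (E / 2)%R with (8 * (M + 1) * (E / (16 * (M + 1))))%R by (field; lra).
    apply Rmult_le_compat_l; lra. }
  nra.
Qed.

(** * Uniqueness of analytic continuation *)

Lemma Ccont_on_bounded (F : R -> C) (a b : R) : (a <= b)%R -> Ccont_on F a b ->
  exists B : R, forall t, (a <= t <= b)%R -> (Cmod (F t)%C <= B)%R.
Proof.
  intros Hab HF.
  destruct (continuity_ab_maj (fun t => Cmod (F t)%C) a b Hab) as [m [Hm _]].
  - intros t Ht. apply continuity_pt_filterlim, filterlim_locally. intros eps.
    destruct (Ccont_eps F t (HF t Ht) (eps / 2)%R) as [d [Hd K]].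
    { pose proof (cond_pos eps). lra. }
    exists (mkposreal d Hd). intros u Hu. specialize (K u Hu).
    change (Rabs (Cmod (F u)%C - Cmod (F t)%C) < eps)%R.
    pose proof (Cmod_le_minus (F u) (F t)). pose proof (Cmod_le_minus (F t) (F u)).
    rewrite (Cmod_minus_sym (F t)) in *. pose proof (cond_pos eps).
    apply Rabs_def1; lra.
  - now exists (Cmod (F m)%C).
Qed.

Lemma Cplus_minus_r (a b : C) : a + (b - a) = b.
Proof. ring. Qed.

Lemma Cinv_Re_Im (u v : R) : (u <> 0 \/ v <> 0)%R ->
  / (u, v) = (u / (u * u + v * v), - v / (u * u + v * v))%R.
Proof.
  intros H. assert (u * u + v * v <> 0)%R by (destruct H; nra).
  unfold Cinv; simpl. apply injective_projections; simpl; field; auto.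
Qed.

Lemma Chol_shift_inv (z0 z : C) : z <> z0 -> Chol (fun w => / (w - z0)) z.
Proof.
  intros H. apply (Chol_inv (fun w => w - z0)).
  - apply Chol_minus; [apply Chol_id|apply Chol_const].
  - now apply Cminus_eq_contra.
Qed.

(* Each side of the rectangle contributes a positive imaginary part. *)
Lemma rect_inv_neq_0 (a b c d x0 y0 : R) : (a < x0 < b)%R -> (c < y0 < d)%R ->
  rect (fun z => / (z - (x0, y0))) a b c d <> 0.
Proof.
  intros Hx Hy E. set (f := fun z => / (z - (x0, y0))) in *.
  assert (Hf : forall x y, (x <> x0 \/ y <> y0) ->
    f (x, y) = ((x - x0) / ((x - x0) * (x - x0) + (y - y0) * (y - y0)),
               - (y - y0) / ((x - x0) * (x - x0) + (y - y0) * (y - y0)))%R).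
  { intros x y H. unfold f. rewrite <- Cinv_Re_Im by (destruct H; [left|right]; lra).
    f_equal. }
  assert (Hc : forall x y, (x <> x0 \/ y <> y0) -> Chol f (x, y)).
  { intros x y H. apply Chol_shift_inv. intros Q. injection Q. intros. now destruct H. }
  assert (P : forall x y, (x <> x0 \/ y <> y0) ->
    (0 < / ((x - x0) * (x - x0) + (y - y0) * (y - y0)))%R).
  { intros x y H. apply Rinv_0_lt_compat.
    pose proof (Rle_0_sqr (x - x0)). pose proof (Rle_0_sqr (y - y0)).
    destruct H as [H|H]; pose proof (Rsqr_pos_lt _ (Rminus_eq_contra _ _ H)); unfold Rsqr in *; lra. }
  assert (Z : forall (g : R -> R) (p q : R), (p < q)%R ->
     (forall t, (p <= t <= q)%R -> continuous g t) ->
     (forall t, (p < t < q)%R -> (g t < 0)%R) -> (RInt g p q < 0)%R).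
  { intros g p q Hpq Hg Hn. rewrite <- (Rmult_0_r (q - p)).
    change ((q - p) * 0)%R with (scal (q - p) 0)%R.
    rewrite <- (@RInt_const R_CompleteNormedModule).
    apply RInt_lt; auto. intros; apply continuous_const. }
  apply (f_equal Im) in E. unfold rect, CInt in E. simpl in E.
  rewrite !Rmult_0_l, !Rplus_0_l, !Rmult_1_l in E.
  assert (I1 : (0 < RInt (fun t => Im (f (t, c))%C) a b)%R).
  { apply RInt_gt_0; [lra| |].
    - intros x H. rewrite Hf by (right; lra). simpl.  apply Rmult_lt_0_compat; [lra|].
      apply P. right; lra.
    - intros x H. apply (Ccont_horizontal f x c). apply Hc. right; lra. }
  assert (I2 : (RInt (fun t => Im (f (t, d))%C) a b < 0)%R).
  { apply Z; [lra| |].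
    - intros x H. apply (Ccont_horizontal f x d). apply Hc. right; lra.
    - intros x H. rewrite Hf by (right; lra). simpl. pose proof (P x d ltac:(right; lra)).
      unfold Rdiv. nra. }
  assert (I3 : (0 < RInt (fun t => Re (f (b, t))%C) c d)%R).
  { apply RInt_gt_0; [lra| |].
    - intros x H. rewrite Hf by (left; lra). simpl.  apply Rmult_lt_0_compat; [lra|].
      apply P. left; lra.
    - intros x H. apply (Ccont_vertical f b x). apply Hc. left; lra. }
  assert (I4 : (RInt (fun t => Re (f (a, t))%C) c d < 0)%R).
  { apply Z; [lra| |].
    - intros x H. apply (Ccont_vertical f a x). apply Hc. left; lra.
    - intros x H. rewrite Hf by (left; lra). simpl. pose proof (P a x ltac:(left; lra)).
      unfold Rdiv. nra. }
  unfold Rminus in E. simpl in E.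
  change (RInt (fun t => Im (f (t, c))%C) a b + - RInt (fun t => Im (f (t, d))%C) a b
    + (RInt (fun t => Re (f (b, t))%C) c d + - RInt (fun t => Re (f (a, t))%C) c d) = 0)%R in E.
  lra.
Qed.

Lemma Chol_edges (f : C -> C) (a b c d : R) : (a <= b)%R -> (c <= d)%R ->
  (forall x y, (a <= x <= b)%R -> (c <= y <= d)%R ->
     (x = a \/ x = b \/ y = c \/ y = d) -> Chol f (x, y)) ->
  Ccont_edges f a b c d.
Proof.
  intros Hab Hcd H.
  split; split; intros t Ht; first [apply Ccont_horizontal|apply Ccont_vertical];
  apply H; auto; lra.
Qed.

(** The quotient [(f z - f z0) / (z - z0)] stays bounded near [z0] by differentiability, so its
    integral vanishes by [cauchy_removable]. The integral of [1 / (z - z0)] is left unevaluated;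
    that it is nonzero suffices for uniqueness. *)
Lemma cauchy_formula (f : C -> C) (a b c d x0 y0 : R) :
  (a < x0 < b)%R -> (c < y0 < d)%R -> Chol_rect f a b c d ->
  rect (fun z => f z * / (z - (x0, y0))) a b c d
    = f (x0, y0) * rect (fun z => / (z - (x0, y0))) a b c d.
Proof.
  intros Hx Hy Hf. set (z0 := (x0, y0) : C).
  assert (Hk : forall x y, (x, y) <> z0 -> Chol (fun z => / (z - z0)) (x, y)).
  { intros x y H. now apply Chol_shift_inv. }
  assert (Hne : forall x y, (x = a \/ x = b \/ y = c \/ y = d) -> (x, y) <> z0).
  { intros x y H Q. injection Q. intros. destruct H as [H|[H|[H|H]]]; lra. }
  destruct (Hf x0 y0 ltac:(lra) ltac:(lra)) as [l Hl].
  destruct (Hl 1%R Rlt_0_1) as [r [Hr K]].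
  set (g := fun z => (f z + - f z0) * / (z - z0)).
  assert (G0 : rect g a b c d = 0).
  { apply (cauchy_removable g a b c d x0 y0 (1 + Cmod l) (r / 4)); auto; [lra| |].
    - intros x y h1 h2 Hn. apply Chol_mult; [|now apply Hk].
      apply Chol_plus; [now apply Hf|apply Chol_const].
    - intros x y h1 h2 Hn.
      assert (Hz : (x, y) - z0 <> 0) by now apply Cminus_eq_contra.
      assert (Hp : (0 < Cmod ((x, y) - z0)%C)%R) by now apply Cmod_gt_0.
      unfold g. rewrite Cmod_mult, Cmod_inv by assumption.
      apply Rle_div_l; [assumption|].
      specialize (K ((x, y) - z0)). fold z0 in K.
      rewrite (Cplus_minus_r z0 (x, y)) in K.
      assert (Hs : (Cmod ((x, y) - z0)%C < r)%R).
      { eapply Rle_lt_trans; [apply Cmod_Re_Im|]. simpl. unfold Rminus in *. lra. }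
      specialize (K Hs).
      pose proof (Cmod_le_minus (f (x, y) - f z0) (l * ((x, y) - z0))) as T.
      rewrite Cmod_mult in T. unfold Cminus in *. lra. }
  assert (e1 : Ccont_edges (fun z => f z * / (z - z0)) a b c d).
  { apply Chol_edges; try lra. intros x y h1 h2 h3.
    apply Chol_mult; [now apply Hf|now apply Hk, Hne]. }
  assert (e2 : Ccont_edges (fun z => / (z - z0)) a b c d).
  { apply Chol_edges; try lra. intros x y h1 h2 h3. now apply Hk, Hne. }
  assert (e3 : Ccont_edges (fun z => (- f z0) * / (z - z0)) a b c d).
  { destruct e2 as [[p1 p2] [p3 p4]].
    split; split; intros t Ht; apply Ccont_mult; try apply Ccont_const;
    [now apply p1|now apply p2|now apply p3|now apply p4]. }
  rewrite (rect_ext g (fun z => f z * / (z - z0) + (- f z0) * / (z - z0))) in G0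
    by (try lra; intros; unfold g; ring).
  rewrite rect_plus, rect_scal in G0 by (auto; lra).
  transitivity (rect (fun z => f z * / (z - z0)) a b c d
    + (- f z0) * rect (fun z => / (z - z0)) a b c d + f z0 * rect (fun z => / (z - z0)) a b c d);
    [ring|]. rewrite G0. ring.
Qed.

Lemma Ccont_edges_bounded (f : C -> C) (a b c d : R) : (a <= b)%R -> (c <= d)%R ->
  Ccont_edges f a b c d ->
  exists B, (0 <= B)%R /\ forall x y, (a <= x <= b)%R -> (c <= y <= d)%R ->
     (x = a \/ x = b \/ y = c \/ y = d) -> (Cmod (f (x, y))%C <= B)%R.
Proof.
  intros Hab Hcd [[h1 h2] [h3 h4]].
  destruct (Ccont_on_bounded _ _ _ Hab h1) as [B1 K1].
  destruct (Ccont_on_bounded _ _ _ Hab h2) as [B2 K2].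
  destruct (Ccont_on_bounded _ _ _ Hcd h3) as [B3 K3].
  destruct (Ccont_on_bounded _ _ _ Hcd h4) as [B4 K4].
  exists (Rabs B1 + Rabs B2 + Rabs B3 + Rabs B4)%R.
  pose proof (Rabs_pos B1); pose proof (Rabs_pos B2);
  pose proof (Rabs_pos B3); pose proof (Rabs_pos B4).
  pose proof (Rle_abs B1); pose proof (Rle_abs B2);
  pose proof (Rle_abs B3); pose proof (Rle_abs B4).
  split; [lra|]. intros x y Hx Hy [-> | [-> | [-> | ->]]].
  - specialize (K4 y Hy). lra.
  - specialize (K3 y Hy). lra.
  - specialize (K1 x Hx). lra.
  - specialize (K2 x Hx). lra.
Qed.

(* Cauchy's formula for [F z / (z - a)^N], which is still holomorphic since [F] vanishes
   near [a]; then let [N] tend to infinity. *)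
Lemma identity_square (F : C -> C) (p q rho r : R) (z0 : C) :
  (0 < r)%R -> Chol_rect F (p - rho) (p + rho) (q - rho) (q + rho) ->
  (forall z, (Cmod (z - (p, q))%C < r)%R -> F z = 0) ->
  (Cmod (z0 - (p, q))%C < rho)%R -> F z0 = 0.
Proof.
  intros Hr HF H0 Hz0. set (a := (p, q) : C) in *.
  destruct (Ceq_dec (F z0) 0) as [E|E]; [exact E|]. exfalso.
  set (m := Cmod (z0 - a)%C) in *.
  assert (Hm : (r <= m)%R).
  { apply Rnot_lt_le. intros L. apply E. now apply H0. }
  assert (Hrho : (0 < rho)%R) by lra.
  destruct z0 as [x0 y0].
  assert (Hx : (p - rho < x0 < p + rho)%R).
  { pose proof (re_le_Cmod ((x0, y0) - a)) as T. simpl in T. fold m in T.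
    apply Rabs_le_between in T. unfold Rminus in *. lra. }
  assert (Hy : (q - rho < y0 < q + rho)%R).
  { pose proof (im_le_Cmod ((x0, y0) - a)) as T. simpl in T. fold m in T.
    apply Rabs_le_between in T. unfold Rminus in *. lra. }
  set (I0 := rect (fun z => / (z - (x0, y0))) (p - rho) (p + rho) (q - rho) (q + rho)).
  assert (HI : (0 < Cmod I0)%R) by (apply Cmod_gt_0, rect_inv_neq_0; auto).
  set (K := fun z => F z * / (z - (x0, y0))).
  (* The boundary has distance at least [rho] from [a], whereas the point under study has distance
     [m < rho]; dividing by [(z - a)^N] therefore gains the factor [(m / rho)^N]. *)
  assert (Hedge : forall x y, (p - rho <= x <= p + rho)%R -> (q - rho <= y <= q + rho)%R ->
     (x = p - rho \/ x = p + rho \/ y = q - rho \/ y = q + rho)%R ->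
     (x, y) <> (x0, y0) /\ (rho <= Cmod ((x, y) - a)%C)%R).
  { intros x y h1 h2 h3. split.
    - intros Q. injection Q. intros. destruct h3 as [h|[h|[h|h]]]; lra.
    - pose proof (re_le_Cmod ((x, y) - a)) as T1. pose proof (im_le_Cmod ((x, y) - a)) as T2.
      simpl in T1, T2. unfold Rminus in *. apply Rabs_le_between in T1. apply Rabs_le_between in T2.
      destruct h3 as [h|[h|[h|h]]]; lra. }
  assert (Kc : forall x y, (p - rho <= x <= p + rho)%R -> (q - rho <= y <= q + rho)%R ->
     (x = p - rho \/ x = p + rho \/ y = q - rho \/ y = q + rho)%R -> Chol K (x, y)).
  { intros x y h1 h2 h3. apply Chol_mult; [now apply HF|].
    apply Chol_shift_inv. now apply Hedge. }
  assert (Ke : Ccont_edges K (p - rho) (p + rho) (q - rho) (q + rho)).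
  { apply Chol_edges; auto; lra. }
  apply Ccont_edges_bounded in Ke; [|lra|lra]. destruct Ke as [B [HB KB]].
  assert (Main : forall N : nat, (Cmod (F (x0, y0))%C * Cmod I0 <= 8 * B * rho * (m / rho) ^ N)%R).
  { intros N. set (G := fun z => F z * (/ (z - a)) ^ N).
    assert (HG : Chol_rect G (p - rho) (p + rho) (q - rho) (q + rho)).
    { intros x y h1 h2. destruct (Ceq_dec (x, y) a) as [Q|Q].
      (* Around [a] the factor [F] is zero, so [G] is locally zero whatever value [/ 0] has. *)
      - apply (Chol_ext_loc (fun _ => 0)); [|apply Chol_const].
        exists r. split; [assumption|]. intros w Hw. unfold G.
        rewrite Q in Hw. rewrite (H0 w Hw). ring.
      - apply Chol_mult; [now apply HF|]. apply Chol_pow. now apply Chol_shift_inv. }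
    pose proof (cauchy_formula G _ _ _ _ x0 y0 Hx Hy HG) as CF. fold I0 in CF.
    assert (Hp : (0 < m)%R) by lra.
    assert (Ga : (Cmod (G (x0, y0))%C = Cmod (F (x0, y0))%C * (/ m) ^ N)%R).
    { unfold G. rewrite Cmod_mult, Cmod_pow, Cmod_inv; [reflexivity|].
      apply Cmod_gt_0. exact Hp. }
    assert (Bd : (Cmod (G (x0, y0) * I0)%C <= 8 * B * rho * (/ rho) ^ N)%R).
    { rewrite <- CF. eapply Rle_trans.
      - apply (rect_bound _ (B * (/ rho) ^ N)); try lra.
        + apply Chol_edges; try lra. intros x y h1 h2 h3.
          apply Chol_mult; [now apply HG|]. apply Chol_shift_inv. now apply Hedge.
        + intros x y h1 h2 h3.
          replace (G (x, y) * / ((x, y) - (x0, y0))) with (K (x, y) * (/ ((x, y) - a)) ^ N)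
            by (unfold K, G; ring).
          destruct (Hedge x y h1 h2 h3) as [_ L].
          rewrite Cmod_mult, Cmod_pow, Cmod_inv by (apply Cmod_gt_0; lra).
          apply Rmult_le_compat; try apply Cmod_ge_0.
          * apply pow_le. left. apply Rinv_0_lt_compat. lra.
          * now apply KB.
          * apply pow_incr. split; [left; apply Rinv_0_lt_compat; lra|].
            apply Rinv_le_contravar; lra.
      - right. ring. }
    rewrite Cmod_mult, Ga in Bd.
    assert (Pm : (0 < m ^ N)%R) by now apply pow_lt.
    apply (Rmult_le_compat_r (m ^ N)) in Bd; [|lra].
    rewrite pow_inv in Bd.
    replace (Cmod (F (x0, y0))%C * / m ^ N * Cmod I0 * m ^ N)%R
      with (Cmod (F (x0, y0))%C * Cmod I0)%R in Bd by (field; lra).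
    unfold Rdiv. rewrite Rpow_mult_distr. lra. }
  assert (Hq : (0 <= m / rho < 1)%R).
  { split; [apply Rle_mult_inv_pos; lra|]. apply Rlt_div_l; lra. }
  set (X := (Cmod (F (x0, y0))%C * Cmod I0)%R) in *.
  assert (HX : (0 < X)%R).
  { apply Rmult_lt_0_compat; [now apply Cmod_gt_0|assumption]. }
  destruct (pow_lt_1_zero (m / rho) ltac:(rewrite Rabs_pos_eq; lra) (X / (8 * B * rho + 1)))
    as [N HN].
  { apply Rdiv_lt_0_compat; [lra|]. assert (0 <= 8 * B * rho)%R by (apply Rmult_le_pos; lra). lra. }
  specialize (HN N (le_n N)). specialize (Main N).
  assert (P : (0 <= (m / rho) ^ N)%R) by (apply pow_le; lra).
  rewrite Rabs_pos_eq in HN by assumption.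
  assert (P2 : (0 <= 8 * B * rho)%R) by (apply Rmult_le_pos; lra).
  apply (Rmult_lt_compat_l (8 * B * rho + 1)) in HN; [|lra].
  replace ((8 * B * rho + 1) * (X / (8 * B * rho + 1)))%R with X in HN by (field; lra).
  lra.
Qed.

(** A non-real point lies in a square centred far up or down on the line [Re z = 3] which misses the
    real axis, hence misses [1], and whose centre has a neighbourhood in [Re z > 1]. Real points
    follow by continuity from the non-real points above them. *)
Lemma identity_half_plane (F : C -> C) :
  (forall z : C, z <> RtoC 1 -> Chol F z) -> (forall z, (1 < Re z)%R -> F z = 0) ->
  forall z : C, z <> RtoC 1 -> F z = 0.
Proof.
  intros HF H0.
  assert (NR : forall x y, y <> 0%R -> F (x, y) = 0).
  { intros x y Hy.
    (* This height solves [(3 - x)^2 + (y - Y)^2 = Y^2 - 1]: the point is nearer to the centre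
       [(3, Y)] than the real axis is, and [rho] is taken halfway between the two distances. *)
    set (Y := (((3 - x) * (3 - x) + y * y + 1) / (2 * y))%R).
    assert (HY : (2 * Y * y = (3 - x) * (3 - x) + y * y + 1)%R) by (unfold Y; field; lra).
    set (m := Cmod ((x, y) - (3%R, Y))%C).
    assert (Hm2 : (m ^ 2 = Y * Y - 1)%R).
    { unfold m. rewrite Cmod2_alt. simpl. nra. }
    assert (Hm : (m < Rabs Y)%R).
    { apply Rsqr_incrst_0; [|apply Cmod_ge_0|apply Rabs_pos].
      rewrite <- Rsqr_abs. unfold Rsqr. simpl in Hm2. lra. }
    set (rho := ((m + Rabs Y) / 2)%R).
    apply (identity_square F 3 Y rho 1); [lra| | |fold m; unfold rho; lra].
    - intros u v _ Hv. apply HF. intros Q. injection Q. intros Ev _.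
      rewrite Ev in Hv.
      assert (Rabs Y <= rho)%R by (apply Rabs_le; lra). unfold rho in *. lra.
    - intros z Hz. apply H0.
      pose proof (re_le_Cmod (z - (3%R, Y))) as T. destruct z as [u v]. simpl in *.
      apply Rabs_le_between in T. lra. }
  intros [x y] Hz. destruct (Req_dec y 0) as [->|Hy]; [|now apply NR].
  destruct (Ceq_dec (F (x, 0%R)) 0) as [E|E]; [exact E|]. exfalso.
  apply Cmod_gt_0 in E.
  destruct (Cderiv_cont F _ (HF _ Hz) (Cmod (F (x, 0%R))%C / 2)) as [d [Hd K]]; [lra|].
  specialize (K (0, d / 2)%R).
  assert (Q : (x, 0%R) + (0, d / 2)%R = (x, d / 2)%R).
  { apply injective_projections; simpl; ring. }
  rewrite Q, NR in K by lra.
  replace (0 - F (x, 0%R)) with (- F (x, 0%R)) in K by ring.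
  rewrite Cmod_opp in K.
  assert (Hs : (Cmod (0, d / 2)%R < d)%R).
  { eapply Rle_lt_trans; [apply Cmod_Re_Im|]. simpl. rewrite Rabs_R0, Rabs_pos_eq; lra. }
  specialize (K Hs). lra.
Qed.

(** * Exponential, logarithm, sine and cosine *)

Lemma Cexp_plus (a b : C) : Cexp (a + b) = Cexp a * Cexp b.
Proof.
  destruct a as [x y], b as [u v]. unfold Cexp; simpl.
  rewrite exp_plus, cos_plus, sin_plus.
  apply injective_projections; simpl; ring.
Qed.

Lemma Cexp_0 : Cexp 0 = 1.
Proof. unfold Cexp; simpl. rewrite exp_0, cos_0, sin_0. apply injective_projections; simpl; ring. Qed.

Lemma Cmod_Cexp (z : C) : Cmod (Cexp z)%C = exp (Re z).
Proof.
  apply Rsqr_inj; [apply Cmod_ge_0|left; apply exp_pos|].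
  rewrite !Rsqr_pow2, Cmod2_alt. unfold Cexp; simpl.
  pose proof (sin2_cos2 (Im z)) as H. unfold Rsqr in H.
  transitivity (exp (Re z) * exp (Re z) * (sin (Im z) * sin (Im z) + cos (Im z) * cos (Im z)))%R;
  [ring|]. rewrite H. ring.
Qed.

Lemma Cexp_neq_0 (z : C) : Cexp z <> 0.
Proof. apply Cmod_gt_0. rewrite Cmod_Cexp. apply exp_pos. Qed.

Lemma Cexp_opp (z : C) : Cexp (- z) = / Cexp z.
Proof.
  assert (H : Cexp z * Cexp (- z) = 1).
  { rewrite <- Cexp_plus, <- Cexp_0. f_equal. ring. }
  transitivity (/ Cexp z * (Cexp z * Cexp (- z))).
  - field. apply Cexp_neq_0.
  - rewrite H. ring.
Qed.

(** The index counts the terms, so the degree is below [n]; differentiation then lowers the index by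
    exactly one, down to the empty sum. *)
Fixpoint cexp_poly (n : nat) (w : C) : C :=
  match n with
  | O => 0
  | S m => cexp_poly m w + RtoC (/ INR (fact m)) * w ^ m
  end.

Lemma Cderiv_pow (n : nat) (z : C) :
  Cderiv (fun w => w ^ S n) z (RtoC (INR (S n)) * z ^ n).
Proof.
  induction n as [|n IH].
  - simpl. replace (1 * 1) with (1 * 1 + z * 0) by ring.
    apply (Cderiv_mult (fun w => w) (fun _ => 1)); [apply Cderiv_id|apply Cderiv_const].
  - replace (RtoC (INR (S (S n))) * z ^ S n)
      with (1 * z ^ S n + z * (RtoC (INR (S n)) * z ^ n)).
    + apply (Cderiv_mult (fun w => w) (fun w => w ^ S n)); [apply Cderiv_id|exact IH].
    + rewrite (S_INR (S n)), RtoC_plus. simpl. ring.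
Qed.

Lemma Cderiv_cexp_poly (n : nat) (z : C) : Cderiv (cexp_poly (S n)) z (cexp_poly n z).
Proof.
  induction n as [|n IH].
  - exact (Cderiv_const (cexp_poly 1 0) z).
  - change (cexp_poly (S (S n))) with
      (fun w => cexp_poly (S n) w + RtoC (/ INR (fact (S n))) * w ^ S n).
    replace (cexp_poly (S n) z) with (cexp_poly n z +
      (0 * z ^ S n + RtoC (/ INR (fact (S n))) * (RtoC (INR (S n)) * z ^ n))).
    + apply Cderiv_plus; [exact IH|].
      apply (Cderiv_mult (fun _ => RtoC (/ INR (fact (S n)))) (fun w => w ^ S n));
        [apply Cderiv_const|apply Cderiv_pow].
    + simpl cexp_poly. rewrite fact_simpl, mult_INR.
      assert (INR (fact n) <> 0)%R by apply INR_fact_neq_0.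
      assert (INR (S n) <> 0)%R by now apply not_0_INR.
      replace (/ INR (fact n))%R with (/ (INR (S n) * INR (fact n)) * INR (S n))%R
        by (field; auto).
      rewrite RtoC_mult. ring.
Qed.

Lemma exp_line_derive (w : C) (t : R) :
  is_derive (fun u => Re (Cexp (RtoC u * w))%C) t (Re (w * Cexp (RtoC t * w))%C) /\
  is_derive (fun u => Im (Cexp (RtoC u * w))%C) t (Im (w * Cexp (RtoC t * w))%C).
Proof.
  destruct w as [x y].
  split; unfold Cexp, Re, Im; simpl; auto_derive; auto; unfold Rminus; ring.
Qed.

Lemma Ccont_line (w : C) (t : R) : Ccont (fun u => RtoC u * w) t.
Proof.
  apply Ccont_mult; [|apply Ccont_const]. apply Ccont_RtoC, continuous_id.
Qed.

Lemma Ccont_exp_line (w : C) (t : R) : Ccont (fun u => Cexp (RtoC u * w)) t.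
Proof.
  destruct (exp_line_derive w t).
  split; apply (@ex_derive_continuous R_AbsRing); eexists; eassumption.
Qed.

Lemma Ccont_cexp_poly (n : nat) (w : C) (t : R) :
  Ccont (fun u => cexp_poly n (RtoC u * w)) t.
Proof.
  apply (Ccont_Chol (cexp_poly n) (fun u => RtoC u * w)); [|apply Ccont_line].
  destruct n; [exact (Chol_const 0 _)|]. eexists. apply Cderiv_cexp_poly.
Qed.

(* The remainder of order [n + 1] is [w] times the integral of that of order [n]; the
   free parameter [r] turns the factorial bound into a geometric one. *)
Lemma cexp_remainder_line (n : nat) (r : R) (w : C) (t : R) :
  (0 < r <= 1)%R -> (0 <= t)%R ->
  (Cmod (Cexp (RtoC t * w) - cexp_poly n (RtoC t * w))%C <= r ^ n * exp (Cmod w / r * t))%R.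
Proof.
  intros Hr. revert t. induction n as [|n IH]; intros t Ht.
  - simpl. replace (Cexp (RtoC t * w) - 0) with (Cexp (RtoC t * w)) by ring.
    rewrite Cmod_Cexp, Rmult_1_l.
    assert (H : (Re (RtoC t * w)%C <= Cmod w / r * t)%R).
    { simpl. pose proof (re_le_Cmod w) as H. pose proof (Rle_abs (Re w)).
      pose proof (Cmod_ge_0 w).
      assert (Cmod w <= Cmod w / r)%R.
      { apply Rle_div_r; [lra|]. nra. }
      change (fst w) with (Re w). nra. }
    destruct H as [H|H]; [left; now apply exp_increasing|right; now rewrite H].
  - set (rho := fun m u => Cexp (RtoC u * w) - cexp_poly m (RtoC u * w)).
    assert (Hc : forall m, Ccont_on (rho m) 0 t).
    { intros m u _. apply Ccont_minus; [apply Ccont_exp_line|apply Ccont_cexp_poly]. }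
    assert (E : rho (S n) t = CInt (fun u => w * rho n u) 0 t).
    { rewrite (CInt_derive (rho (S n))).
      - unfold rho at 3. replace (RtoC 0 * w) with (RtoC 0) by ring. rewrite Cexp_0.
        assert (Z : forall k, cexp_poly (S k) 0 = 1).
        { induction k as [|k IHk].
          - simpl. replace (/ 1)%R with 1%R by field. ring.
          - change (cexp_poly (S k) 0 + RtoC (/ INR (fact (S k))) * 0 ^ S k = 1).
            rewrite IHk. simpl. ring. }
        rewrite Z. ring.
      - exact Ht.
      - intros u _. destruct (exp_line_derive w u) as [D1 D2].
        destruct (Cderiv_line (cexp_poly (S n)) (fun v => RtoC v * w) w _ u
          ltac:(intros; rewrite RtoC_minus; ring) (Cderiv_cexp_poly n _)) as [D3 D4].
        unfold rho. split.
        + replace (Re (w * (Cexp (RtoC u * w) - cexp_poly n (RtoC u * w)))%C) with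
            (minus (Re (w * Cexp (RtoC u * w))%C) (Re (cexp_poly n (RtoC u * w) * w)%C))
            by (unfold minus, plus, opp; simpl; ring).
          exact (is_derive_minus _ _ _ _ _ D1 D3).
        + replace (Im (w * (Cexp (RtoC u * w) - cexp_poly n (RtoC u * w)))%C) with
            (minus (Im (w * Cexp (RtoC u * w))%C) (Im (cexp_poly n (RtoC u * w) * w)%C))
            by (unfold minus, plus, opp; simpl; ring).
          exact (is_derive_minus _ _ _ _ _ D2 D4).
      - intros u Hu. apply Ccont_mult; [apply Ccont_const|now apply Hc]. }
    change (Cmod (rho (S n) t)%C <= r ^ S n * exp (Cmod w / r * t))%R. rewrite E.
    (* The induction hypothesis times [Cmod w] is the derivative of [r^(n+1) exp (Cmod w / r * u)]:
       integrating divides by [Cmod w / r], which produces the new factor [r]. *)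
    set (g := fun u => (Cmod w * (r ^ n * exp (Cmod w / r * u)))%R).
    assert (Ig : is_RInt g 0 t (minus (r ^ S n * exp (Cmod w / r * t)) (r ^ S n * exp (Cmod w / r * 0)))%R).
    { apply (is_RInt_derive (fun u => r ^ S n * exp (Cmod w / r * u))%R).
      - intros u _. unfold g. auto_derive; auto. simpl. field. lra.
      - intros u _. unfold g. apply (@ex_derive_continuous R_AbsRing). auto_derive. auto. }
    eapply Rle_trans.
    + apply (CInt_bound _ g); auto.
      * intros u Hu. apply Ccont_mult; [apply Ccont_const|now apply Hc].
      * now exists (minus (r ^ S n * exp (Cmod w / r * t)) (r ^ S n * exp (Cmod w / r * 0)))%R.
      * intros u Hu. rewrite Cmod_mult. unfold g.
        apply Rmult_le_compat_l; [apply Cmod_ge_0|]. apply IH. lra.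
    + rewrite (@is_RInt_unique R_CompleteNormedModule _ _ _ _ Ig).
      unfold minus, plus, opp; simpl.
      assert (0 < r * r ^ n * exp (Cmod w / r * 0))%R.
      { repeat apply Rmult_lt_0_compat; [lra|apply pow_lt; lra|apply exp_pos]. }
      lra.
Qed.

Lemma cexp_remainder (n : nat) (r : R) (w : C) : (0 < r <= 1)%R ->
  (Cmod (Cexp w - cexp_poly n w)%C <= r ^ n * exp (Cmod w / r))%R.
Proof.
  intros Hr. pose proof (cexp_remainder_line n r w 1 Hr Rle_0_1) as H.
  rewrite Cmult_1_l, Rmult_1_r in H. exact H.
Qed.

Lemma cexp_poly_2 (w : C) : cexp_poly 2 w = 1 + w.
Proof.
  simpl. replace (/ 1)%R with 1%R by field. ring.
Qed.

(** With [r = Cmod h] in the remainder of order two, the geometric factor is [|h|^2] and the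
    exponential is [e <= 3]. The case [h = 0] is separate because [r] must be positive. *)
Lemma Cexp_quadratic (h : C) : (Cmod h <= 1)%R ->
  (Cmod (Cexp h - (1 + h))%C <= 3 * (Cmod h * Cmod h))%R.
Proof.
  intros Hh. rewrite <- cexp_poly_2.
  destruct (Req_dec (Cmod h) 0) as [E|E].
  - apply Cmod_eq_0 in E. subst h. rewrite cexp_poly_2, Cexp_0.
    replace (1 - (1 + 0)) with (RtoC 0) by ring. rewrite Cmod_0. lra.
  - assert (0 < Cmod h)%R by (pose proof (Cmod_ge_0 h); lra).
    eapply Rle_trans; [apply (cexp_remainder 2 (Cmod h)); lra|].
    replace (Cmod h / Cmod h)%R with 1%R by (field; lra).
    pose proof exp_le_3. simpl. nra.
Qed.

Lemma Cderiv_Cexp (z : C) : Cderiv Cexp z (Cexp z).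
Proof.
  intros eps He. set (K := (3 * exp (Re z))%R).
  pose proof (exp_pos (Re z)).
  exists (Rmin 1 (eps / K)). split.
  { apply Rmin_pos; [lra|]. apply Rdiv_lt_0_compat; unfold K; lra. }
  intros h Hh.
  pose proof (Rlt_le_trans _ _ _ Hh (Rmin_l _ _)) as h1.
  pose proof (Rlt_le_trans _ _ _ Hh (Rmin_r _ _)) as h2.
  rewrite Cexp_plus.
  replace (Cexp z * Cexp h - Cexp z - Cexp z * h) with (Cexp z * (Cexp h - (1 + h))) by ring.
  rewrite Cmod_mult, Cmod_Cexp. pose proof (Cmod_ge_0 h).
  pose proof (Cexp_quadratic h ltac:(lra)).
  assert (K * Cmod h <= eps)%R.
  { replace eps with (K * (eps / K))%R by (unfold K; field; lra).
    apply Rmult_le_compat_l; unfold K in *; lra. }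
  apply Rle_trans with (K * Cmod h * Cmod h)%R; [|nra].
  unfold K. nra.
Qed.

(* The principal branch, meaningful for [0 < Re z] only. *)
Definition Clog (z : C) : C :=
  (ln (Re z * Re z + Im z * Im z) / 2, atan (Im z / Re z))%R.

Lemma Cexp_Clog (z : C) : (0 < Re z)%R -> Cexp (Clog z) = z.
Proof.
  destruct z as [x y]. simpl. intros Hx.
  set (q := (x * x + y * y)%R).
  assert (Hq : (0 < q)%R) by (unfold q; nra).
  unfold Cexp, Clog; simpl. fold q.
  assert (E : exp (ln q / 2) = sqrt q).
  { apply Rsqr_inj; [left; apply exp_pos|apply sqrt_pos|].
    rewrite Rsqr_sqrt by lra. unfold Rsqr. rewrite <- exp_plus.
    replace (ln q / 2 + ln q / 2)%R with (ln q) by field. now apply exp_ln. }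
  rewrite E, cos_atan, sin_atan.
  assert (S : sqrt (1 + (y / x)²) = (sqrt q / x)%R).
  { rewrite <- (sqrt_Rsqr x) at 2 by lra. rewrite <- sqrt_div_alt by (unfold Rsqr; nra).
    f_equal. unfold Rsqr, q. field. lra. }
  rewrite S. assert (0 < sqrt q)%R by now apply sqrt_lt_R0.
  apply injective_projections; simpl; field; lra.
Qed.

Lemma Clog_RtoC (x : R) : (0 < x)%R -> Clog (RtoC x) = RtoC (ln x).
Proof.
  intros Hx. unfold Clog; simpl. apply injective_projections; simpl.
  - replace (x * x + 0 * 0)%R with (x * x)%R by ring. rewrite ln_mult by lra. field.
  - replace (0 / x)%R with 0%R by (field; lra). apply atan_0.
Qed.

Lemma Clog_continuous (z : C) : (0 < Re z)%R ->
  forall eps, (0 < eps)%R -> exists d, (0 < d)%R /\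
    forall h, (Cmod h < d)%R -> (Cmod (Clog (z + h) - Clog z)%C <= eps)%R.
Proof.
  destruct z as [x y]. simpl. intros Hx eps He.
  assert (c1 : continuous (fun p : R * R => fst p) (x, y)) by apply continuous_fst.
  assert (c2 : continuous (fun p : R * R => snd p) (x, y)) by apply continuous_snd.
  assert (H1 : continuous (fun p : R * R => ln (fst p * fst p + snd p * snd p) / 2)%R (x, y)).
  { apply (continuous_comp (fun p : R * R => fst p * fst p + snd p * snd p)%R (fun q => ln q / 2)%R).
    - apply (@continuous_plus _ R_AbsRing R_NormedModule);
      apply (@continuous_mult _ R_AbsRing); assumption.
    - apply (@ex_derive_continuous R_AbsRing). simpl. auto_derive. nra. }
  assert (H2 : continuous (fun p : R * R => atan (snd p / fst p)) (x, y)).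
  { apply (continuous_comp (fun p : R * R => snd p / fst p)%R atan).
    - apply (@continuous_mult _ R_AbsRing); [assumption|].
      apply (continuous_comp (fun p : R * R => fst p) Rinv); [assumption|].
      apply (@ex_derive_continuous R_AbsRing). simpl. auto_derive. lra.
    - apply (@ex_derive_continuous R_AbsRing). simpl. auto_derive. auto. }
  destruct (proj1 (filterlim_locally _ _) H1 (mkposreal (eps / 2) ltac:(lra))) as [d1 K1].
  destruct (proj1 (filterlim_locally _ _) H2 (mkposreal (eps / 2) ltac:(lra))) as [d2 K2].
  exists (Rmin d1 d2). split; [apply Rmin_pos; apply cond_pos|].
  intros h Hh.
  assert (B : forall d : posreal, (Cmod h < d)%R -> ball (x, y) d ((x, y) + h)).
  { intros d Hd. pose proof (re_le_Cmod h). pose proof (im_le_Cmod h).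
    split; simpl; unfold ball; simpl; unfold AbsRing_ball, abs, minus, plus, opp; simpl.
    - replace (x + fst h + - x)%R with (Re h) by (unfold Re; ring). lra.
    - replace (y + snd h + - y)%R with (Im h) by (unfold Im; ring). lra. }
  specialize (K1 ((x, y) + h) (B d1 (Rlt_le_trans _ _ _ Hh (Rmin_l _ _)))).
  specialize (K2 ((x, y) + h) (B d2 (Rlt_le_trans _ _ _ Hh (Rmin_r _ _)))).
  eapply Rle_trans; [apply Cmod_Re_Im|].
  assert (T1 : (Rabs (Re (Clog ((x, y) + h) - Clog (x, y))%C) < eps / 2)%R) by exact K1.
  assert (T2 : (Rabs (Im (Clog ((x, y) + h) - Clog (x, y))%C) < eps / 2)%R) by exact K2.
  lra.
Qed.

(** Inverse function argument: the increment [D] of [Clog] satisfies [Cexp D = 1 + h / z], so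
    [|h / z - D| <= 3 |D|^2]. Continuity gives [|D| <= 1/6], hence [|D| <= |h / z| + |D| / 2], that
    is [|D| <= 2 |h / z|], and the error is at most [12 |h / z|^2]. *)
Lemma Cderiv_Clog (z : C) : (0 < Re z)%R -> Cderiv Clog z (/ z).
Proof.
  intros Hz eps He.
  assert (Hz0 : z <> 0) by (intros E; rewrite E in Hz; simpl in Hz; lra).
  assert (Hm : (0 < Cmod z)%R) by now apply Cmod_gt_0.
  set (m := Cmod z) in *.
  destruct (Clog_continuous z Hz (/ 6) ltac:(lra)) as [d [Hd K]].
  (* The three bounds make [D] small, keep [z + h] in the right half-plane, and bring
     [12 |h|^2 / m^2] below [eps |h|]. *)
  exists (Rmin d (Rmin (Re z) (eps * (m * m) / 12))). split.
  { repeat apply Rmin_pos; try lra. apply Rdiv_lt_0_compat; [|lra].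
    repeat apply Rmult_lt_0_compat; lra. }
  intros h Hh.
  pose proof (Rlt_le_trans _ _ _ Hh (Rmin_l _ _)) as h1.
  pose proof (Rlt_le_trans _ _ _ Hh (Rmin_r _ _)) as h'.
  pose proof (Rlt_le_trans _ _ _ h' (Rmin_l _ _)) as h2.
  pose proof (Rlt_le_trans _ _ _ h' (Rmin_r _ _)) as h3.
  specialize (K h h1). set (D := Clog (z + h) - Clog z) in *.
  assert (Hzh : (0 < Re (z + h)%C)%R).
  { pose proof (re_le_Cmod h) as T. simpl. apply Rabs_le_between in T.
    unfold Re in *. lra. }
  assert (E : Cexp D = 1 + h / z).
  { unfold D, Cminus. rewrite Cexp_plus, Cexp_opp, !Cexp_Clog by assumption. field. assumption. }
  pose proof (Cexp_quadratic D ltac:(lra)) as Q. rewrite E in Q.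
  replace (1 + h / z - (1 + D)) with (h / z - D) in Q by ring.
  pose proof (Cmod_le_minus D (h / z)) as T. rewrite (Cmod_minus_sym D) in T.
  rewrite Cmod_div in T by assumption. fold m in T.
  pose proof (Cmod_ge_0 D). pose proof (Cmod_ge_0 h).
  assert (B : (Cmod D <= 2 * (Cmod h / m))%R) by nra.
  replace (D - / z * h) with (- (h / z - D)) by (unfold Cdiv; ring).
  rewrite Cmod_opp. eapply Rle_trans; [apply Q|].
  assert (0 <= Cmod h / m)%R by (apply Rle_mult_inv_pos; lra).
  apply Rle_trans with (12 * (Cmod h / m * (Cmod h / m)))%R; [nra|].
  replace (12 * (Cmod h / m * (Cmod h / m)))%R with (12 * (Cmod h) / (m * m) * Cmod h)%R
    by (field; lra).
  apply Rmult_le_compat_r; [lra|]. apply Rle_div_l; [nra|]. lra.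
Qed.

(** The power [z^(-s)], with the sign built in as it occurs in Dirichlet series. *)
Definition Cnpow (z s : C) : C := Cexp (- s * Clog z).

Lemma Chol_Cnpow (s z : C) : (0 < Re z)%R -> Chol (fun w => Cnpow w s) z.
Proof.
  intros Hz. apply (Chol_comp (fun w => - s * Clog w) Cexp).
  - apply Chol_mult; [apply Chol_const|]. eexists. now apply Cderiv_Clog.
  - eexists. apply Cderiv_Cexp.
Qed.

Lemma Cnpow_RtoC (x : R) (s : C) : (0 < x)%R -> Cnpow (RtoC x) s = pos_cpow x (- s).
Proof. intros Hx. unfold Cnpow, pos_cpow. now rewrite Clog_RtoC. Qed.

Lemma Cexp_INR_mult (n : nat) (z : C) : Cexp (RtoC (INR n) * z) = Cexp z ^ n.
Proof.
  induction n as [|n IH].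
  - simpl. rewrite Cmult_0_l. apply Cexp_0.
  - rewrite S_INR, RtoC_plus. simpl. rewrite <- IH, <- Cexp_plus. f_equal. ring.
Qed.

(** A power of [z] under the integral sign becomes a shift of [s]; this is the origin of the
    arguments [s - 2k] in the expansion. *)
Lemma Cnpow_minus_INR (z s : C) (n : nat) : (0 < Re z)%R ->
  Cnpow z (s - RtoC (INR n)) = z ^ n * Cnpow z s.
Proof.
  intros Hz. unfold Cnpow.
  replace (- (s - RtoC (INR n)) * Clog z) with (RtoC (INR n) * Clog z + - s * Clog z) by ring.
  now rewrite Cexp_plus, Cexp_INR_mult, Cexp_Clog.
Qed.

(** * Complex cosine and sine, and their size away from the real axis *)

Definition Ccos (z : C) : C := RtoC (1 / 2)%R * (Cexp (Ci * z) + Cexp (- (Ci * z))).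
Definition Csin (z : C) : C := RtoC (1 / 2)%R * (- Ci * (Cexp (Ci * z) - Cexp (- (Ci * z)))).

Lemma Chol_Cexp_lin (k z : C) : Chol (fun w => Cexp (k * w)) z.
Proof.
  apply (Chol_comp (fun w => k * w) Cexp).
  - apply Chol_mult; [apply Chol_const|apply Chol_id].
  - eexists. apply Cderiv_Cexp.
Qed.

Lemma Chol_Ccos_lin (k z : C) : Chol (fun w => Ccos (k * w)) z.
Proof.
  apply Chol_mult; [apply Chol_const|]. apply Chol_plus.
  - apply (Chol_ext (fun w => Cexp ((Ci * k) * w))); [intros; f_equal; ring|].
    apply Chol_Cexp_lin.
  - apply (Chol_ext (fun w => Cexp ((- Ci * k) * w))); [intros; f_equal; ring|].
    apply Chol_Cexp_lin.
Qed.

Lemma Cderiv_Csin_0 : Cderiv Csin 0 1.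
Proof.
  (* The derivative is first written in the unsimplified shape that the product and chain rules
     produce, and evaluated at the end. *)
  replace (RtoC 1) with (0 * (- Ci * (Cexp (Ci * 0) - Cexp (- (Ci * 0)))) + RtoC (1 / 2)%R *
    (0 * (Cexp (Ci * 0) - Cexp (- (Ci * 0))) + - Ci * (Cexp (Ci * 0) * (0 * 0 + Ci * 1) + (- Cexp (-Ci * 0) * (0 * 0 + - Ci * 1))))).
  - apply (Cderiv_mult (fun _ => RtoC (1 / 2)%R)
      (fun w => - Ci * (Cexp (Ci * w) - Cexp (- (Ci * w))))); [apply Cderiv_const|].
    apply (Cderiv_mult (fun _ => - Ci) (fun w => Cexp (Ci * w) - Cexp (- (Ci * w))));
      [apply Cderiv_const|].
    apply (Cderiv_plus (fun w => Cexp (Ci * w)) (fun w => - Cexp (- (Ci * w)))).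
    + apply (Cderiv_comp (fun w => Ci * w) Cexp); [|apply Cderiv_Cexp].
      apply (Cderiv_mult (fun _ => Ci) (fun w => w)); [apply Cderiv_const|apply Cderiv_id].
    + apply (Cderiv_ext_loc (fun w => (- (1)) * Cexp (- Ci * w))).
      { exists 1%R. split; [lra|]. intros w _.
        replace (- Ci * w) with (- (Ci * w)) by ring. ring. }
      replace (- Cexp (- Ci * 0) * (0 * 0 + - Ci * 1)) with
        (0 * Cexp (- Ci * 0) + (- (1)) * (Cexp (- Ci * 0) * (0 * 0 + - Ci * 1))) by ring.
      apply (Cderiv_mult (fun _ => - (1)) (fun w => Cexp (- Ci * w))); [apply Cderiv_const|].
      apply (Cderiv_comp (fun w => - Ci * w) Cexp); [|apply Cderiv_Cexp].
      apply (Cderiv_mult (fun _ => - Ci) (fun w => w)); [apply Cderiv_const|apply Cderiv_id].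
  - replace (Ci * 0) with (RtoC 0) by ring. replace (- Ci * 0) with (RtoC 0) by ring.
    replace (- RtoC 0) with (RtoC 0) by ring. rewrite Cexp_0.
    apply injective_projections; simpl; field.
Qed.

Lemma Chol_Csin_lin (k z : C) : Chol (fun w => Csin (k * w)) z.
Proof.
  apply Chol_mult; [apply Chol_const|]. apply Chol_mult; [apply Chol_const|]. apply Chol_minus.
  - apply (Chol_ext (fun w => Cexp ((Ci * k) * w))); [intros; f_equal; ring|].
    apply Chol_Cexp_lin.
  - apply (Chol_ext (fun w => Cexp ((- Ci * k) * w))); [intros; f_equal; ring|].
    apply Chol_Cexp_lin.
Qed.

Lemma Csin_Re_Im (x y : R) : Csin (x, y) = (sin x * cosh y, cos x * sinh y)%R.
Proof.
  unfold Csin, Cexp, cosh, sinh. simpl.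
  replace (0 * x - 1 * y)%R with (- y)%R by ring. replace (- - y)%R with y by ring.
  replace (0 * y + 1 * x)%R with x by ring. rewrite cos_neg, sin_neg.
  apply injective_projections; simpl; field.
Qed.

Lemma Ccos_Re_Im (x y : R) : Ccos (x, y) = (cos x * cosh y, - sin x * sinh y)%R.
Proof.
  unfold Ccos, Cexp, cosh, sinh. simpl.
  replace (0 * x - 1 * y)%R with (- y)%R by ring. replace (- - y)%R with y by ring.
  replace (0 * y + 1 * x)%R with x by ring. rewrite cos_neg, sin_neg.
  apply injective_projections; simpl; field.
Qed.

Lemma Ccos_RtoC (x : R) : Ccos (RtoC x) = RtoC (cos x).
Proof.
  unfold RtoC at 1. rewrite Ccos_Re_Im, cosh_0, sinh_0.
  apply injective_projections; simpl; ring.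
Qed.

Lemma exp_le_mono (x y : R) : (x <= y)%R -> (exp x <= exp y)%R.
Proof. intros [H|H]; [left; now apply exp_increasing|right; now rewrite H]. Qed.

Lemma Cmod_Ccos_le (z : C) : (Cmod (Ccos z)%C <= exp (Rabs (Im z)))%R.
Proof.
  unfold Ccos. rewrite Cmod_mult, Cmod_R, Rabs_pos_eq by lra.
  pose proof (Cmod_triangle (Cexp (Ci * z)) (Cexp (- (Ci * z)))) as H.
  rewrite !Cmod_Cexp in H.
  assert (exp (Re (Ci * z)%C) <= exp (Rabs (Im z)))%R.
  { apply exp_le_mono. pose proof (Rle_abs (- Im z)). rewrite Rabs_Ropp in *.
    simpl. unfold Im in *. lra. }
  assert (exp (Re (- (Ci * z))%C) <= exp (Rabs (Im z)))%R.
  { apply exp_le_mono. pose proof (Rle_abs (Im z)).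
    simpl. unfold Im in *. lra. }
  lra.
Qed.

Lemma cosh2_sinh2 (y : R) : (cosh y ^ 2 = 1 + sinh y ^ 2)%R.
Proof.
  unfold cosh, sinh. assert (exp y * exp (- y) = 1)%R.
  { rewrite <- exp_plus, Rplus_opp_r. apply exp_0. }
  simpl. nra.
Qed.

(** Since [|sin (x + i y)|^2 = sin^2 x + sinh^2 y]. This is the lower bound on horizontal sides of
    contours. *)
Lemma Rabs_sinh_le_Csin (z : C) : (Rabs (sinh (Im z)) <= Cmod (Csin z)%C)%R.
Proof.
  destruct z as [x y]. simpl Im.
  rewrite <- (Rabs_pos_eq (Cmod (Csin (x, y))%C)) by apply Cmod_ge_0.
  apply Rsqr_le_abs_0. rewrite !Rsqr_pow2, Cmod2_alt, Csin_Re_Im. simpl Re; simpl Im.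
  rewrite !Rpow_mult_distr, cosh2_sinh2.
  pose proof (sin2_cos2 x) as H. rewrite !Rsqr_pow2 in H.
  pose proof (pow2_ge_0 (sin x)). nra.
Qed.

(** * Integrals over the real line *)

Definition Clim (u : nat -> C) (l : C) : Prop :=
  is_lim_seq (fun n => Cmod (u n - l)%C) 0%R.

Lemma Clim_squeeze (u : nat -> C) (l : C) (v : nat -> R) :
  (forall n, (Cmod (u n - l)%C <= v n)%R) -> is_lim_seq v 0%R -> Clim u l.
Proof.
  intros H Hv. apply (is_lim_seq_le_le (fun _ => 0%R) _ v); auto using is_lim_seq_const.
  intros n. split; [apply Cmod_ge_0|apply H].
Qed.

Lemma Clim_ext (u v : nat -> C) (l : C) : (forall n, u n = v n) -> Clim u l -> Clim v l.
Proof. intros E. apply is_lim_seq_ext. intros n. now rewrite E. Qed.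

Lemma Clim_plus (u v : nat -> C) (l k : C) :
  Clim u l -> Clim v k -> Clim (fun n => u n + v n) (l + k).
Proof.
  intros H1 H2. apply (Clim_squeeze _ _ (fun n => Cmod (u n - l)%C + Cmod (v n - k)%C)%R).
  - intros n. replace (u n + v n - (l + k)) with ((u n - l) + (v n - k)) by ring.
    apply Cmod_triangle.
  - replace 0%R with (0 + 0)%R by ring. now apply is_lim_seq_plus'.
Qed.

Lemma Clim_scal (c : C) (u : nat -> C) (l : C) : Clim u l -> Clim (fun n => c * u n) (c * l).
Proof.
  intros H. apply (Clim_squeeze _ _ (fun n => Cmod c * Cmod (u n - l)%C)%R).
  - intros n. replace (c * u n - c * l) with (c * (u n - l)) by ring.
    rewrite Cmod_mult. apply Rle_refl.
  - replace 0%R with (Cmod c * 0)%R by ring.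
    apply (is_lim_seq_scal_l _ (Cmod c) 0%R H).
Qed.

Lemma Clim_Re_Im (u : nat -> C) (l : C) : Clim u l ->
  is_lim_seq (fun n => Re (u n)%C) (Re l) /\ is_lim_seq (fun n => Im (u n)%C) (Im l).
Proof.
  intros H.
  assert (T : forall (v : nat -> R) (k : R),
    (forall n, (Rabs (v n - k) <= Cmod (u n - l)%C)%R) -> is_lim_seq v k).
  { intros v k Hv. apply is_lim_seq_ext with (fun n => (v n - k) + k)%R; [intros; ring|].
    replace (Finite k) with (Finite (0 + k)%R) by (f_equal; ring).
    apply is_lim_seq_plus'; [|apply is_lim_seq_const].
    apply is_lim_seq_abs_0.
    apply (is_lim_seq_le_le (fun _ => 0%R) _ (fun n => Cmod (u n - l)%C));
      auto using is_lim_seq_const.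
    intros n. split; [apply Rabs_pos|apply Hv]. }
  split; apply T; intros n; [apply (re_le_Cmod (u n - l))|apply (im_le_Cmod (u n - l))].
Qed.

Lemma Re_Im_Clim (u : nat -> C) (l : C) :
  is_lim_seq (fun n => Re (u n)%C) (Re l) -> is_lim_seq (fun n => Im (u n)%C) (Im l) -> Clim u l.
Proof.
  intros H1 H2.
  apply (Clim_squeeze _ _ (fun n => Rabs (Re (u n)%C - Re l) + Rabs (Im (u n)%C - Im l))%R).
  - intros n. apply (Cmod_Re_Im (u n - l)).
  - assert (T : forall (v : nat -> R) (k : R), is_lim_seq v k ->
      is_lim_seq (fun n => Rabs (v n - k)) 0%R).
    { intros v k Hv. apply (is_lim_seq_abs_0 (fun n => v n - k)%R).
      replace 0%R with (k - k)%R by ring.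
      apply is_lim_seq_minus'; [exact Hv|apply is_lim_seq_const]. }
    replace 0%R with (0 + 0)%R by ring. apply is_lim_seq_plus'; now apply T.
Qed.

Lemma Clim_unique (u : nat -> C) (l k : C) : Clim u l -> Clim u k -> l = k.
Proof.
  intros H1 H2. apply Clim_Re_Im in H1, H2. destruct H1 as [a b], H2 as [c d].
  apply is_lim_seq_unique in a, b, c, d. apply injective_projections.
  - rewrite a in c. now injection c.
  - rewrite b in d. now injection d.
Qed.

Lemma Clim_Cmod_le (u : nat -> C) (l : C) (B : R) :
  (forall n, (Cmod (u n)%C <= B)%R) -> Clim u l -> (Cmod l <= B)%R.
Proof.
  intros H Hu.
  assert (L : is_lim_seq (fun n => B + Cmod (u n - l)%C)%R (B + 0)%R).
  { apply is_lim_seq_plus'; [apply is_lim_seq_const|exact Hu]. }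
  rewrite Rplus_0_r in L.
  apply (is_lim_seq_le (fun _ => Cmod l) _ (Cmod l) B) in L; auto using is_lim_seq_const.
  intros n. pose proof (Cmod_le_minus l (u n)). rewrite (Cmod_minus_sym l) in *.
  specialize (H n). lra.
Qed.

(** Symmetric truncation at integers is enough, as the integrands in use decay exponentially. *)
Definition is_lint (F : R -> C) (l : C) : Prop :=
  Clim (fun n => CInt F (- INR n) (INR n)) l.

(** A total function, so that integrals can be named before convergence is known; the value has a
    meaning only together with [is_lint]. *)
Definition LInt (F : R -> C) : C :=
  (real (Lim_seq (fun n => Re (CInt F (- INR n) (INR n))%C)),
   real (Lim_seq (fun n => Im (CInt F (- INR n) (INR n))%C))).

Lemma is_lint_LInt (F : R -> C) (l : C) : is_lint F l -> LInt F = l.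
Proof.
  intros H. apply Clim_Re_Im in H. destruct H as [H1 H2]. unfold LInt.
  rewrite (is_lim_seq_unique _ _ H1), (is_lim_seq_unique _ _ H2). now destruct l.
Qed.

(** The constants are explicit because the resulting bound [2 M / delta] on the integral is what
    makes remainders tend to zero. *)
Definition exp_decay (F : R -> C) (M delta : R) : Prop :=
  (forall t, Ccont F t) /\ (0 < delta)%R /\
  forall t, (Cmod (F t)%C <= M * exp (- delta * Rabs t))%R.

Lemma exp_lim_0 (c : R) : (0 < c)%R -> is_lim_seq (fun n => exp (- c * INR n)) 0%R.
Proof.
  intros Hc. apply is_lim_seq_ext with (fun n => exp (- c) ^ n)%R.
  - intros n. induction n as [|n IH].
    + simpl. now rewrite Rmult_0_r, exp_0.
    + rewrite S_INR. simpl. rewrite IH, <- exp_plus. f_equal. ring.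
  - apply is_lim_seq_geom. rewrite Rabs_pos_eq by (left; apply exp_pos).
    rewrite <- exp_0. apply exp_increasing. lra.
Qed.

Lemma CInt_tail (F : R -> C) (M delta a b : R) : (a <= b)%R -> (0 < delta)%R ->
  Ccont_on F a b ->
  (forall t, (a <= t <= b)%R -> (Cmod (F t)%C <= M * exp (- delta * t))%R) ->
  (0 <= M)%R -> (Cmod (CInt F a b)%C <= M / delta * exp (- delta * a))%R.
Proof.
  intros Hab Hd HF H HM.
  set (G := fun t => (- (M / delta) * exp (- delta * t))%R).
  assert (I : is_RInt (fun t => M * exp (- delta * t))%R a b (minus (G b) (G a))).
  { apply (is_RInt_derive G).
    - intros t _. unfold G. auto_derive; auto. field. lra.
    - intros t _. apply (@ex_derive_continuous R_AbsRing). auto_derive. auto. }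
  eapply Rle_trans.
  - apply (CInt_bound F (fun t => M * exp (- delta * t))%R); auto. eexists. exact I.
  - rewrite (@is_RInt_unique R_CompleteNormedModule _ _ _ _ I).
    unfold minus, plus, opp, G; simpl.
    assert (0 <= M / delta)%R by (apply Rle_mult_inv_pos; lra).
    pose proof (exp_pos (- delta * b)). nra.
Qed.

Lemma exp_decay_pos (F : R -> C) (M delta : R) : exp_decay F M delta -> (0 <= M)%R.
Proof.
  intros (_ & _ & H). specialize (H 0%R). rewrite Rabs_R0, Rmult_0_r, exp_0 in H.
  pose proof (Cmod_ge_0 (F 0%R)). lra.
Qed.

Lemma lint_increment (F : R -> C) (M delta : R) (a b : R) : exp_decay F M delta ->
  (0 <= a <= b)%R ->
  (Cmod (CInt F (- b) b - CInt F (- a) a)%C <= 2 * M / delta * exp (- delta * a))%R.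
Proof.
  intros HF Hab. pose proof (exp_decay_pos _ _ _ HF) as HM. destruct HF as (Hc & Hd & HF).
  assert (Hco : forall p q, Ccont_on F p q) by (intros p q t _; apply Hc).
  rewrite (CInt_Chasles F (- b) (- a) b) by (auto; lra).
  rewrite (CInt_Chasles F (- a) a b) by (auto; lra).
  rewrite <- (CInt_reflect F a b) by (auto; lra).
  replace (CInt (fun t => F (- t)%R) a b + (CInt F (- a) a + CInt F a b) - CInt F (- a) a)
    with (CInt (fun t => F (- t)%R) a b + CInt F a b) by ring.
  eapply Rle_trans; [apply Cmod_triangle|].
  assert (T1 : (Cmod (CInt F a b)%C <= M / delta * exp (- delta * a))%R).
  { apply CInt_tail; auto; try lra. intros t Ht. specialize (HF t).
    rewrite Rabs_pos_eq in HF by lra. exact HF. }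
  assert (T2 : (Cmod (CInt (fun t => F (- t)%R) a b)%C <= M / delta * exp (- delta * a))%R).
  { apply CInt_tail; auto; try lra.
    - intros t _. destruct (Hc (- t)%R) as [c1 c2].
      assert (Cn : continuous (fun u => - u)%R t).
      { apply (@continuous_opp _ R_AbsRing R_NormedModule), continuous_id. }
      split; [exact (continuous_comp _ (fun u => Re (F u)%C) t Cn c1)
             |exact (continuous_comp _ (fun u => Im (F u)%C) t Cn c2)].
    - intros t Ht. specialize (HF (- t)%R).
      rewrite Rabs_Ropp, Rabs_pos_eq in HF by lra. exact HF. }
  replace (2 * M / delta)%R with (M / delta + M / delta)%R by (field; lra). lra.
Qed.

Lemma CInt_point (F : R -> C) (a : R) : CInt F a a = 0.
Proof. unfold CInt. rewrite !(@RInt_point R_CompleteNormedModule). reflexivity. Qed.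

Lemma exp_decay_lint (F : R -> C) (M delta : R) : exp_decay F M delta ->
  is_lint F (LInt F) /\ (Cmod (LInt F)%C <= 2 * M / delta)%R.
Proof.
  intros HF. set (u := fun n => CInt F (- INR n) (INR n)).
  pose proof (exp_decay_pos _ _ _ HF) as HM.
  assert (Hd : (0 < delta)%R) by apply HF.
  assert (Inc : forall n m, (n <= m)%nat ->
    (Cmod (u m - u n)%C <= 2 * M / delta * exp (- delta * INR n))%R).
  { intros n m L. apply (lint_increment F M delta (INR n) (INR m) HF). split; [apply pos_INR|now apply le_INR]. }
  assert (Cau : forall eps : posreal, exists N, forall n m, (N <= n)%nat -> (N <= m)%nat ->
    (Cmod (u n - u m)%C < eps)%R).
  { intros eps.
    assert (L : is_lim_seq (fun n => 4 * M / delta * exp (- delta * INR n))%R (4 * M / delta * 0)%R).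
    { apply (is_lim_seq_scal_l _ (4 * M / delta)%R 0%R). now apply exp_lim_0. }
    rewrite Rmult_0_r in L.
    destruct (proj2 (is_lim_seq_spec _ 0%R) L eps) as [N HN]. exists N. intros n m Hn Hm.
    specialize (HN N (le_n N)). rewrite Rminus_0_r in HN.
    pose proof (Inc N n Hn). pose proof (Inc N m Hm).
    pose proof (Rle_abs (4 * M / delta * exp (- delta * INR N))).
    replace (u n - u m) with ((u n - u N) - (u m - u N)) by ring.
    eapply Rle_lt_trans; [apply Cmod_triangle_minus|].
    replace (4 * M / delta)%R with (2 * M / delta + 2 * M / delta)%R in * by (field; lra). lra. }
  assert (X : exists l, Clim u l).
  { assert (E1 : ex_finite_lim_seq (fun n => Re (u n)%C)).
    { apply ex_lim_seq_cauchy_corr. intros eps. destruct (Cau eps) as [N HN].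
      exists N. intros n m Hn Hm. eapply Rle_lt_trans; [|apply (HN n m Hn Hm)].
      apply (re_le_Cmod (u n - u m)). }
    assert (E2 : ex_finite_lim_seq (fun n => Im (u n)%C)).
    { apply ex_lim_seq_cauchy_corr. intros eps. destruct (Cau eps) as [N HN].
      exists N. intros n m Hn Hm. eapply Rle_lt_trans; [|apply (HN n m Hn Hm)].
      apply (im_le_Cmod (u n - u m)). }
    destruct E1 as [l1 E1], E2 as [l2 E2]. exists (l1, l2). now apply Re_Im_Clim. }
  destruct X as [l Hl]. rewrite (is_lint_LInt F l Hl). split; [exact Hl|].
  (* The bound is the increment estimate starting from the empty interval at [0]. *)
  apply (Clim_Cmod_le u); auto. intros n. specialize (Inc 0%nat n (Nat.le_0_l n)).
  simpl INR in Inc. rewrite Rmult_0_r, exp_0, Rmult_1_r in Inc.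
  replace (u n - u 0%nat) with (u n) in Inc; [exact Inc|].
  unfold u at 3. simpl INR. rewrite Ropp_0, CInt_point. ring.
Qed.

Lemma is_lint_plus (F G : R -> C) (l k : C) : (forall t, Ccont F t) -> (forall t, Ccont G t) ->
  is_lint F l -> is_lint G k -> is_lint (fun t => F t + G t) (l + k).
Proof.
  intros HF HG H1 H2. apply (Clim_ext (fun n => CInt F (- INR n) (INR n) + CInt G (- INR n) (INR n))).
  - intros n. symmetry. pose proof (pos_INR n).
    apply CInt_plus; [lra|intros t _; apply HF|intros t _; apply HG].
  - now apply Clim_plus.
Qed.

Lemma is_lint_scal (F : R -> C) (c l : C) : (forall t, Ccont F t) ->
  is_lint F l -> is_lint (fun t => c * F t) (c * l).
Proof.
  intros HF H. apply (Clim_ext (fun n => c * CInt F (- INR n) (INR n))).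
  - intros n. symmetry. pose proof (pos_INR n). apply CInt_scal; [lra|intros t _; apply HF].
  - now apply Clim_scal.
Qed.

Lemma is_lint_ext (F G : R -> C) (l : C) : (forall t, F t = G t) -> is_lint F l -> is_lint G l.
Proof.
  intros E. apply Clim_ext. intros n. pose proof (pos_INR n). apply CInt_ext; auto; lra.
Qed.

(** * Summation by residues *)

Lemma cosh_pos (y : R) : (0 < cosh y)%R.
Proof. unfold cosh. pose proof (exp_pos y). pose proof (exp_pos (- y)). lra. Qed.

Lemma inv_cosh_le (y : R) : (/ cosh y <= 2 * exp (- Rabs y))%R.
Proof.
  assert (H : (exp (Rabs y) / 2 <= cosh y)%R).
  { unfold cosh, Rabs. destruct (Rcase_abs y); pose proof (exp_pos y); pose proof (exp_pos (- y)); lra. }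
  rewrite exp_Ropp. pose proof (exp_pos (Rabs y)).
  replace (2 * / exp (Rabs y))%R with (/ (exp (Rabs y) / 2))%R by (field; lra).
  apply Rinv_le_contravar; lra.
Qed.

Lemma sinh_ge (y : R) : (1 <= y)%R -> (exp y / 4 <= sinh y)%R.
Proof.
  intros Hy. unfold sinh. pose proof (exp_ineq1_le y) as H.
  assert (exp (- y) <= 1)%R by (rewrite <- exp_0; apply exp_le_mono; lra). lra.
Qed.

Definition sech_pi (t : R) : C := RtoC (/ cosh (PI * t)).

Lemma continuous_inv_cosh (t : R) : continuous (fun u => / cosh (PI * u))%R t.
Proof.
  apply (@ex_derive_continuous R_AbsRing). unfold cosh. auto_derive.
  pose proof (cosh_pos (PI * t)) as H. unfold cosh in H. lra.
Qed.

Lemma Ccont_sech (t : R) : Ccont sech_pi t.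
Proof. apply Ccont_RtoC, continuous_inv_cosh. Qed.

Lemma Cmod_sech_le (t : R) : (Cmod (sech_pi t)%C <= 2 * exp (- PI * Rabs t))%R.
Proof.
  unfold sech_pi. pose proof (cosh_pos (PI * t)). pose proof PI_RGT_0.
  rewrite Cmod_R, Rabs_pos_eq by (left; now apply Rinv_0_lt_compat).
  eapply Rle_trans; [apply inv_cosh_le|]. rewrite Rabs_mult, (Rabs_pos_eq PI) by lra.
  right. f_equal. f_equal. ring.
Qed.

(** A primitive is [2 / PI * atan (exp (PI t))], and [atan (1 / u) = PI / 2 - atan u] combines the
    two endpoints into one vanishing term. *)
Lemma is_lint_sech : is_lint sech_pi 1.
Proof.
  pose proof PI_RGT_0 as Hpi.
  set (Phi := fun t => (2 / PI * atan (exp (PI * t)))%R).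
  assert (E : forall n, CInt sech_pi (- INR n) (INR n) =
    RtoC (1 - 4 / PI * atan (exp (- PI * INR n)))%R).
  { intros n. pose proof (pos_INR n).
    rewrite (CInt_derive (fun t => RtoC (Phi t))).
    - rewrite <- RtoC_minus. f_equal. unfold Phi.
      replace (PI * - INR n)%R with (- PI * INR n)%R by ring.
      replace (PI * INR n)%R with (- (- PI * INR n))%R by ring.
      rewrite exp_Ropp, atan_inv by apply exp_pos. field. lra.
    - lra.
    - intros t _. simpl. split; [|apply (@is_derive_const R_AbsRing R_NormedModule)].
      unfold Phi, cosh. auto_derive; auto. rewrite exp_Ropp.
      pose proof (exp_pos (PI * t)). field. repeat split; nra.
    - intros t _. apply Ccont_sech. }
  apply (Clim_ext (fun n => RtoC (1 - 4 / PI * atan (exp (- PI * INR n)))%R)).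
  { intros n. now rewrite E. }
  apply Re_Im_Clim; simpl; [|apply is_lim_seq_const].
  replace (Finite 1) with (Finite (1 - 4 / PI * atan 0)%R) by (rewrite atan_0; f_equal; ring).
  apply is_lim_seq_minus'; [apply is_lim_seq_const|].
  apply (is_lim_seq_scal_l _ (4 / PI)%R (atan 0)).
  apply is_lim_seq_continuous.
  - apply derivable_continuous_pt, derivable_pt_atan.
  - now apply exp_lim_0.
Qed.

Definition half_line (N t : R) : C := (N + 1 / 2, t)%R.

Lemma Ccont_half_line (N t : R) : Ccont (half_line N) t.
Proof. apply Ccont_pair; [apply continuous_const|apply continuous_id]. Qed.

Lemma Csin_neq_0 (x y : R) : (- (1 / 2) <= x <= 1 / 2)%R -> (x, y) <> (0, 0)%R ->
  Csin (RtoC PI * (x, y)) <> 0.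
Proof.
  intros Hx Hn. pose proof PI_RGT_0.
  replace (RtoC PI * (x, y)) with ((PI * x, PI * y)%R : C)
    by (apply injective_projections; simpl; ring).
  rewrite Csin_Re_Im. intros E. injection E. intros E2 E1.
  pose proof (cosh_pos (PI * y)).
  assert (S : sin (PI * x) = 0%R).
  { apply Rmult_integral in E1. destruct E1; [assumption|lra]. }
  assert (X : x = 0%R).
  { destruct (Rtotal_order x 0) as [L|[L|L]]; [|exact L|].
    - assert (0 < sin (- (PI * x)))%R by (apply sin_gt_0; nra).
      rewrite sin_neg in *. lra.
    - assert (0 < sin (PI * x))%R by (apply sin_gt_0; nra). lra. }
  subst x. rewrite Rmult_0_r, cos_0 in E2.
  assert (Y : y <> 0%R) by (intros ->; now apply Hn).
  assert (sinh (PI * y) <> 0)%R.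
  { intros Z. assert (PI * y = 0)%R.
    { destruct (Rtotal_order (PI * y) 0) as [L|[L|L]]; [|exact L|];
      unfold sinh in Z; [pose proof (exp_increasing (PI * y) (- (PI * y)) ltac:(lra))
                        |pose proof (exp_increasing (- (PI * y)) (PI * y) ltac:(lra))]; lra. }
    apply Y. nra. }
  lra.
Qed.

(** As [Csin] has derivative [1] at [0], an error of half the argument leaves at least
    [PI / 2 * |w|], and [PI / 2 > 1]. *)
Lemma Csin_pi_lower : exists d, (0 < d)%R /\ forall w, (Cmod w < d)%R ->
  (Cmod w <= Cmod (Csin (RtoC PI * w))%C)%R.
Proof.
  pose proof PI_RGT_0. pose proof PI2_1.
  destruct (Cderiv_Csin_0 (1 / 2)%R ltac:(lra)) as [d [Hd K]].
  exists (d / PI)%R. split; [now apply Rdiv_lt_0_compat|]. intros w Hw.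
  specialize (K (RtoC PI * w)). rewrite Cmod_mult, Cmod_R, (Rabs_pos_eq PI) in K by lra.
  assert (L : (PI * Cmod w < d)%R).
  { apply (Rmult_lt_compat_l PI) in Hw; [|lra].
    replace (PI * (d / PI))%R with d in Hw by (field; lra). exact Hw. }
  specialize (K L).
  replace (0 + RtoC PI * w) with (RtoC PI * w) in K by ring.
  assert (S0 : Csin 0 = 0).
  { unfold RtoC at 1. rewrite Csin_Re_Im, sin_0, sinh_0. apply injective_projections; simpl; ring. }
  rewrite S0 in K.
  replace (Csin (RtoC PI * w) - 0 - 1 * (RtoC PI * w))
    with (- (RtoC PI * w - Csin (RtoC PI * w))) in K by ring.
  rewrite Cmod_opp in K.
  pose proof (Cmod_le_minus (RtoC PI * w) (Csin (RtoC PI * w))) as T.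
  rewrite Cmod_mult, Cmod_R, Rabs_pos_eq in T by lra.
  pose proof (Cmod_ge_0 w). nra.
Qed.

(* The residue at [N] of [f z / sin (pi z)]; subtracting the constant [f N] makes the
   singularity removable, and the constant itself is accounted for by the integral of [sech]. *)
Lemma lint_residue (f : C -> C) (A b N : R) :
  (1 <= N)%R -> (0 <= b < PI)%R ->
  (forall z, (1 / 2 <= Re z)%R -> Chol f z) ->
  (forall z, (1 / 2 <= Re z)%R -> (Cmod (f z)%C <= A * exp (b * Rabs (Im z)))%R) ->
  is_lint (fun t => (f (half_line N t) + f (half_line (N - 1) t)) * sech_pi t)
    (RtoC 2 * f (RtoC N)).
Proof.
  intros HN Hb Hf HA. pose proof PI_RGT_0 as Hpi. pose proof PI2_1 as Hpi2.
  set (fN := f (RtoC N)).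
  set (g := fun z => (f (RtoC N + z) - fN) * / Csin (RtoC PI * z)).
  assert (Hfs : forall z, (- (1 / 2) <= Re z)%R -> Chol (fun w => f (RtoC N + w)) z).
  { intros z Hz. apply (Chol_comp (fun w => RtoC N + w) f).
    - apply Chol_plus; [apply Chol_const|apply Chol_id].
    - apply Hf. simpl. unfold Re in Hz. lra. }
  assert (Hg : forall x y, (- (1 / 2) <= x <= 1 / 2)%R -> (x, y) <> (0, 0)%R -> Chol g (x, y)).
  { intros x y Hx Hn. apply Chol_mult.
    - apply Chol_minus; [apply Hfs; simpl; lra|apply Chol_const].
    - apply (Chol_inv (fun z => Csin (RtoC PI * z))); [apply Chol_Csin_lin|].
      now apply Csin_neq_0. }
  assert (G0 : forall n, (1 <= n)%R -> rect g (- (1 / 2)) (1 / 2) (- n) n = 0).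
  { intros n Hn.
    destruct (Hfs 0 ltac:(simpl; lra)) as [l Hl].
    destruct (Hl 1%R Rlt_0_1) as [d1 [Hd1 K1]].
    destruct Csin_pi_lower as [d2 [Hd2 K2]].
    apply (cauchy_removable g _ _ _ _ 0 0 (1 + Cmod l) (Rmin d1 d2 / 4)); try lra.
    - pose proof (Rmin_pos _ _ Hd1 Hd2). lra.
    - intros x y Hx _ Hn0. now apply Hg.
    - intros x y Hx Hy Hn0. rewrite Rminus_0_r in Hx, Hy.
      assert (Hs : (Cmod (x, y)%C < Rmin d1 d2)%R).
      { eapply Rle_lt_trans; [apply Cmod_Re_Im|]. simpl.
        pose proof (Rmin_pos _ _ Hd1 Hd2). lra. }
      pose proof (Rlt_le_trans _ _ _ Hs (Rmin_l _ _)) as Hs1.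
      pose proof (Rlt_le_trans _ _ _ Hs (Rmin_r _ _)) as Hs2.
      specialize (K1 _ Hs1). specialize (K2 _ Hs2).
      assert (Hz : (0 < Cmod (x, y)%C)%R) by (apply Cmod_gt_0; exact Hn0).
      assert (Hz2 : Csin (RtoC PI * (x, y)) <> 0) by (apply Cmod_gt_0; lra).
      unfold g. rewrite Cmod_mult, Cmod_inv by assumption.
      apply Rle_div_l; [lra|].
      rewrite Cplus_0_l, Cplus_0_r in K1. fold fN in K1.
      pose proof (Cmod_le_minus (f (RtoC N + (x, y)) - fN) (l * (x, y))) as T.
      rewrite Cmod_mult in T. pose proof (Cmod_ge_0 l). nra. }
  set (Hz := fun y => CInt (fun x => g (x, y)) (- (1 / 2)) (1 / 2)).
  (* The horizontal sides die out: the sine is at least [exp (PI n) / 4] there, the numerator at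
     most of order [exp (b n)], and [b < PI]. *)
  assert (HB : forall n y, (1 <= n)%R -> (Rabs y = n)%R ->
    (Cmod (Hz y)%C <= 4 * (A + Cmod fN) * exp (- (PI - b) * n))%R).
  { intros n y Hn Hy. unfold Hz.
    assert (Y0 : y <> 0%R) by (intros ->; rewrite Rabs_R0 in Hy; lra).
    replace (4 * (A + Cmod fN) * exp (- (PI - b) * n))%R with
      (4 * (A + Cmod fN) * exp (- (PI - b) * n) * (1 / 2 - - (1 / 2)))%R by field.
    apply CInt_bound_const; [lra| |].
    - intros x Hx. apply Ccont_horizontal, Hg; [lra|]. intros Q. injection Q. intros. lra.
    - intros x Hx. unfold g.
      assert (Hs : (exp (PI * n) / 4 <= Cmod (Csin (RtoC PI * (x, y)))%C)%R).
      { eapply Rle_trans; [|apply Rabs_sinh_le_Csin]. simpl.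
        replace (PI * y + 0 * x)%R with (PI * y)%R by ring.
        eapply Rle_trans; [apply sinh_ge; nra|].
        rewrite <- Hy. unfold Rabs. destruct (Rcase_abs y).
        - eapply Rle_trans; [|apply Rcomplements.Rabs_maj2].
          right. unfold sinh. rewrite Ropp_mult_distr_r, Ropp_involutive.
          replace (- (PI * - y))%R with (PI * y)%R by ring.
          replace (PI * - y)%R with (- (PI * y))%R by ring. field.
        - apply Rle_abs. }
      assert (Pe : (0 < exp (PI * n) / 4)%R) by (pose proof (exp_pos (PI * n)); lra).
      rewrite Cmod_mult, Cmod_inv by (apply Cmod_gt_0; lra).
      assert (Hnum : (Cmod (f (RtoC N + (x, y)) - fN)%C <= (A + Cmod fN) * exp (b * n))%R).
      { eapply Rle_trans; [apply Cmod_triangle_minus|].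
        specialize (HA (RtoC N + (x, y)) ltac:(simpl; lra)). simpl in HA.
        rewrite Rplus_0_l, Hy in HA.
        assert (1 <= exp (b * n))%R by (rewrite <- exp_0; apply exp_le_mono; nra).
        pose proof (Cmod_ge_0 fN). nra. }
      eapply Rle_trans.
      { apply Rmult_le_compat; [apply Cmod_ge_0| |exact Hnum|].
        - left. apply Rinv_0_lt_compat. lra.
        - apply Rinv_le_contravar; [|exact Hs]. lra. }
      right. replace (- (PI - b) * n)%R with (b * n + - (PI * n))%R by ring.
      rewrite exp_plus, exp_Ropp. field. pose proof (exp_pos (PI * n)). lra. }
  assert (Lf : forall M t, (0 <= M)%R -> Ccont (fun u => f (half_line M u)) t).
  { intros M t HM. apply (Ccont_Chol f (half_line M)); [|apply Ccont_half_line].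
    apply Hf. simpl. lra. }
  assert (HA0 : (0 <= A + Cmod fN)%R).
  { specialize (HA (RtoC N) ltac:(simpl; lra)). simpl in HA.
    rewrite Rabs_R0, Rmult_0_r, exp_0 in HA. fold fN in HA. pose proof (Cmod_ge_0 fN). lra. }
  (* On the right side the sine is [cosh], on the left side [- cosh]; the opposite signs turn the
     difference of the two sides into the sum in the statement. *)
  assert (ER : forall y, g (1 / 2, y)%R = (f (half_line N y) - fN) * sech_pi y).
  { intros y. unfold g, sech_pi, half_line.
    replace (RtoC N + (1 / 2, y)%R) with ((N + 1 / 2, y)%R : C)
      by (apply injective_projections; simpl; ring).
    replace (RtoC PI * (1 / 2, y)%R) with ((PI / 2, PI * y)%R : C)
      by (apply injective_projections; simpl; field).
    rewrite Csin_Re_Im, sin_PI2, cos_PI2.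
    pose proof (cosh_pos (PI * y)). f_equal. rewrite RtoC_inv by lra. f_equal.
    apply injective_projections; simpl; ring. }
  assert (EL : forall y, g (- (1 / 2), y)%R = - ((f (half_line (N - 1) y) - fN) * sech_pi y)).
  { intros y. unfold g, sech_pi, half_line.
    replace (RtoC N + (- (1 / 2), y)%R) with ((N - 1 + 1 / 2, y)%R : C)
      by (apply injective_projections; simpl; field).
    replace (RtoC PI * (- (1 / 2), y)%R) with ((- (PI / 2), PI * y)%R : C)
      by (apply injective_projections; simpl; field).
    rewrite Csin_Re_Im, sin_neg, cos_neg, sin_PI2, cos_PI2.
    pose proof (cosh_pos (PI * y)). rewrite RtoC_inv by lra.
    replace ((- (1) * cosh (PI * y))%R, (0 * sinh (PI * y))%R) with (- RtoC (cosh (PI * y)))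
      by (apply injective_projections; simpl; ring).
    field. intros Q. apply RtoC_inj in Q. lra. }
  set (P := fun t => (f (half_line N t) + f (half_line (N - 1) t)) * sech_pi t).
  assert (PC : forall t, Ccont P t).
  { intros t. apply Ccont_mult; [|apply Ccont_sech].
    apply Ccont_plus; apply Lf; lra. }
  (* This is the right side minus the left side of the contour for [g]: the subtracted constant [fN]
     appears once on each side, hence the factor [2]. *)
  set (X := fun n => CInt P (- INR n) (INR n) +
    (- (RtoC 2 * fN)) * CInt sech_pi (- INR n) (INR n)).
  assert (HX : Clim X 0).
  { apply (Clim_squeeze _ _ (fun n => 8 * (A + Cmod fN) * exp (- (PI - b) * INR n))%R).
    - intros n. replace (X n - 0) with (X n) by ring. destruct n as [|n].
      + unfold X. simpl INR. rewrite Ropp_0, !CInt_point.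
        replace (0 + - (RtoC 2 * fN) * 0) with (RtoC 0) by ring. rewrite Cmod_0.
        pose proof (exp_pos (- (PI - b) * 0)). apply Rmult_le_pos; lra.
      + assert (Hm : (1 <= INR (S n))%R) by (rewrite S_INR; pose proof (pos_INR n); lra).
        set (m := INR (S n)) in *.
        assert (EX : X (S n) = CInt (fun y => g (1 / 2, y)%R) (- m) m
                             - CInt (fun y => g (- (1 / 2), y)%R) (- m) m).
        { assert (c1 : Ccont_on (fun y => g (1 / 2, y)%R) (- m) m).
          { intros t _. apply Ccont_vertical, Hg; [lra|]. intros Q. injection Q. intros. lra. }
          assert (c2 : Ccont_on (fun y => g (- (1 / 2), y)%R) (- m) m).
          { intros t _. apply Ccont_vertical, Hg; [lra|]. intros Q. injection Q. intros. lra. }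
          rewrite <- CInt_minus by (auto; lra).
          unfold X. fold m. rewrite <- CInt_scal, <- CInt_plus.
          - apply CInt_ext; [lra|]. intros t _. rewrite ER, EL. unfold P. ring.
          - lra.
          - intros t _. apply PC.
          - intros t _. apply Ccont_mult; [apply Ccont_const|apply Ccont_sech].
          - lra.
          - intros t _. apply Ccont_sech. }
        specialize (G0 m Hm). unfold rect in G0. rewrite <- EX in G0.
        fold (Hz (- m)%R) in G0. fold (Hz m) in G0.
        assert (EQ : X (S n) = Ci * (Hz (- m)%R - Hz m)).
        { transitivity (Ci * (Hz (- m)%R - Hz m)
            - Ci * (Hz (- m)%R - Hz m + Ci * X (S n))).
          - apply injective_projections; simpl; ring.
          - rewrite G0. ring. }
        rewrite EQ, Cmod_mult, Cmod_Ci, Rmult_1_l.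
        pose proof (HB m m Hm ltac:(rewrite Rabs_pos_eq; lra)).
        pose proof (HB m (- m)%R Hm ltac:(rewrite Rabs_Ropp, Rabs_pos_eq; lra)).
        pose proof (Cmod_triangle_minus (Hz (- m)%R) (Hz m)). lra.
    - replace (Finite 0) with (Finite (8 * (A + Cmod fN) * 0)%R) by (f_equal; ring).
      apply (is_lim_seq_scal_l _ (8 * (A + Cmod fN))%R 0%R). apply exp_lim_0. lra. }
  replace (RtoC 2 * fN) with (0 + RtoC 2 * fN * 1) by ring.
  apply (Clim_ext (fun n => X n + RtoC 2 * fN * CInt sech_pi (- INR n) (INR n))).
  - intros n. unfold X. fold P. ring.
  - apply Clim_plus; [exact HX|]. apply Clim_scal. exact is_lint_sech.
Qed.

(** Unlike in [sum_n], the upper index is excluded, so that inductions on partial sums can start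
    from the empty sum. *)
Fixpoint csum (a : nat -> C) (n : nat) : C :=
  match n with
  | O => 0
  | S m => csum a m + a m
  end.

Lemma sum_n_csum (a : nat -> C) (n : nat) :
  @sum_n C_AbelianMonoid a n = csum a (S n).
Proof.
  induction n as [|n IH].
  - rewrite sum_O. simpl. ring.
  - rewrite sum_Sn, IH. reflexivity.
Qed.

Lemma Cis_series_csum (a : nat -> C) (l : C) : Cis_series a l <-> Clim (csum a) l.
Proof.
  assert (E : forall n, @sum_n C_NormedModule a n = csum a (S n)) by apply sum_n_csum.
  split.
  - intros H. apply is_lim_seq_incr_1.
    apply is_lim_seq_spec. intros eps.
    destruct (H (fun w => Cmod (w - l)%C < eps)%R) as [N HN].
    { exists (mkposreal (eps / 2) ltac:(pose proof (cond_pos eps); lra)).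
      intros w [h1 h2]. simpl in h1, h2. pose proof (Cmod_Re_Im (w - l)) as T.
      change (Rabs (Re (w - l)%C) < eps / 2)%R in h1.
      change (Rabs (Im (w - l)%C) < eps / 2)%R in h2. lra. }
    exists N. intros n Hn. rewrite Rminus_0_r, Rabs_pos_eq by apply Cmod_ge_0.
    rewrite <- E. now apply HN.
  - intros H P [eps HP].
    apply is_lim_seq_incr_1 in H.
    destruct (proj2 (is_lim_seq_spec _ 0%R) H eps) as [N HN]. exists N. intros n Hn.
    apply HP. specialize (HN n Hn). rewrite Rminus_0_r, Rabs_pos_eq in HN by apply Cmod_ge_0.
    rewrite <- E in HN.
    pose proof (re_le_Cmod (@sum_n C_NormedModule a n - l)).
    pose proof (im_le_Cmod (@sum_n C_NormedModule a n - l)).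
    split.
    + change (Rabs (Re (@sum_n C_NormedModule a n - l)%C) < eps)%R. lra.
    + change (Rabs (Im (@sum_n C_NormedModule a n - l)%C) < eps)%R. lra.
Qed.

Lemma exp_decay_sech (F : R -> C) (A b : R) : (b < PI)%R -> (forall t, Ccont F t) ->
  (forall t, (Cmod (F t)%C <= A * exp (b * Rabs t))%R) ->
  exp_decay (fun t => F t * sech_pi t) (2 * A) (PI - b).
Proof.
  intros Hb Hc H. split; [|split].
  - intros t. apply Ccont_mult; [apply Hc|apply Ccont_sech].
  - lra.
  - intros t. rewrite Cmod_mult.
    replace (- (PI - b) * Rabs t)%R with (b * Rabs t + - PI * Rabs t)%R by ring.
    rewrite exp_plus.
    replace (2 * A * (exp (b * Rabs t) * exp (- PI * Rabs t)))%R
      with (A * exp (b * Rabs t) * (2 * exp (- PI * Rabs t)))%R by ring.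
    apply Rmult_le_compat; try apply Cmod_ge_0; [apply H|apply Cmod_sech_le].
Qed.

(** With [a N] half the integral over [Re z = N + 1/2], the residue at [N + 1] gives
    [f (N + 1) = a N + a (N + 1)]. The alternating partial sum telescopes to [a 0] up to sign times
    [a K], and [a K] is controlled by [An K]. The uniform bound [A] feeds the residue, the decaying
    bound [An] the limit. *)
Lemma alternating_series_lint (f : C -> C) (An : nat -> R) (b : R) :
  (0 <= b < PI)%R ->
  (forall z, (1 / 2 <= Re z)%R -> Chol f z) ->
  (exists A, forall z, (1 / 2 <= Re z)%R -> (Cmod (f z)%C <= A * exp (b * Rabs (Im z)))%R) ->
  (forall N t, (Cmod (f (half_line (INR N) t))%C <= An N * exp (b * Rabs t))%R) ->
  is_lim_seq An 0%R ->
  Cis_series (fun n => RtoC ((-1) ^ n)%R * f (RtoC (INR (S n))))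
    (RtoC (1 / 2)%R * LInt (fun t => f (half_line 0 t) * sech_pi t)).
Proof.
  intros Hb Hf [A HA] HAn Hlim.
  set (H := fun N t => f (half_line (INR N) t) * sech_pi t).
  assert (Lf : forall N t, Ccont (fun u => f (half_line (INR N) u)) t).
  { intros N t. apply (Ccont_Chol f (half_line (INR N))); [|apply Ccont_half_line].
    apply Hf. simpl. pose proof (pos_INR N). lra. }
  assert (HD : forall N, exp_decay (H N) (2 * An N) (PI - b)).
  { intros N. apply (exp_decay_sech (fun t => f (half_line (INR N) t))); [lra|apply Lf|apply HAn]. }
  set (a := fun N => RtoC (1 / 2)%R * LInt (H N)).
  assert (Hrec : forall N, f (RtoC (INR (S N))) = a N + a (S N)).
  { intros N.
    assert (E : RtoC 2 * f (RtoC (INR (S N))) = LInt (H (S N)) + LInt (H N)).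
    { apply (Clim_unique (fun n => CInt (fun t => (f (half_line (INR (S N)) t)
        + f (half_line (INR (S N) - 1) t)) * sech_pi t) (- INR n) (INR n))).
      - apply (lint_residue f A b); auto. rewrite S_INR. pose proof (pos_INR N). lra.
      - apply (is_lint_ext (fun t => H (S N) t + H N t)).
        + intros t. unfold H. replace (INR (S N) - 1)%R with (INR N) by (rewrite S_INR; ring). ring.
        + apply is_lint_plus; [apply (HD (S N))|apply (HD N)| |].
          * apply (exp_decay_lint _ _ _ (HD (S N))).
          * apply (exp_decay_lint _ _ _ (HD N)). }
    unfold a. transitivity (RtoC (1 / 2)%R * (RtoC 2 * f (RtoC (INR (S N))))).
    - rewrite Cmult_assoc, <- RtoC_mult. replace (1 / 2 * 2)%R with 1%R by field. ring.
    - rewrite E. ring. }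
  apply Cis_series_csum.
  set (c := fun n => RtoC ((-1) ^ n)%R * f (RtoC (INR (S n)))).
  assert (ES : forall K, csum c K = a 0%nat - RtoC ((-1) ^ K)%R * a K).
  { induction K as [|K IH].
    - simpl. ring.
    - change (csum c K + c K = a 0%nat - RtoC ((-1) ^ S K)%R * a (S K)). rewrite IH.
      unfold c. rewrite Hrec.
      replace ((-1) ^ S K)%R with (- (-1) ^ K)%R by (simpl; ring). rewrite RtoC_opp. ring. }
  change (RtoC (1 / 2)%R * LInt (fun t => f (half_line 0 t) * sech_pi t)) with (a 0%nat).
  apply (Clim_squeeze _ _ (fun N => 2 / (PI - b) * An N)%R).
  - intros K. rewrite ES.
    replace (a 0%nat - RtoC ((-1) ^ K)%R * a K - a 0%nat) with (- (RtoC ((-1) ^ K)%R * a K)) by ring.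
    rewrite Cmod_opp, Cmod_mult, Cmod_R, pow_1_abs, Rmult_1_l.
    unfold a. rewrite Cmod_mult, Cmod_R, Rabs_pos_eq by lra.
    destruct (exp_decay_lint _ _ _ (HD K)) as [_ T].
    replace (2 / (PI - b) * An K)%R with (1 / 2 * (2 * (2 * An K) / (PI - b)))%R by (field; lra).
    lra.
  - replace (Finite 0) with (Finite (2 / (PI - b) * 0)%R) by (f_equal; ring).
    now apply (is_lim_seq_scal_l _ (2 / (PI - b))%R 0%R).
Qed.

(** * The integral representation of the alternating zeta function *)

(** From [1 + u <= exp u] at [u = ln (eps y)]. *)
Lemma ln_le_lin (eps y : R) : (0 < eps)%R -> (0 < y)%R -> (ln y <= eps * y + Rabs (ln eps))%R.
Proof.
  intros He Hy. pose proof (exp_ineq1_le (ln (eps * y))) as H.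
  rewrite exp_ln, ln_mult in H by (try apply Rmult_lt_0_compat; lra).
  pose proof (Rle_abs (- ln eps)) as T. rewrite Rabs_Ropp in T. lra.
Qed.

(** The logarithm is sublinear along the line, so [exp (k |log z|)], and with it any power of [z],
    costs only an arbitrarily small exponential rate. *)
Lemma Clog_growth (eps : R) : (0 < eps)%R ->
  exists B, forall t, (Cmod (Clog (half_line 0 t))%C <= eps * Rabs t + B)%R.
Proof.
  intros He. exists (eps / 2 + Rabs (ln eps) + Rabs (ln (1 / 4)) + PI / 2)%R. intros t.
  eapply Rle_trans; [apply Cmod_Re_Im|]. unfold Clog, half_line. simpl.
  replace (0 + 1 / 2)%R with (1 / 2)%R by ring.
  set (q := (1 / 2 * (1 / 2) + t * t)%R).
  assert (Hq : (1 / 4 <= q)%R) by (unfold q; nra).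
  assert (H1 : (Rabs (atan (t / (1 / 2))) <= PI / 2)%R).
  { pose proof (atan_bound (t / (1 / 2))). apply Rabs_le. lra. }
  assert (H2 : (ln (1 / 4) <= ln q)%R) by (apply ln_le; lra).
  assert (H3 : (ln q <= 2 * (eps * (1 / 2 + Rabs t) + Rabs (ln eps)))%R).
  { pose proof (Rabs_pos t).
    apply Rle_trans with (ln ((1 / 2 + Rabs t) * (1 / 2 + Rabs t))).
    - apply ln_le; [lra|]. unfold q. pose proof (Rsqr_abs t) as Q. unfold Rsqr in Q. nra.
    - rewrite ln_mult by lra. pose proof (ln_le_lin eps (1 / 2 + Rabs t) He ltac:(lra)). lra. }
  pose proof (Rle_abs (- ln (1 / 4))) as T. rewrite Rabs_Ropp in T.
  pose proof (Rabs_pos (ln eps)). pose proof (Rabs_pos t). pose proof (Rabs_pos (ln (1 / 4))).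
  assert (Hq2 : (Rabs (ln q / 2) <= eps / 2 + eps * Rabs t + Rabs (ln eps) + Rabs (ln (1 / 4)))%R).
  { apply Rabs_le. split; nra. }
  lra.
Qed.

Lemma Cmod_Cexp_le (z : C) : (Cmod (Cexp z)%C <= exp (Cmod z))%R.
Proof.
  rewrite Cmod_Cexp. apply exp_le_mono. eapply Rle_trans; [apply Rle_abs|apply re_le_Cmod].
Qed.

Lemma exp_Clog_growth (k b : R) : (0 <= k)%R -> (0 < b)%R ->
  exists A, (0 < A)%R /\
    forall t, (exp (k * Cmod (Clog (half_line 0 t))%C) <= A * exp (b * Rabs t))%R.
Proof.
  intros Hk Hb. destruct (Clog_growth (b / (k + 1))) as [B HB].
  { apply Rdiv_lt_0_compat; lra. }
  exists (exp (k * B)). split; [apply exp_pos|]. intros t. rewrite <- exp_plus.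
  apply exp_le_mono. specialize (HB t). pose proof (Rabs_pos t).
  apply (Rmult_le_compat_l k) in HB; [|assumption].
  assert (k * (b / (k + 1)) <= b)%R.
  { replace (k * (b / (k + 1)))%R with (b * (k / (k + 1)))%R by (field; lra).
    rewrite <- (Rmult_1_r b) at 2. apply Rmult_le_compat_l; [lra|]. apply Rle_div_l; lra. }
  nra.
Qed.

Definition Cnpow_line (s : C) (t : R) : C := Cnpow (half_line 0 t) s.

Lemma Re_half_line_0 (t : R) : (0 < Re (half_line 0 t)%C)%R.
Proof. simpl. lra. Qed.

Lemma Ccont_Clog_line (t : R) : Ccont (fun u => Clog (half_line 0 u)) t.
Proof.
  apply (Ccont_Chol Clog (half_line 0)); [|apply Ccont_half_line].
  eexists. apply Cderiv_Clog, Re_half_line_0.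
Qed.

Lemma Ccont_Cnpow_line (s : C) (t : R) : Ccont (Cnpow_line s) t.
Proof.
  apply (Ccont_Chol (fun z => Cnpow z s) (half_line 0)); [|apply Ccont_half_line].
  apply Chol_Cnpow, Re_half_line_0.
Qed.

Lemma Ccont_Ccos_line (x t : R) : Ccont (fun u => Ccos (RtoC x * half_line 0 u)) t.
Proof.
  apply (Ccont_Chol (fun z => Ccos (RtoC x * z)) (half_line 0)); [|apply Ccont_half_line].
  apply Chol_Ccos_lin.
Qed.

Lemma Cmod_Cnpow_line (s : C) (t : R) :
  (Cmod (Cnpow_line s t)%C <= exp (Cmod s * Cmod (Clog (half_line 0 t))%C))%R.
Proof.
  unfold Cnpow_line, Cnpow. eapply Rle_trans; [apply Cmod_Cexp_le|].
  rewrite Cmod_mult, Cmod_opp. apply Rle_refl.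
Qed.

Lemma Cmod_Ccos_lin (x : R) (z : C) : (0 <= x)%R ->
  (Cmod (Ccos (RtoC x * z))%C <= exp (x * Rabs (Im z)))%R.
Proof.
  intros Hx. eapply Rle_trans; [apply Cmod_Ccos_le|]. right. f_equal. simpl.
  rewrite Rmult_0_l, Rplus_0_r, Rabs_mult, (Rabs_pos_eq x) by assumption. reflexivity.
Qed.

Definition eta_kernel (x : R) (s : C) (t : R) : C :=
  Cnpow_line s t * Ccos (RtoC x * half_line 0 t) * sech_pi t.

(* For [0 <= x < PI] the entire continuation in [s] of
   [sum (-1)^(n-1) cos (n x) n^(-s)]; the integral is that of
   [z^(-s) cos (x z) / (2 i sin (pi z))] over the line [Re z = 1/2]. *)
Definition eta_cos (x : R) (s : C) : C := RtoC (1 / 2)%R * LInt (eta_kernel x s).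

(* [exp (k |log z|)] dominates any fixed power of [z] and is still integrable against
   [sech]; every estimate below has this shape. *)
Lemma weighted_exp_decay (k x : R) : (0 <= k)%R -> (0 <= x < PI)%R ->
  exists A delta, (0 < A)%R /\ forall (Phi : R -> C) (M : R),
    (0 <= M)%R -> (forall t, Ccont Phi t) ->
    (forall t, (Cmod (Phi t)%C <=
       M * (exp (k * Cmod (Clog (half_line 0 t))%C) * exp (x * Rabs t)))%R) ->
    exp_decay (fun t => Phi t * sech_pi t) (M * A) delta.
Proof.
  intros Hk Hx. destruct (exp_Clog_growth k ((PI - x) / 2) Hk ltac:(lra)) as [A [HA HB]].
  (* Half of the gap [PI - x] is given to the logarithmic weight; together with the rate [x] this
     makes [(PI + x) / 2], still below [PI]. *)
  exists (2 * A)%R, (PI - (PI + x) / 2)%R. split; [lra|].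
  intros F M HM Hc HF. replace (M * (2 * A))%R with (2 * (M * A))%R by ring.
  apply exp_decay_sech; [lra|exact Hc|]. intros t. eapply Rle_trans; [apply HF|].
  rewrite Rmult_assoc. apply Rmult_le_compat_l; [assumption|].
  replace ((PI + x) / 2 * Rabs t)%R with ((PI - x) / 2 * Rabs t + x * Rabs t)%R by field.
  rewrite exp_plus, <- Rmult_assoc. apply Rmult_le_compat_r; [left; apply exp_pos|apply HB].
Qed.

Lemma eta_kernel_exp_decay (x : R) (s : C) : (0 <= x < PI)%R ->
  exists M delta, exp_decay (eta_kernel x s) M delta.
Proof.
  intros Hx. destruct (weighted_exp_decay (Cmod s) x (Cmod_ge_0 s) Hx) as (A & d & HA & H).
  exists (1 * A)%R, d. apply H; [lra| |].
  - intros t. apply Ccont_mult; [apply Ccont_Cnpow_line|apply Ccont_Ccos_line].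
  - intros t. rewrite Rmult_1_l, Cmod_mult.
    apply Rmult_le_compat; try apply Cmod_ge_0; [apply Cmod_Cnpow_line|].
    apply (Cmod_Ccos_lin x (half_line 0 t)). lra.
Qed.

Lemma eta_kernel_lint (x : R) (s : C) : (0 <= x < PI)%R ->
  is_lint (eta_kernel x s) (RtoC 2 * eta_cos x s).
Proof.
  intros Hx. destruct (eta_kernel_exp_decay x s Hx) as (M & d & H).
  unfold eta_cos. rewrite Cmult_assoc, <- RtoC_mult.
  replace (2 * (1 / 2))%R with 1%R by field. rewrite Cmult_1_l.
  now apply (exp_decay_lint _ M d).
Qed.

Lemma Ccont_eta_kernel (x : R) (s : C) (t : R) : Ccont (eta_kernel x s) t.
Proof.
  apply Ccont_mult; [|apply Ccont_sech].
  apply Ccont_mult; [apply Ccont_Cnpow_line|apply Ccont_Ccos_line].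
Qed.

(** Differentiation under the integral sign: moving [s] by [h] multiplies the kernel by
    [exp (- h log z)], whose linear part gives the derivative [D] and whose remainder is at most
    [|h|^2 exp (|log z|)], integrable against the kernel. *)
Lemma eta_cos_entire (x : R) (s : C) : (0 <= x < PI)%R -> Chol (eta_cos x) s.
Proof.
  intros Hx.
  set (L := fun t => Clog (half_line 0 t)).
  (* The extra [1] pays for a factor [exp (|log z|)], which dominates both the factor [|log z|] of
     the derivative and the second order remainder. *)
  set (k := (Cmod s + 1)%R). pose proof (Cmod_ge_0 s) as Hs.
  destruct (weighted_exp_decay k x ltac:(unfold k; lra) Hx) as (A & d & HA & HW).
  set (W := fun t => Cnpow_line s t * Ccos (RtoC x * half_line 0 t)).
  assert (WC : forall t, Ccont W t).
  { intros t. apply Ccont_mult; [apply Ccont_Cnpow_line|apply Ccont_Ccos_line]. }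
  assert (WB : forall t c, (0 <= c)%R -> (Cmod (W t)%C * (c * exp (Cmod (L t)%C)) <=
    c * (exp (k * Cmod (L t)%C) * exp (x * Rabs t)))%R).
  { intros t c Hc. unfold W. rewrite Cmod_mult.
    pose proof (Cmod_Cnpow_line s t) as H1. pose proof (Cmod_Ccos_lin x (half_line 0 t) ltac:(lra)) as H2.
    simpl Im in H2. unfold k. rewrite Rmult_plus_distr_r, exp_plus, Rmult_1_l.
    pose proof (exp_pos (Cmod (L t)%C)).
    replace (c * (exp (Cmod s * Cmod (L t)%C) * exp (Cmod (L t)%C) * exp (x * Rabs t)))%R
      with (exp (Cmod s * Cmod (L t)%C) * exp (x * Rabs t) * (c * exp (Cmod (L t)%C)))%R by ring.
    apply Rmult_le_compat_r; [apply Rmult_le_pos; lra|].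
    apply Rmult_le_compat; try apply Cmod_ge_0; assumption. }
  set (D := fun t => (- L t * W t) * sech_pi t).
  assert (DC : forall t, Ccont (fun t => - L t * W t) t).
  { intros t. apply Ccont_mult; [|apply WC].
    apply (Ccont_ext (fun u => RtoC (-1) * L u)); [intros; ring|].
    apply Ccont_mult; [apply Ccont_const|apply Ccont_Clog_line]. }
  assert (DD : exp_decay D (1 * A) d).
  { apply (HW (fun t => - L t * W t)); [lra|exact DC|]. intros t.
    rewrite Cmod_mult, Cmod_opp, Rmult_comm.
    eapply Rle_trans; [|apply (WB t 1%R); lra].
    apply Rmult_le_compat_l; [apply Cmod_ge_0|]. rewrite Rmult_1_l.
    pose proof (exp_ineq1_le (Cmod (L t)%C)). lra. }
  destruct (exp_decay_lint _ _ _ DD) as [DL _].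
  exists (RtoC (1 / 2)%R * LInt D). intros eps He.
  assert (Hd : (0 < d)%R) by apply DD.
  set (K := (A / d)%R). assert (HK : (0 < K)%R) by (apply Rdiv_lt_0_compat; lra).
  exists (Rmin 1 (eps / K)). split.
  { apply Rmin_pos; [lra|]. apply Rdiv_lt_0_compat; lra. }
  intros h Hh.
  pose proof (Rlt_le_trans _ _ _ Hh (Rmin_l _ _)) as h1.
  pose proof (Rlt_le_trans _ _ _ Hh (Rmin_r _ _)) as h2.
  destruct (Req_dec (Cmod h) 0) as [Z|Z].
  { apply Cmod_eq_0 in Z. subst h. rewrite Cplus_0_r.
    replace (eta_cos x s - eta_cos x s - RtoC (1 / 2)%R * LInt D * 0) with (RtoC 0) by ring.
    rewrite Cmod_0, Rmult_0_r. apply Rle_refl. }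
  assert (Hp : (0 < Cmod h)%R) by (pose proof (Cmod_ge_0 h); lra).
  set (Phi := fun t => W t * (Cexp (- h * L t) - (1 + - h * L t))).
  set (E := fun t => Phi t * sech_pi t).
  assert (PC : forall t, Ccont Phi t).
  { intros t. apply Ccont_mult; [apply WC|].
    assert (Lc : Ccont (fun u => - h * L u) t).
    { apply Ccont_mult; [apply Ccont_const|apply Ccont_Clog_line]. }
    apply Ccont_minus.
    - apply (Ccont_Chol Cexp (fun u => - h * L u)); [|exact Lc]. eexists. apply Cderiv_Cexp.
    - apply Ccont_plus; [apply Ccont_const|exact Lc]. }
  assert (ED : exp_decay E (Cmod h * Cmod h * A) d).
  { apply HW; [nra|exact PC|]. intros t. unfold Phi. rewrite Cmod_mult.
    eapply Rle_trans; [|apply (WB t (Cmod h * Cmod h)%R); nra].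
    apply Rmult_le_compat_l; [apply Cmod_ge_0|].
    rewrite <- cexp_poly_2.
    (* The choice [r = Cmod h] extracts [|h|^2] and leaves an exponential independent of [h]. *)
    eapply Rle_trans; [apply (cexp_remainder 2 (Cmod h)); lra|].
    rewrite Cmod_mult, Cmod_opp.
    replace (Cmod h * Cmod (L t)%C / Cmod h)%R with (Cmod (L t)%C) by (field; lra).
    right. ring. }
  destruct (exp_decay_lint _ _ _ ED) as [EL EB].
  assert (Heq : RtoC 2 * eta_cos x (s + h) = RtoC 2 * eta_cos x s + h * LInt D + LInt E).
  { refine (Clim_unique _ _ _ (eta_kernel_lint x (s + h) Hx) _).
    apply (is_lint_ext (fun t => eta_kernel x s t + h * D t + E t)).
    - intros t. unfold E, Phi, D, W, eta_kernel, Cnpow_line, Cnpow. fold (L t).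
      replace (- (s + h) * L t) with (- s * L t + - h * L t) by ring.
      rewrite Cexp_plus. ring.
    - assert (HDC : forall t, Ccont (fun t => h * D t) t).
      { intros t. apply Ccont_mult; [apply Ccont_const|]. apply DD. }
      apply is_lint_plus; [|apply ED| |exact EL].
      + intros t. apply Ccont_plus; [apply Ccont_eta_kernel|apply HDC].
      + apply is_lint_plus; [intros t; apply Ccont_eta_kernel|exact HDC| |].
        * now apply eta_kernel_lint.
        * apply is_lint_scal; [apply DD|exact DL]. }
  replace (eta_cos x (s + h) - eta_cos x s - RtoC (1 / 2)%R * LInt D * h)
    with (RtoC (1 / 2)%R * LInt E).
  2: { transitivity (RtoC (1 / 2)%R * (RtoC 2 * eta_cos x (s + h) - RtoC 2 * eta_cos x s - h * LInt D)).
       - rewrite Heq. ring.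
       - replace (RtoC (1 / 2)%R * (RtoC 2 * eta_cos x (s + h) - RtoC 2 * eta_cos x s - h * LInt D))
           with ((RtoC (1 / 2)%R * RtoC 2) * (eta_cos x (s + h) - eta_cos x s)
                  - RtoC (1 / 2)%R * h * LInt D) by ring.
         rewrite <- RtoC_mult. replace (1 / 2 * 2)%R with 1%R by field. ring. }
  rewrite Cmod_mult, Cmod_R, Rabs_pos_eq by lra.
  apply Rle_trans with (K * Cmod h * Cmod h)%R.
  - eapply Rle_trans; [apply Rmult_le_compat_l; [lra|exact EB]|].
    right. unfold K. field. lra.
  - apply Rmult_le_compat_r; [lra|].
    replace eps with (K * (eps / K))%R by (field; lra). apply Rmult_le_compat_l; lra.
Qed.

(** The modulus is [exp (- Re s ln |z| + Im s arg z)], with [|z| >= u] and [|arg z| <= PI / 2] in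
    the right half-plane. *)
Lemma Cmod_Cnpow_le (z s : C) (u : R) : (0 < u <= Re z)%R -> (0 <= Re s)%R ->
  (Cmod (Cnpow z s)%C <= exp (Rabs (Im s) * (PI / 2)) * exp (- Re s * ln u))%R.
Proof.
  intros Hu Hs. unfold Cnpow. rewrite Cmod_Cexp, <- exp_plus. apply exp_le_mono.
  destruct z as [p q], s as [sg ta]. simpl in *.
  assert (H1 : (2 * ln u <= ln (p * p + q * q))%R).
  { replace (2 * ln u)%R with (ln (u * u)) by (rewrite ln_mult by lra; ring).
    apply ln_le; nra. }
  assert (H2 : (ta * atan (q / p) <= Rabs ta * (PI / 2))%R).
  { eapply Rle_trans; [apply Rle_abs|]. rewrite Rabs_mult.
    apply Rmult_le_compat_l; [apply Rabs_pos|].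
    pose proof (atan_bound (q / p)). apply Rabs_le. lra. }
  nra.
Qed.

Lemma power_lim_0 (sg : R) : (0 < sg)%R ->
  is_lim_seq (fun n => exp (- sg * ln (INR n + 1 / 2))) 0%R.
Proof.
  intros Hs.
  assert (L1 : is_lim_seq (fun n => INR n + 1 / 2)%R p_infty).
  { apply (is_lim_seq_le_p_loc INR); [|apply is_lim_seq_INR]. exists 0%nat. intros; lra. }
  assert (L2 : is_lim_seq (fun n => ln (INR n + 1 / 2)) p_infty).
  { apply (is_lim_comp_seq ln _ p_infty p_infty is_lim_ln_p); [|exact L1].
    exists 0%nat. discriminate. }
  assert (L3 : is_lim_seq (fun n => - sg * ln (INR n + 1 / 2))%R m_infty).
  { replace m_infty with (Rbar_mult (Finite (- sg)%R) p_infty).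
    - now apply is_lim_seq_scal_l.
    - unfold Rbar_mult; simpl. destruct (Rle_dec 0 (- sg)); [exfalso; lra|reflexivity]. }
  apply (is_lim_comp_seq exp _ m_infty 0%R is_lim_exp_m); [|exact L3].
  exists 0%nat. discriminate.
Qed.

(** Summation by residues for [z^(-s) cos (x z)]: on [Re z = N + 1/2] this is of order
    [(N + 1/2)^(- Re s) exp (x |t|)], which tends to zero in [N] as soon as [Re s > 0]. *)
Lemma eta_cos_series (x : R) (s : C) : (0 <= x < PI)%R -> (0 < Re s)%R ->
  Cis_series (fun n => RtoC ((-1) ^ n)%R *
    (pos_cpow (INR (S n)) (- s) * RtoC (cos (x * INR (S n))))) (eta_cos x s).
Proof.
  intros Hx Hs. set (f := fun z => Cnpow z s * Ccos (RtoC x * z)).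
  (* The free lower bound [u] is taken as [1/2] for the uniform bound and as [N + 1/2] for the
     decaying one. *)
  assert (HB : forall u z, (0 < u <= Re z)%R -> (Cmod (f z)%C <=
     exp (Rabs (Im s) * (PI / 2)) * exp (- Re s * ln u) * exp (x * Rabs (Im z)))%R).
  { intros u z Hu. unfold f. rewrite Cmod_mult.
    apply Rmult_le_compat; try apply Cmod_ge_0; [apply Cmod_Cnpow_le; lra|].
    apply Cmod_Ccos_lin. lra. }
  assert (H : Cis_series (fun n => RtoC ((-1) ^ n)%R * f (RtoC (INR (S n))))
    (RtoC (1 / 2)%R * LInt (fun t => f (half_line 0 t) * sech_pi t))).
  { apply (alternating_series_lint f
      (fun n => exp (Rabs (Im s) * (PI / 2)) * exp (- Re s * ln (INR n + 1 / 2)))%R x Hx).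
    - intros z Hz. apply Chol_mult; [apply Chol_Cnpow; lra|apply Chol_Ccos_lin].
    - eexists. intros z Hz. apply (HB (1 / 2)%R). lra.
    - intros N t. apply (HB (INR N + 1 / 2)%R (half_line (INR N) t)).
      simpl. pose proof (pos_INR N). lra.
    - replace (Finite 0) with (Finite (exp (Rabs (Im s) * (PI / 2)) * 0)%R) by (f_equal; ring).
      apply (is_lim_seq_scal_l _ (exp (Rabs (Im s) * (PI / 2))) 0%R). now apply power_lim_0. }
  apply Cis_series_csum. apply Cis_series_csum in H.
  apply (Clim_ext (csum (fun n => RtoC ((-1) ^ n)%R * f (RtoC (INR (S n)))))); [|exact H].
  intros n. induction n as [|n IH]; [reflexivity|].
  change (csum (fun n => RtoC ((-1) ^ n)%R * f (RtoC (INR (S n)))) n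
      + RtoC ((-1) ^ n)%R * f (RtoC (INR (S n)))
    = csum (fun n => RtoC ((-1) ^ n)%R *
        (pos_cpow (INR (S n)) (- s) * RtoC (cos (x * INR (S n))))) n
      + RtoC ((-1) ^ n)%R * (pos_cpow (INR (S n)) (- s) * RtoC (cos (x * INR (S n))))).
  rewrite IH. unfold f. rewrite Cnpow_RtoC by (apply lt_0_INR; lia).
  now rewrite <- RtoC_mult, Ccos_RtoC.
Qed.

(** With [2K + 2] terms the exponentials are cut after degree [2K + 1]; the odd powers cancel, which
    leaves the cosine series up to and including [w^(2K)]. *)
Definition ccos_poly (K : nat) (w : C) : C :=
  RtoC (1 / 2)%R * (cexp_poly (2 * K + 2) (Ci * w) + cexp_poly (2 * K + 2) (- (Ci * w))).

Lemma ccos_poly_0 (w : C) : ccos_poly 0 w = 1.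
Proof.
  unfold ccos_poly. change (2 * 0 + 2)%nat with 2%nat. rewrite !cexp_poly_2.
  apply injective_projections; simpl; field.
Qed.

Lemma Ci_pow_even (n : nat) : Ci ^ (2 * n) = RtoC ((-1) ^ n)%R.
Proof.
  rewrite Cpow_mult_r. replace (Ci ^ 2) with (RtoC (-1)).
  - now rewrite RtoC_pow.
  - apply injective_projections; simpl; ring.
Qed.

Lemma ccos_poly_S (K : nat) (w : C) :
  ccos_poly (S K) w = ccos_poly K w
    + RtoC ((-1) ^ S K / INR (fact (2 * S K)))%R * w ^ (2 * S K).
Proof.
  unfold ccos_poly. replace (2 * S K + 2)%nat with (S (S (2 * K + 2))) by lia.
  set (n := (2 * K + 2)%nat). replace (2 * S K)%nat with n by (unfold n; lia).
  simpl cexp_poly.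
  assert (P1 : (Ci * w) ^ n = RtoC ((-1) ^ S K)%R * w ^ n).
  { rewrite Cpow_mult_l. f_equal. rewrite <- Ci_pow_even. f_equal. unfold n. lia. }
  assert (P2 : (- (Ci * w)) ^ n = RtoC ((-1) ^ S K)%R * w ^ n).
  { replace (- (Ci * w)) with (Ci * (- w)) by ring.
    rewrite Cpow_mult_l. replace n with (2 * S K)%nat at 1 by (unfold n; lia).
    rewrite Ci_pow_even. f_equal.
    replace (- w) with (RtoC (-1) * w) by ring. rewrite Cpow_mult_l.
    replace n with (2 * S K)%nat at 1 by (unfold n; lia).
    rewrite <- RtoC_pow, pow_1_even. ring. }
  rewrite !P1, !P2.
  assert (Hh : RtoC (1 / 2)%R + RtoC (1 / 2)%R = 1).
  { rewrite <- RtoC_plus. f_equal. field. }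
  set (hf := RtoC (1 / 2)%R) in *. unfold Rdiv. rewrite (RtoC_mult ((-1) ^ S K)).
  set (u := RtoC (/ INR (fact n))). set (v := RtoC (/ INR (fact n + n * fact n))).
  transitivity (hf * (cexp_poly n (Ci * w) + cexp_poly n (- (Ci * w)))
    + (hf + hf) * (RtoC ((-1) ^ S K)%R * u * w ^ n)); [ring|]. rewrite Hh. ring.
Qed.

Lemma ccos_remainder (K : nat) (r : R) (w : C) : (0 < r <= 1)%R ->
  (Cmod (Ccos w - ccos_poly K w)%C <= r ^ (2 * K + 2) * exp (Cmod w / r))%R.
Proof.
  intros Hr. unfold Ccos, ccos_poly. set (n := (2 * K + 2)%nat).
  pose proof (cexp_remainder n r (Ci * w) Hr) as H1.
  pose proof (cexp_remainder n r (- (Ci * w)) Hr) as H2.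
  rewrite Cmod_opp, Cmod_mult, Cmod_Ci, Rmult_1_l in H2.
  rewrite Cmod_mult, Cmod_Ci, Rmult_1_l in H1.
  replace (RtoC (1 / 2)%R * (Cexp (Ci * w) + Cexp (- (Ci * w))) -
    RtoC (1 / 2)%R * (cexp_poly n (Ci * w) + cexp_poly n (- (Ci * w)))) with
    (RtoC (1 / 2)%R * ((Cexp (Ci * w) - cexp_poly n (Ci * w)) +
       (Cexp (- (Ci * w)) - cexp_poly n (- (Ci * w))))) by ring.
  rewrite Cmod_mult, Cmod_R, Rabs_pos_eq by lra.
  pose proof (Cmod_triangle (Cexp (Ci * w) - cexp_poly n (Ci * w))
    (Cexp (- (Ci * w)) - cexp_poly n (- (Ci * w)))). lra.
Qed.

Lemma Chol_cexp_poly_lin (n : nat) (k z : C) : Chol (fun w => cexp_poly n (k * w)) z.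
Proof.
  apply (Chol_comp (fun w => k * w) (cexp_poly n)).
  - apply Chol_mult; [apply Chol_const|apply Chol_id].
  - destruct n; [exact (Chol_const 0 _)|]. eexists. apply Cderiv_cexp_poly.
Qed.

Lemma Chol_ccos_poly_lin (K : nat) (k z : C) : Chol (fun w => ccos_poly K (k * w)) z.
Proof.
  apply Chol_mult; [apply Chol_const|]. apply Chol_plus.
  - apply (Chol_ext (fun w => cexp_poly (2 * K + 2) ((Ci * k) * w))); [intros; f_equal; ring|].
    apply Chol_cexp_poly_lin.
  - apply (Chol_ext (fun w => cexp_poly (2 * K + 2) ((- Ci * k) * w))); [intros; f_equal; ring|].
    apply Chol_cexp_poly_lin.
Qed.

Lemma Ccos_0_lin (z : C) : Ccos (RtoC 0 * z) = 1.
Proof. rewrite Cmult_0_l, Ccos_RtoC, cos_0. reflexivity. Qed.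

(* Expand the cosine under the integral sign; since [x < PI], some [y] with [x < y < PI]
   makes the remainders geometrically small, of ratio [x / y]. *)
Lemma eta_cos_expansion (x : R) (s : C) : (0 < x < PI)%R ->
  is_eta_expansion (eta_cos 0) x s (eta_cos 0 s - eta_cos x s).
Proof.
  intros Hx. set (y := ((x + PI) / 2)%R). set (r := (x / y)%R).
  assert (Hr : (0 < r < 1)%R).
  { unfold r. split; [apply Rdiv_lt_0_compat; unfold y; lra|].
    apply Rlt_div_l; unfold y; lra. }
  set (Z := half_line 0).
  set (Phi := fun K t => Cnpow_line s t * ccos_poly K (RtoC x * Z t)).
  set (F := fun K t => Phi K t * sech_pi t).
  assert (PC : forall K t, Ccont (Phi K) t).
  { intros K t. apply Ccont_mult; [apply Ccont_Cnpow_line|].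
    apply (Ccont_Chol (fun z => ccos_poly K (RtoC x * z)) Z); [|apply Ccont_half_line].
    apply Chol_ccos_poly_lin. }
  assert (FC : forall K t, Ccont (F K) t).
  { intros K t. apply Ccont_mult; [apply PC|apply Ccont_sech]. }
  set (c := fun j => eta_term (eta_cos 0) x s (S j)).
  (* The sum is subtracted because [eta_term] carries the sign [(-1)^(k-1)], opposite to the cosine
     series; the term [k = 0] is [eta_cos 0 s] itself. *)
  assert (FL : forall K, is_lint (F K) (RtoC 2 * (eta_cos 0 s - csum c K))).
  { induction K as [|K IH].
    - simpl csum. replace (eta_cos 0 s - 0) with (eta_cos 0 s) by ring.
      apply (is_lint_ext (eta_kernel 0 s)).
      + intros t. unfold F, Phi, eta_kernel. now rewrite Ccos_0_lin, ccos_poly_0.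
      + apply eta_kernel_lint. pose proof PI_RGT_0. lra.
    - set (a := RtoC ((-1) ^ S K / INR (fact (2 * S K)) * x ^ (2 * S K))%R).
      set (s' := s - RtoC (INR (2 * S K))).
      apply (is_lint_ext (fun t => F K t + a * eta_kernel 0 s' t)).
      + intros t. unfold F, Phi, eta_kernel. rewrite Ccos_0_lin, ccos_poly_S.
        unfold s', Cnpow_line. rewrite Cnpow_minus_INR by apply Re_half_line_0.
        fold (Z t). rewrite Cpow_mult_l. unfold a.
        rewrite (RtoC_mult _ (x ^ (2 * S K))), RtoC_pow. ring.
      + replace (RtoC 2 * (eta_cos 0 s - csum c (S K))) with
          (RtoC 2 * (eta_cos 0 s - csum c K) + a * (RtoC 2 * eta_cos 0 s')).
        * apply is_lint_plus; [apply FC| |exact IH|].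
          -- intros t. apply Ccont_mult; [apply Ccont_const|apply Ccont_eta_kernel].
          -- apply is_lint_scal; [intros t; apply Ccont_eta_kernel|].
             apply eta_kernel_lint. pose proof PI_RGT_0. lra.
        * change (csum c (S K)) with (csum c K + eta_term (eta_cos 0) x s (S K)).
          unfold eta_term. fold s'. replace (S K - 1)%nat with K by lia. unfold a.
          replace ((-1) ^ S K / INR (fact (2 * S K)) * x ^ (2 * S K))%R
            with (- ((-1) ^ K / INR (fact (2 * S K)) * x ^ (2 * S K)))%R.
          -- rewrite RtoC_opp. ring.
          -- change ((-1) ^ S K)%R with (-1 * (-1) ^ K)%R. unfold Rdiv. ring. }
  destruct (weighted_exp_decay (Cmod s) y (Cmod_ge_0 s) ltac:(unfold y; lra))
    as (A & d & HA & HW).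
  (* On the line [Cmod z <= 1/2 + |t|]; the real part [1/2] accounts for this constant. *)
  set (B := exp (y / 2)).
  assert (HB : (0 < B)%R) by apply exp_pos.
  assert (Hbound : forall K, (Cmod (csum c K - (eta_cos 0 s - eta_cos x s))%C
      <= (B * A / d * (r * r)) * (r * r) ^ K)%R).
  { intros K.
    set (Psi := fun t => Cnpow_line s t * (Ccos (RtoC x * Z t) - ccos_poly K (RtoC x * Z t))).
    set (M := (r ^ (2 * K + 2) * B)%R).
    assert (HM : (0 <= M)%R) by (apply Rmult_le_pos; [apply pow_le|]; lra).
    assert (ED : exp_decay (fun t => Psi t * sech_pi t) (M * A) d).
    { apply HW; [exact HM| |].
      - intros t. apply Ccont_mult; [apply Ccont_Cnpow_line|].
        apply Ccont_minus; [apply Ccont_Ccos_line|].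
        apply (Ccont_Chol (fun z => ccos_poly K (RtoC x * z)) Z); [|apply Ccont_half_line].
        apply Chol_ccos_poly_lin.
      - intros t. unfold Psi. rewrite Cmod_mult.
        replace (M * (exp (Cmod s * Cmod (Clog (half_line 0 t))%C) * exp (y * Rabs t)))%R
          with (exp (Cmod s * Cmod (Clog (half_line 0 t))%C) * (r ^ (2 * K + 2) * exp (y / 2 + y * Rabs t)))%R
          by (unfold M, B; rewrite exp_plus; ring).
        apply Rmult_le_compat; try apply Cmod_ge_0; [apply Cmod_Cnpow_line|].
        eapply Rle_trans; [apply (ccos_remainder K r); lra|].
        apply Rmult_le_compat_l; [apply pow_le; lra|]. apply exp_le_mono.
        rewrite Cmod_mult, Cmod_R, Rabs_pos_eq by lra.
        assert (HZ : (Cmod (Z t)%C <= 1 / 2 + Rabs t)%R).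
        { eapply Rle_trans; [apply Cmod_Re_Im|]. simpl. rewrite Rplus_0_l, Rabs_pos_eq; lra. }
        (* The ratio [r = x / y] replaces the rate [x] by [y], which is still below [PI]. *)
        unfold r. replace (x * Cmod (Z t)%C / (x / y))%R with (y * Cmod (Z t)%C)%R
          by (field; unfold y; lra).
        assert (0 < y)%R by (unfold y; lra). nra. }
    destruct (exp_decay_lint _ _ _ ED) as [EL EB].
    assert (Heq : RtoC 2 * eta_cos x s = RtoC 2 * (eta_cos 0 s - csum c K)
      + LInt (fun t => Psi t * sech_pi t)).
    { refine (Clim_unique _ _ _ (eta_kernel_lint x s ltac:(lra)) _).
      apply (is_lint_ext (fun t => F K t + Psi t * sech_pi t)).
      - intros t. unfold F, Phi, Psi, eta_kernel. fold (Z t). ring.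
      - apply is_lint_plus; [apply FC|apply ED|apply FL|exact EL]. }
    assert (Heq2 : csum c K - (eta_cos 0 s - eta_cos x s) =
      RtoC (1 / 2)%R * LInt (fun t => Psi t * sech_pi t)).
    { transitivity (RtoC (1 / 2)%R * (RtoC 2 * eta_cos x s - RtoC 2 * (eta_cos 0 s - csum c K))).
      - replace (RtoC (1 / 2)%R * (RtoC 2 * eta_cos x s - RtoC 2 * (eta_cos 0 s - csum c K)))
          with ((RtoC (1 / 2)%R * RtoC 2) * (eta_cos x s - (eta_cos 0 s - csum c K))) by ring.
        rewrite <- RtoC_mult. replace (1 / 2 * 2)%R with 1%R by field. ring.
      - rewrite Heq. ring. }
    rewrite Heq2, Cmod_mult, Cmod_R, Rabs_pos_eq by lra.
    assert (Hd : (0 < d)%R) by apply ED.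
    eapply Rle_trans; [apply Rmult_le_compat_l; [lra|exact EB]|].
    right. unfold M.
    replace (r ^ (2 * K + 2))%R with ((r * r) ^ K * (r * r))%R; [field; lra|].
    rewrite pow_add, pow_mult. replace (r ^ 2)%R with (r * r)%R by ring. reflexivity. }
  apply Cis_series_csum. fold c.
  apply (Clim_squeeze _ _ _ Hbound).
  replace (Finite 0) with (Finite (B * A / d * (r * r) * 0)%R) by (f_equal; ring).
  apply (is_lim_seq_scal_l _ (B * A / d * (r * r))%R 0%R).
  apply is_lim_seq_geom. rewrite Rabs_pos_eq by nra. nra.
Qed.

(** * Dirichlet series with periodic coefficients *)

Lemma csum_ext (a b : nat -> C) (n : nat) : (forall k, a k = b k) -> csum a n = csum b n.
Proof. intros E. induction n as [|n IH]; [reflexivity|]. simpl. now rewrite IH, E. Qed.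

Lemma Cis_series_ext (a b : nat -> C) (l : C) :
  (forall n, a n = b n) -> Cis_series a l -> Cis_series b l.
Proof.
  intros E H. apply Cis_series_csum. apply Cis_series_csum in H.
  apply (Clim_ext (csum a)); [|exact H]. intros n. now apply csum_ext.
Qed.

Lemma Cis_series_lin (a b : nat -> C) (l k p q : C) :
  Cis_series a l -> Cis_series b k ->
  Cis_series (fun n => p * a n + q * b n) (p * l + q * k).
Proof.
  intros Ha Hb. apply Cis_series_csum. apply Cis_series_csum in Ha, Hb.
  apply (Clim_ext (fun n => p * csum a n + q * csum b n)).
  - intros n. induction n as [|n IH]; [simpl; ring|].
    change (p * (csum a n + a n) + q * (csum b n + b n) =
      csum (fun n => p * a n + q * b n) n + (p * a n + q * b n)).
    rewrite <- IH. ring.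
  - apply Clim_plus; now apply Clim_scal.
Qed.

Lemma Cis_series_unique (a : nat -> C) (l k : C) :
  Cis_series a l -> Cis_series a k -> l = k.
Proof.
  intros H1 H2. apply Cis_series_csum in H1, H2. exact (Clim_unique _ _ _ H1 H2).
Qed.

Definition dirichlet_term (chi : nat -> R) (s : C) (n : nat) : C :=
  RtoC (chi n) * pos_cpow (INR (S n)) (- s).

(* Index [n] stands for the integer [n + 1]. *)
Definition dilate (p : nat) (chi : nat -> R) (n : nat) : R :=
  if (S n mod p =? 0)%nat then chi (S n / p - 1)%nat else 0%R.

Lemma pos_cpow_mult (a b : R) (s : C) : (0 < a)%R -> (0 < b)%R ->
  pos_cpow (a * b) s = pos_cpow a s * pos_cpow b s.
Proof.
  intros Ha Hb. unfold pos_cpow. rewrite ln_mult, RtoC_plus, <- Cexp_plus by assumption.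
  f_equal. ring.
Qed.

Lemma pos_cpow_plus (a : R) (s t : C) : pos_cpow a (s + t) = pos_cpow a s * pos_cpow a t.
Proof. unfold pos_cpow. rewrite <- Cexp_plus. f_equal. ring. Qed.

Lemma pos_cpow_1 (a : R) : (0 < a)%R -> pos_cpow a 1 = RtoC a.
Proof.
  intros Ha. unfold pos_cpow. rewrite Cmult_1_l. unfold Cexp; simpl.
  rewrite exp_ln, cos_0, sin_0 by assumption. apply injective_projections; simpl; ring.
Qed.

Lemma div_succ (p n : nat) : (0 < p)%nat ->
  ((S n mod p = 0 /\ S n / p = S (n / p)) \/ (S n mod p <> 0 /\ S n / p = n / p))%nat.
Proof.
  intros Hp. pose proof (Nat.div_mod (S n) p ltac:(lia)) as E.
  pose proof (Nat.mod_upper_bound (S n) p ltac:(lia)) as U.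
  set (q := (S n / p)%nat) in *. set (r := (S n mod p)%nat) in *.
  destruct r as [|r].
  - left. split; [reflexivity|]. destruct q as [|q]; [lia|]. f_equal.
    apply (Nat.div_unique n p q (p - 1)); nia.
  - right. split; [lia|]. apply (Nat.div_unique n p q r); lia.
Qed.

(** The first [n] terms of the dilated series are [p^(-s)] times the first [n / p] terms of the
    original one. Comparing partial sums in this way needs only conditional convergence. *)
Lemma dirichlet_dilate (p : nat) (chi : nat -> R) (s l : C) : (0 < p)%nat ->
  Cis_series (dirichlet_term chi s) l ->
  Cis_series (dirichlet_term (dilate p chi) s) (pos_cpow (INR p) (- s) * l).
Proof.
  intros Hp H. apply Cis_series_csum. apply Cis_series_csum in H.
  set (c := pos_cpow (INR p) (- s)).
  apply (Clim_ext (fun n => c * csum (dirichlet_term chi s) (n / p))).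
  - intros n. induction n as [|n IH].
    + rewrite Nat.Div0.div_0_l. simpl. ring.
    + change (csum (dirichlet_term (dilate p chi) s) (S n)) with
        (csum (dirichlet_term (dilate p chi) s) n + dirichlet_term (dilate p chi) s n).
      rewrite <- IH. unfold dirichlet_term at 3, dilate.
      destruct (div_succ p n Hp) as [[E1 E2]|[E1 E2]]; rewrite E2.
      * rewrite E1, Nat.eqb_refl.
        change (csum (dirichlet_term chi s) (S (n / p))) with
          (csum (dirichlet_term chi s) (n / p) + dirichlet_term chi s (n / p)).
        replace (S (n / p) - 1)%nat with (n / p)%nat by lia. unfold dirichlet_term at 2.
        assert (EM : S n = (p * S (n / p))%nat).
        { rewrite <- E2. pose proof (Nat.div_mod (S n) p ltac:(lia)). lia. }
        rewrite EM, mult_INR, pos_cpow_mult by (apply lt_0_INR; lia).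
        fold c. replace (p * S (n / p) / p)%nat with (S (n / p)) by (rewrite <- EM; lia).
        ring.
      * apply Nat.eqb_neq in E1. rewrite E1. ring.
  - apply Clim_scal. unfold Clim.
    apply (is_lim_seq_subseq (fun n => Cmod (csum (dirichlet_term chi s) n - l)%C) 0%R (fun n => n / p)%nat);
      [|exact H].
    intros P [N HN]. exists (p * N)%nat. intros n Hn. apply HN.
    apply Nat.div_le_lower_bound; lia.
Qed.

Lemma dirichlet_lin (chi psi phi : nat -> R) (p q : R) (s l k : C) :
  (forall n, phi n = (p * chi n + q * psi n)%R) ->
  Cis_series (dirichlet_term chi s) l -> Cis_series (dirichlet_term psi s) k ->
  Cis_series (dirichlet_term phi s) (RtoC p * l + RtoC q * k).
Proof.
  intros E H1 H2.
  apply (Cis_series_ext (fun n => RtoC p * dirichlet_term chi s n + RtoC q * dirichlet_term psi s n)).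
  - intros n. unfold dirichlet_term. rewrite E, RtoC_plus, !RtoC_mult. ring.
  - now apply Cis_series_lin.
Qed.

Definition alt_sign (n : nat) : R := ((-1) ^ n)%R.

Lemma alt_sign_S (n : nat) : alt_sign (S n) = (- alt_sign n)%R.
Proof. unfold alt_sign. simpl. ring. Qed.

Lemma alt_sign_1 : alt_sign 1 = (- 1)%R.
Proof. unfold alt_sign. simpl. ring. Qed.

Lemma alt_sign_plus (m n : nat) : alt_sign (m + n) = (alt_sign m * alt_sign n)%R.
Proof. apply pow_add. Qed.

Lemma alt_sign_even (n : nat) : alt_sign (2 * n) = 1%R.
Proof. apply pow_1_even. Qed.

Lemma cos_sin_PI_INR (n : nat) : cos (PI * INR n) = alt_sign n /\ sin (PI * INR n) = 0%R.
Proof.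
  induction n as [|n [IH1 IH2]].
  - simpl INR. rewrite Rmult_0_r, cos_0, sin_0. split; reflexivity.
  - rewrite S_INR, alt_sign_S, Rmult_plus_distr_l, Rmult_1_r, neg_cos, neg_sin, IH1, IH2.
    split; ring.
Qed.

Lemma cos_2PI3_INR (k : nat) :
  cos (2 * PI / 3 * INR k) = if (k mod 3 =? 0)%nat then 1%R else (- (1 / 2))%R.
Proof.
  pose proof (Nat.div_mod k 3 ltac:(lia)) as E.
  pose proof (Nat.mod_upper_bound k 3 ltac:(lia)) as U.
  set (q := (k / 3)%nat) in *. set (r := (k mod 3)%nat) in *.
  rewrite E, plus_INR, mult_INR.
  replace (2 * PI / 3 * (INR 3 * INR q + INR r))%R
    with (2 * PI / 3 * INR r + 2 * INR q * PI)%R by (simpl; field).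
  rewrite cos_period. destruct r as [|[|[|r]]]; simpl Nat.eqb; [..|lia].
  - simpl INR. rewrite Rmult_0_r. apply cos_0.
  - simpl INR. replace (2 * PI / 3 * 1)%R with (2 * (PI / 3))%R by field.
    rewrite cos_2PI3. field.
  - simpl INR. replace (2 * PI / 3 * (1 + 1))%R with (PI / 3 + PI)%R by field.
    rewrite neg_cos, cos_PI3. reflexivity.
Qed.

(** The cosine is [-1/2], plus [3/2] at multiples of [3]. In shifted indices the hypothesis says
    that the coefficients at [3 (m + 1)] and [m + 1] agree, so the restriction to multiples of [3]
    is a dilation. *)
Lemma dilate_3_cos (chi : nat -> R) (n : nat) :
  (forall m, chi (3 * m + 2)%nat = chi m) ->
  (chi n * cos (2 * PI / 3 * INR (S n)) = - (1 / 2) * chi n + 3 / 2 * dilate 3 chi n)%R.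
Proof.
  intros H. rewrite cos_2PI3_INR. unfold dilate.
  destruct (Nat.eqb_spec (S n mod 3) 0) as [E|E]; [|ring].
  pose proof (Nat.div_mod (S n) 3 ltac:(lia)) as D. rewrite E in D.
  set (m := (S n / 3 - 1)%nat).
  replace (chi n) with (chi m); [field|].
  rewrite <- H. f_equal. unfold m. lia.
Qed.

Lemma dilate_3_cos_alt (n : nat) :
  (alt_sign n * cos (2 * PI / 3 * INR (S n)) =
    - (1 / 2) * alt_sign n + 3 / 2 * dilate 3 alt_sign n)%R.
Proof.
  apply dilate_3_cos. intros m.
  replace (3 * m + 2)%nat with (m + 2 * (m + 1))%nat by lia.
  rewrite alt_sign_plus, alt_sign_even. ring.
Qed.

(** For [k = n + 1], [cos (k PI / 3) = (-1)^k cos (2 k PI / 3)]: the alternating sign cancels and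
    the constant coefficients of [zeta] remain. This is why the third identity involves [zeta]. *)
Lemma dilate_3_cos_PI3 (n : nat) :
  (alt_sign n * cos (PI / 3 * INR (S n)) =
    1 / 2 * 1 + - (3 / 2) * dilate 3 (fun _ => 1) n)%R.
Proof.
  pose proof (dilate_3_cos (fun _ => 1%R) n (fun _ => eq_refl)) as H.
  replace (2 * PI / 3 * INR (S n))%R with (PI * INR (S n) - PI / 3 * INR (S n))%R in H by field.
  destruct (cos_sin_PI_INR (S n)) as [Hc Hs].
  rewrite cos_minus, Hc, Hs, alt_sign_S in H. lra.
Qed.

(** For [k = n + 1] odd the cosine vanishes; for [k = 2q] it is [(-1)^q], and the alternating sign
    at an even integer is [-1]. *)
Lemma dilate_2_cos (n : nat) :
  (alt_sign n * cos (PI / 2 * INR (S n)) = dilate 2 alt_sign n)%R.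
Proof.
  unfold dilate. pose proof (Nat.div_mod (S n) 2 ltac:(lia)) as D.
  pose proof (Nat.mod_upper_bound (S n) 2 ltac:(lia)) as U.
  set (q := (S n / 2)%nat) in *.
  destruct (Nat.eqb_spec (S n mod 2) 0) as [E|E].
  - rewrite D, E, Nat.add_0_r, mult_INR.
    replace (PI / 2 * (INR 2 * INR q))%R with (PI * INR q)%R by (simpl; field).
    destruct (cos_sin_PI_INR q) as [-> _].
    replace n with (2 * (q - 1) + 1)%nat by lia. rewrite alt_sign_plus, alt_sign_even, alt_sign_1.
    replace q with (S (q - 1)) at 1 by lia. rewrite alt_sign_S. ring.
  - assert (E1 : (S n mod 2 = 1)%nat) by lia.
    rewrite D, E1, plus_INR, mult_INR.
    replace (PI / 2 * (INR 2 * INR q + INR 1))%R with (PI * INR q + PI / 2)%R by (simpl; field).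
    destruct (cos_sin_PI_INR q) as [_ Hs].
    rewrite cos_plus, cos_PI2, Hs. ring.
Qed.

(** Changing the sign at even integers subtracts their terms twice; this is the factor [1 - 2^(1-s)]
    between [eta] and [zeta]. *)
Lemma dilate_2_alt (n : nat) :
  (alt_sign n = 1 * 1 + - 2 * dilate 2 (fun _ => 1) n)%R.
Proof.
  unfold dilate. pose proof (Nat.div_mod (S n) 2 ltac:(lia)) as D.
  pose proof (Nat.mod_upper_bound (S n) 2 ltac:(lia)) as U.
  set (q := (S n / 2)%nat) in *.
  destruct (Nat.eqb_spec (S n mod 2) 0) as [E|E].
  - replace n with (2 * (q - 1) + 1)%nat by lia. rewrite alt_sign_plus, alt_sign_even.
    rewrite alt_sign_1. ring.
  - replace n with (2 * q)%nat by lia. rewrite alt_sign_even. ring.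
Qed.

(** * Closed forms of the cosine integrals by analytic continuation *)

Lemma eta_cos_dirichlet (x : R) (s : C) : (0 <= x < PI)%R -> (0 < Re s)%R ->
  Cis_series (dirichlet_term (fun n => (alt_sign n * cos (x * INR (S n)))%R) s) (eta_cos x s).
Proof.
  intros Hx Hs. apply (Cis_series_ext (fun n => RtoC ((-1) ^ n)%R *
    (pos_cpow (INR (S n)) (- s) * RtoC (cos (x * INR (S n)))))).
  - intros n. unfold dirichlet_term. rewrite RtoC_mult. unfold alt_sign. ring.
  - now apply eta_cos_series.
Qed.

Lemma dirichlet_ext (chi psi : nat -> R) (s l : C) : (forall n, chi n = psi n) ->
  Cis_series (dirichlet_term chi s) l -> Cis_series (dirichlet_term psi s) l.
Proof. intros E. apply Cis_series_ext. intros n. unfold dirichlet_term. now rewrite E. Qed.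

(** The exceptional point [1] of [identity_half_plane] lies in [Re z > 0], where equality is
    given. *)
Lemma entire_eq (f g : C -> C) :
  (forall z, Chol f z) -> (forall z, Chol g z) ->
  (forall z, (0 < Re z)%R -> f z = g z) -> forall z, f z = g z.
Proof.
  intros Hf Hg H z. destruct (Rlt_dec 0 (Re z)) as [L|L]; [now apply H|].
  apply Ceq_minus.
  apply (identity_half_plane (fun w => f w - g w)).
  - intros w _. now apply Chol_minus.
  - intros w Hw. rewrite H by lra. ring.
  - intros ->. apply L. simpl. lra.
Qed.

Lemma Chol_pos_cpow_opp (a : R) (z : C) : Chol (fun w => pos_cpow a (- w)) z.
Proof.
  apply (Chol_ext (fun w => Cexp ((- RtoC (ln a)) * w))).
  - intros w. unfold pos_cpow. f_equal. ring.
  - apply Chol_Cexp_lin.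
Qed.

Lemma INR_2_IZR : INR 2 = 2%R. Proof. simpl. ring. Qed.
Lemma INR_3_IZR : INR 3 = 3%R. Proof. simpl. ring. Qed.

Lemma is_eta_expansion_ext (f g : C -> C) (x : R) (s l : C) : (forall z, f z = g z) ->
  is_eta_expansion f x s l -> is_eta_expansion g x s l.
Proof.
  intros E. apply Cis_series_ext. intros n. unfold eta_term. now rewrite E.
Qed.

Lemma alternating_zeta_dirichlet (eta : C -> C) (s : C) : is_alternating_zeta eta ->
  (0 < Re s)%R -> Cis_series (dirichlet_term alt_sign s) (eta s).
Proof. intros [_ H] Hs. exact (H s Hs). Qed.

Lemma riemann_zeta_dirichlet (zeta : C -> C) (s : C) : is_riemann_zeta zeta ->
  (1 < Re s)%R -> Cis_series (dirichlet_term (fun _ => 1%R) s) (zeta s).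
Proof.
  intros [_ H] Hs.
  apply (Cis_series_ext (fun n => pos_cpow (INR (S n)) (- s))); [|now apply H].
  intros n. unfold dirichlet_term. ring.
Qed.

Lemma alternating_zeta_eta_cos (eta : C -> C) : is_alternating_zeta eta ->
  forall s, eta_cos 0 s = eta s.
Proof.
  intros He. pose proof PI_RGT_0. apply entire_eq.
  - intros z. apply eta_cos_entire. lra.
  - intros z. apply holomorphic_at_Chol, He.
  - intros z Hz. apply (Cis_series_unique (dirichlet_term alt_sign z)).
    + apply (dirichlet_ext (fun n => (alt_sign n * cos (0 * INR (S n)))%R)).
      * intros n. rewrite Rmult_0_l, cos_0. ring.
      * apply eta_cos_dirichlet; lra.
    + now apply alternating_zeta_dirichlet.
Qed.

Lemma eta_cos_2PI3 (eta : C -> C) : is_alternating_zeta eta -> forall s,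
  eta_cos (2 * PI / 3) s =
    RtoC (- (1 / 2))%R * eta s + RtoC (3 / 2)%R * (pos_cpow 3 (- s) * eta s).
Proof.
  intros He. pose proof PI_RGT_0. apply entire_eq.
  - intros z. apply eta_cos_entire. lra.
  - intros z. assert (Hez : Chol eta z) by apply holomorphic_at_Chol, He.
    apply Chol_plus; (apply Chol_mult; [apply Chol_const|]); [exact Hez|].
    apply Chol_mult; [apply Chol_pos_cpow_opp|exact Hez].
  - intros z Hz. pose proof (alternating_zeta_dirichlet eta z He Hz) as Hser.
    eapply Cis_series_unique; [apply eta_cos_dirichlet; lra|].
    apply (dirichlet_lin _ _ _ _ _ _ _ _ dilate_3_cos_alt Hser).
    rewrite <- INR_3_IZR. apply dirichlet_dilate; [lia|exact Hser].
Qed.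

Lemma eta_cos_PI2 (eta : C -> C) : is_alternating_zeta eta -> forall s,
  eta_cos (PI / 2) s = pos_cpow 2 (- s) * eta s.
Proof.
  intros He. pose proof PI_RGT_0. apply entire_eq.
  - intros z. apply eta_cos_entire. lra.
  - intros z. apply Chol_mult; [apply Chol_pos_cpow_opp|]. apply holomorphic_at_Chol, He.
  - intros z Hz. pose proof (alternating_zeta_dirichlet eta z He Hz) as Hser.
    eapply Cis_series_unique; [apply eta_cos_dirichlet; lra|].
    apply (dirichlet_ext (dilate 2 alt_sign)).
    + intros n. symmetry. apply dilate_2_cos.
    + rewrite <- INR_2_IZR. apply dirichlet_dilate; [lia|exact Hser].
Qed.

Lemma eq_off_1 (f g : C -> C) :
  (forall z : C, z <> RtoC 1 -> Chol f z) -> (forall z : C, z <> RtoC 1 -> Chol g z) ->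
  (forall z, (1 < Re z)%R -> f z = g z) -> forall z : C, z <> RtoC 1 -> f z = g z.
Proof.
  intros Hf Hg H z Hz. apply Ceq_minus.
  apply (identity_half_plane (fun w => f w - g w)); [| |exact Hz].
  - intros w Hw. apply Chol_minus; auto.
  - intros w Hw. rewrite H by assumption. ring.
Qed.

Lemma eta_cos_0_zeta (zeta : C -> C) : is_riemann_zeta zeta -> forall s : C, s <> RtoC 1 ->
  eta_cos 0 s = RtoC 1 * zeta s + RtoC (- 2)%R * (pos_cpow 2 (- s) * zeta s).
Proof.
  intros Hz. pose proof PI_RGT_0. apply eq_off_1.
  - intros z _. apply eta_cos_entire. lra.
  - intros z Hn. assert (Hzz : Chol zeta z) by now apply holomorphic_at_Chol, Hz.
    apply Chol_plus; (apply Chol_mult; [apply Chol_const|]); [exact Hzz|].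
    apply Chol_mult; [apply Chol_pos_cpow_opp|exact Hzz].
  - intros z Hr. pose proof (riemann_zeta_dirichlet zeta z Hz Hr) as Hser.
    apply (Cis_series_unique (dirichlet_term alt_sign z)).
    + apply (dirichlet_ext (fun n => (alt_sign n * cos (0 * INR (S n)))%R)).
      * intros n. rewrite Rmult_0_l, cos_0. ring.
      * apply eta_cos_dirichlet; lra.
    + apply (dirichlet_lin _ _ _ _ _ _ _ _ dilate_2_alt Hser).
      rewrite <- INR_2_IZR. apply dirichlet_dilate; [lia|exact Hser].
Qed.

Lemma eta_cos_PI3_zeta (zeta : C -> C) : is_riemann_zeta zeta -> forall s : C, s <> RtoC 1 ->
  eta_cos (PI / 3) s =
    RtoC (1 / 2)%R * zeta s + RtoC (- (3 / 2))%R * (pos_cpow 3 (- s) * zeta s).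
Proof.
  intros Hz. pose proof PI_RGT_0. apply eq_off_1.
  - intros z _. apply eta_cos_entire. lra.
  - intros z Hn. assert (Hzz : Chol zeta z) by now apply holomorphic_at_Chol, Hz.
    apply Chol_plus; (apply Chol_mult; [apply Chol_const|]); [exact Hzz|].
    apply Chol_mult; [apply Chol_pos_cpow_opp|exact Hzz].
  - intros z Hr. pose proof (riemann_zeta_dirichlet zeta z Hz Hr) as Hser.
    eapply Cis_series_unique; [apply eta_cos_dirichlet; lra|].
    apply (dirichlet_lin _ _ _ _ _ _ _ _ dilate_3_cos_PI3 Hser).
    rewrite <- INR_3_IZR. apply dirichlet_dilate; [lia|exact Hser].
Qed.

Lemma Chol_Cis_lim (f g : C -> C) (s : C) :
  Chol g s -> (forall z : C, z <> s -> g z = f z) -> Cis_lim f s (g s).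
Proof.
  intros Hg E P [eps HP].
  destruct (Cderiv_cont g s Hg (eps / 2)%R ltac:(pose proof (cond_pos eps); lra)) as [d [Hd K]].
  exists (mkposreal (d / 2) ltac:(lra)). intros w [h1 h2] Hw. simpl in h1, h2.
  apply HP. rewrite <- E by assumption.
  change (Rabs (Re (w - s)%C) < d / 2)%R in h1. change (Rabs (Im (w - s)%C) < d / 2)%R in h2.
  pose proof (Cmod_Re_Im (w - s)).
  specialize (K (w - s) ltac:(lra)). rewrite Cplus_minus_r in K.
  pose proof (cond_pos eps).
  pose proof (re_le_Cmod (g w - g s)). pose proof (im_le_Cmod (g w - g s)).
  split.
  - change (Rabs (Re (g w - g s)%C) < eps)%R. lra.
  - change (Rabs (Im (g w - g s)%C) < eps)%R. lra.
Qed.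

Theorem theorem3p8 (zeta eta : C -> C)
    (Hzeta : is_riemann_zeta zeta) (Heta : is_alternating_zeta eta) (s : C) :
  is_eta_expansion eta (2 * PI / 3)%R s
    (RtoC (3 / 2) * (RtoC 1 - pos_cpow 3 (- s)) * eta s)%C
  /\
  is_eta_expansion eta (PI / 2)%R s
    ((RtoC 1 - pos_cpow 2 (- s)) * eta s)%C
  /\
  (let lhs3 := fun z : C =>
     (RtoC (1 / 2)
        * (RtoC 1 - pos_cpow 2 (RtoC 2 - z) + pos_cpow 3 (RtoC 1 - z))
        * zeta z)%C in
   (s <> RtoC 1 -> is_eta_expansion eta (PI / 3)%R s (lhs3 s)) /\
   (s = RtoC 1 ->
      exists l : C, Cis_lim lhs3 s l /\ is_eta_expansion eta (PI / 3)%R s l)).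
Proof.
  pose proof PI_RGT_0 as Hpi.
  (* The three sums are thus [eta_cos 0 s - eta_cos x s], and only the closed form of [eta_cos x] at
     each angle remains to be inserted. *)
  assert (HE : forall x, (0 < x < PI)%R ->
    is_eta_expansion eta x s (eta_cos 0 s - eta_cos x s)).
  { intros x Hx. apply (is_eta_expansion_ext (eta_cos 0)).
    - now apply alternating_zeta_eta_cos.
    - now apply eta_cos_expansion. }
  assert (E0 := alternating_zeta_eta_cos eta Heta).
  split; [|split].
  - replace (RtoC (3 / 2) * (RtoC 1 - pos_cpow 3 (- s)) * eta s)%C
      with (eta_cos 0 s - eta_cos (2 * PI / 3) s); [apply HE; lra|].
    rewrite E0, (eta_cos_2PI3 eta Heta).
    replace (3 / 2)%R with (1 + 1 / 2)%R by field.
    rewrite RtoC_opp, RtoC_plus. ring.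
  - replace ((RtoC 1 - pos_cpow 2 (- s)) * eta s)%C
      with (eta_cos 0 s - eta_cos (PI / 2) s); [apply HE; lra|].
    rewrite E0, (eta_cos_PI2 eta Heta). ring.
  - intros lhs3.
    (* The two closed forms give [1 - 2 * 2^(-z) - 1/2 + 3/2 * 3^(-z)] times [zeta z], which is
       [1/2 (1 - 2^(2-z) + 3^(1-z))] times [zeta z]. *)
    assert (L3 : forall z : C, z <> RtoC 1 -> eta_cos 0 z - eta_cos (PI / 3) z = lhs3 z).
    { intros z Hz. unfold lhs3.
      rewrite (eta_cos_0_zeta zeta Hzeta z Hz), (eta_cos_PI3_zeta zeta Hzeta z Hz).
      unfold Cminus at 3 4. rewrite !pos_cpow_plus.
      replace (RtoC 2) with (RtoC 1 + RtoC 1) by (rewrite <- RtoC_plus; f_equal; ring).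
      rewrite pos_cpow_plus, !pos_cpow_1 by lra.
      rewrite !RtoC_opp.
      replace (3 / 2)%R with (3 * (1 / 2))%R by field. rewrite (RtoC_mult 3).
      assert (Hh : RtoC 1 = RtoC (1 / 2)%R + RtoC (1 / 2)%R).
      { rewrite <- RtoC_plus. f_equal. field. }
      apply injective_projections; simpl; field. }
    split.
    + intros Hs. rewrite <- L3 by assumption. apply HE. lra.
    (* The witness is the value at [1] of the entire function that equals [lhs3] elsewhere, so
       continuity makes it the limit; the expansion at [1] is already covered by [HE]. *)
    + intros ->. exists (eta_cos 0 1 - eta_cos (PI / 3) 1). split; [|apply HE; lra].
      apply (Chol_Cis_lim lhs3 (fun z => eta_cos 0 z - eta_cos (PI / 3) z)); [|exact L3].
      apply Chol_minus; apply eta_cos_entire; lra.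
Qed.
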